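(* For each $\nu\in\mathcal N_G$, the set $$X_\nu=\{c\in\mathbb{A}(F)_\nu:\ \exists\,a\in A(\overline F)\text{ with } c=c(a)\text{ and }\mathrm{val}\,\Omega(a)=m_\nu\}$$ is non-empty, and for any $a\in A(\overline F)$ with $c(a)\in X_\nu$, any element $h\in W$ with $\sigma(a)=h(a)$ is conjugate in $W$ to $w(\nu)$.
   Context: Let $G$ be a connected reductive group over $\mathbb{C}$ of rank $n$ whose derived group $G_{sc}$ is simply connected, of rank $l$. Fix a maximal torus $A$ and a Borel subgroup $B\supseteq A$; $A_{sc}=A\cap G_{sc}$. $R\subset X^*(A)$ are the roots, $\Delta=\{\alpha_i\}_{i\in I}$, $I=\{1,\dots,l\}$, the simple roots for $B$; $Q(R),Q(R^\vee)$ root and coroot lattices, $P(R),P(R^\vee)$ the dual lattices, $\varpi_i$ the fundamental weights. Choose a $\mathbb{Z}$-basis $\omega_1,\dots,\omega_n$ of $X^*(A)$ with $\omega_i|_{A_{sc}}=\varpi_i$ for $i\le l$ and $\omega_{l+1},\dots,\omega_n$ a basis of the kernel of restriction. $W$ is the Weyl group, $c_i=\sum_{\lambda\in W\omega_i}e^\lambda$, $\mathbb{A}=\mathbb{G}_a^l\times\mathbb{G}_m^{n-l}$, $c=(c_1,\dots,c_n):A\to\mathbb{A}$ (identifying $A/W\cong\mathbb{A}$). $\Omega=\prod_{\alpha\in R}(1-e^\alpha)\in\mathbb{C}[X^*(A)]$ and $m_\nu=\sum_{\alpha\in R}\max\{0,\langle\alpha,\nu\rangle\}$. $F=\mathbb{C}((\epsilon))$,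 $\overline F=\bigcup_n\mathbb{C}((\epsilon^{1/n}))$ with compatible roots, $\sigma$ the Galois generator with $\sigma(\epsilon^{1/n})=e^{2\pi\sqrt{-1}/n}\epsilon^{1/n}$, $\mathrm{val}$ the valuation with $\mathrm{val}(\epsilon^{1/n})=-1/n$. $\mathfrak a=X_*(A)\otimes\mathbb{R}$. For a standard parabolic $P=MN\supseteq B$ with Levi $M\supseteq A$, simple roots $\Delta_M$, roots $R_M$, Weyl group $W_M$: $A_M$ is the identity component of the center of $M$, $\mathfrak a_M=X_*(A_M)\otimes\mathbb{R}=\mathfrak a^{W_M}$, $p_M$ the $W_M$-average, $\Lambda_M=p_M(X_*(A))\cong X_*(A)/Q(R_M^\vee)$, $\Lambda_P^+=\{\nu\in\Lambda_M:\langle\alpha,\nu\rangle>0\ \forall\alpha\in\Delta\setminus\Delta_M\}$, $\mathcal N_G=\coprod_P\Lambda_P^+$. For $\nu\in\mathcal N_G$, $\mathbb{A}(F)_\nu$ is the set of $c\in\mathbb{A}(\overline F)$ for which there is $a\in A(\overline F)$ with $c=c(a)$, $\sigma(a)=g(a)$ for some $g\in W$, and $\langle\lambda,\nu\rangle=\mathrm{val}\,\lambda(a)$ for all $\lambda\in X^*(A)$. $\psi$: for a reduced irreducible root system $R$ with basis $\{\alpha_i\}$, highest root $\tilde\alpha$, let $W_e=P(R^\vee)\rtimes W$ act on $V^*$ ($V=Q(R)\otimes\mathbb{R}$), $P(R^\vee)$ by translations; $C=\{v:\langle\alpha_i,v\rangle>0\ \forall i,\ \langle\tilde\alpha,v\rangle<1\}$;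 the stabilizer $\Gamma_C$ of $C$ in $W_e$ maps isomorphically ($\xi$) onto $W_e/(Q(R^\vee)\rtimes W)\cong P(R^\vee)/Q(R^\vee)$, and $\psi=\mathrm{pr}\circ\xi^{-1}$, $\mathrm{pr}:W_e\to W$; for reducible $R$ take the product over components. $\psi_M$ is the composite $\Lambda_M\cong X_*(A)/Q(R_M^\vee)\to P(R_M^\vee)/Q(R_M^\vee)\xrightarrow{\psi}W_M$, the first map induced by $\lambda\mapsto\langle\cdot,\lambda\rangle|_{Q(R_M)}$. For $\nu\in\Lambda_P^+$, $w(\nu)=\psi_M(\nu)$. *)

(* Defs.v *)
From HB Require Import structures.
From mathcomp Require Import all_boot all_order all_algebra.
From mathcomp Require Import boolp classical_sets fsbigop reals.
From mathcomp Require Import complex.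
From Stdlib Require Import ClassicalEpsilon.

Set Implicit Arguments.
Unset Strict Implicit.
Unset Printing Implicit Defensive.
Import Order.TTheory GRing.Theory Num.Theory.
Local Open Scope ring_scope.
Local Open Scope classical_set_scope.

Section Defs.
Variables (R : realType) (l k N : nat).
Local Notation n := (l + k)%N.
Local Notation C := R[i].
Variables (rt crt : 'I_N -> 'rV[int]_n) (sr : 'I_l -> 'I_N).

Definition pairXY (x y : 'rV[int]_n) : int := \sum_(i < n) x 0 i * y 0 i.
Definition pairXA (x : 'rV[int]_n) (v : 'rV[R]_n) : R := \sum_(i < n) (x 0 i)%:~R * v 0 i.
Definition intv (y : 'rV[int]_n) : 'rV[R]_n := map_mx (fun z : int => z%:~R) y.

Definition sref (i : 'I_N) : 'M[int]_n := 1%:M - (rt i)^T *m crt i.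
Definition actX (w : 'M[int]_n) (x : 'rV[int]_n) : 'rV[int]_n := x *m w^T.
Definition actA (w : 'M[int]_n) (v : 'rV[R]_n) : 'rV[R]_n :=
  v *m map_mx (fun z : int => z%:~R) (invmx w).

Inductive inW : 'M[int]_n -> Prop :=
| inW1 : inW 1%:M
| inWS i w : inW w -> inW (sref i *m w).

Definition based_root_datum : Prop :=
  injective rt /\ injective crt /\
  (forall i, pairXY (rt i) (crt i) = 2) /\
  (forall i j, exists m, rt m = rt j - (pairXY (rt j) (crt i)) *: rt i) /\
  (forall i j, exists m, crt m = crt j - (pairXY (rt i) (crt j)) *: crt i) /\
  (forall i j, rt j != 2%:~R *: rt i) /\
  (forall i, exists c : 'I_l -> int,
      ((forall j, 0 <= c j) \/ (forall j, c j <= 0)) /\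
      rt i = \sum_(j < l) c j *: rt (sr j)) /\
  (forall c : 'I_l -> int, \sum_(j < l) c j *: rt (sr j) = 0 -> forall j, c j = 0) /\
  (forall j, crt (sr j) = delta_mx 0 (lshift k j)).

Definition isRoot (a : 'rV[int]_n) := exists i, rt i = a.
Definition inRM (J : {set 'I_l}) (a : 'rV[int]_n) :=
  exists c : 'I_l -> int, (forall j, j \notin J -> c j = 0) /\
    a = \sum_(j < l) c j *: rt (sr j).
Definition posRM (J : {set 'I_l}) (a : 'rV[int]_n) :=
  isRoot a /\ exists c : 'I_l -> int, (forall j, j \notin J -> c j = 0) /\
    (forall j, 0 <= c j) /\ a = \sum_(j < l) c j *: rt (sr j).

Inductive inWM (J : {set 'I_l}) : 'M[int]_n -> Prop :=
| inWM1 : inWM J 1%:M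
| inWMS i w : inRM J (rt i) -> inWM J w -> inWM J (sref i *m w).

Definition WMset (J : {set 'I_l}) : set 'M[int]_n := [set w | inWM J w].

Definition avg (J : {set 'I_l}) (v : 'rV[R]_n) : 'rV[R]_n :=
  (\sum_(w \in WMset J) (1 : R))^-1 *: \sum_(w \in WMset J) actA w v.

Definition inNG (J : {set 'I_l}) (nu : 'rV[R]_n) : Prop :=
  (exists y : 'rV[int]_n, nu = avg J (intv y)) /\
  forall j, j \notin J -> 0 < pairXA (rt (sr j)) nu.

Definition corootM (J : {set 'I_l}) (q : 'rV[int]_n) :=
  exists z : 'I_N -> int, (forall i, ~ inRM J (rt i) -> z i = 0) /\
    q = \sum_(i < N) z i *: crt i.

Definition alcove (J : {set 'I_l}) (v : 'rV[R]_n) : Prop :=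
  (forall j, j \in J -> 0 < pairXA (rt (sr j)) v) /\
  (forall a, posRM J a -> (forall j, j \in J -> ~ isRoot (a + rt (sr j))) ->
     pairXA a v < 1).

Definition IsWnu (J : {set 'I_l}) (nu : 'rV[R]_n) (w : 'M[int]_n) : Prop :=
  inWM J w /\ exists y : 'rV[int]_n, avg J (intv y) = nu /\
   exists q, corootM J q /\
     forall v, alcove J v <-> alcove J (actA w v + intv (y + q)).

Definition wnu (J : {set 'I_l}) (nu : 'rV[R]_n) : 'M[int]_n :=
  epsilon (inhabits 1%:M) (IsWnu J nu).

(* Puiseux series sum_q f(q) eps^q, coefficients in C *)
Definition puis := rat -> C.
Definition isPuis (f : puis) : Prop :=
  exists N0 : nat, (0 < N0)%N /\ exists q0 : rat,
    forall q, f q != 0 -> q0 <= q /\ exists m : int, q = m%:~R / N0%:R.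
Definition pone : puis := fun q => if q == 0 then 1 else 0.
Definition psub (f g : puis) : puis := fun q => f q - g q.
Definition pmul (f g : puis) : puis :=
  fun q => \sum_(r \in [set: rat]) (f r * g (q - r)).
Definition pinv (f : puis) : puis :=
  epsilon (inhabits pone) (fun g => isPuis g /\ pmul f g = pone).
Definition ppowz (f : puis) (z : int) : puis :=
  match z with
  | Posz m => iter m (pmul f) pone
  | Negz m => iter m.+1 (pmul (pinv f)) pone
  end.
Definition zeta (q : rat) : C := ((absz (denq q)).-root (-1)) ^ (2 * numq q).
Definition psigma (f : puis) : puis := fun q => zeta q * f q.
Definition HasVal (f : puis) (x : R) : Prop :=
  exists q : rat, ratr q = x /\ f (- q) != 0 /\ forall r, r < - q -> f r = 0.

Definition torus (a : 'I_n -> puis) : Prop :=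
  forall i, isPuis (a i) /\ exists g, isPuis g /\ pmul (a i) g = pone.
Definition ev (a : 'I_n -> puis) (x : 'rV[int]_n) : puis :=
  \big[pmul/pone]_(i < n) ppowz (a i) (x 0 i).
Definition orbitW (i : 'I_n) : set 'rV[int]_n :=
  [set x | exists w, inW w /\ x = actX w (delta_mx 0 i)].
Definition cmap (a : 'I_n -> puis) : 'I_n -> puis :=
  fun i q => \sum_(x \in orbitW i) ev a x q.
Definition Omega (a : 'I_n -> puis) : puis :=
  \big[pmul/pone]_(i < N) psub pone (ev a (rt i)).
Definition mnu (nu : 'rV[R]_n) : R := \sum_(i < N) Num.max 0 (pairXA (rt i) nu).
Definition sigmaW (a : 'I_n -> puis) (g : 'M[int]_n) : Prop :=
  forall x, psigma (ev a x) = ev a (actX (invmx g) x).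
Definition inAnu (nu : 'rV[R]_n) (c : 'I_n -> puis) : Prop :=
  exists a, torus a /\ (forall i, c i = cmap a i) /\
    (exists g, inW g /\ sigmaW a g) /\ forall x, HasVal (ev a x) (pairXA x nu).
Definition inXnu (nu : 'rV[R]_n) (c : 'I_n -> puis) : Prop :=
  inAnu nu c /\ exists a, torus a /\ (forall i, c i = cmap a i) /\
    HasVal (Omega a) (mnu nu).
Definition conjW (h w : 'M[int]_n) : Prop :=
  exists u, inW u /\ h = u *m w *m invmx u.
End Defs.

(* Main.v *)
Require Import Defs.
From HB Require Import structures.
From mathcomp Require Import all_boot all_order all_algebra.
From mathcomp Require Import zify ring lra.
From mathcomp Require Import boolp classical_sets fsbigop reals.
From mathcomp Require Import complex.
From mathcomp Require Import sequences exp trigo.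

(** Let [chi] be the point of [A(Fbar)] realising [nu], so [sigma a = g a] with
    [g] in [W], and let [xi] be its leading coefficient.  Comparing valuations
    gives [g nu = nu], hence [g] lies in [W_M]; maximality of [val Omega(a)]
    says exactly that [xi(alpha) <> 1] for every root [alpha] of [M].  Writing
    [xi = exp (u2 + 2 pi i u1)], a generic real combination [v = - (u1 + t u2)]
    avoids all affine root hyperplanes of [M] and satisfies [g v + y = v + nu]
    with [y] a cocharacter averaging to [nu].  So [g], translated by [y], fixes
    (modulo the centre) the alcove of [v]; moving that alcove to the fundamental
    one conjugates [g] into [w(nu)], by simple transitivity of the affine Weyl
    group.  Conversely an averaged fixed point of the alcove automorphism
    attached to [w(nu)] is the exponent of a monomial point of [X_nu].

    Two points with the same image under [c] are [W]-conjugate: a triangularity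
    argument shows that the orbit sums of all weights are determined by those of
    the [omega_i], and then characters are linearly independent. *)

Set Implicit Arguments.
Unset Strict Implicit.
Unset Printing Implicit Defensive.
Import Order.TTheory GRing.Theory Num.Theory.
Local Open Scope ring_scope.

(** * Root data *)

(** Membership in [X_nu] names only [c]: the point carrying the slope [nu], the point carrying the
    valuation of [Omega] and the given [a] may be three different points. Separation over [c] brings
    them together, at the price of conjugating the monodromy.

    The shape of [v] answers two demands. The equation with [y] comes from the arguments of [xi]
    alone, but [xi(alpha) <> 1] may be due to the modulus, so [u1] alone can lie on a hyperplane.
    Moduli are preserved exactly, so [g] fixes [u2], and adding [t u2] keeps the equation. The minus
    sign is due to [val epsilon = -1]: [sigma] multiplies a leading term by [exp (-2 pi i <x, nu>)].

    The affine Weyl group is handled through its action on affine functionals with integer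
    coefficients, whose sign at one base point is the sign of an integer; alcoves enter only
    afterwards. Since simple coroots belong to the chosen basis, a cocharacter of average zero is a
    coroot combination; this makes [w(nu)] unique. Puiseux series are made an integral domain, which
    is all that independence of characters requires. *)

Section Pairing.
Variables l k : nat.
Implicit Types (x y : 'rV[int]_(l + k)) (w : 'M[int]_(l + k)).

Definition actY w y : 'rV[int]_(l + k) := y *m invmx w.

Lemma pairXYE x y : pairXY x y = (x *m y^T) 0 0.
Proof. by rewrite mxE; apply: eq_bigr => i _; rewrite mxE. Qed.
Lemma pairDl x x' y : pairXY (x + x') y = pairXY x y + pairXY x' y.
Proof. by rewrite !pairXYE mulmxDl mxE. Qed.
Lemma pairDr x y y' : pairXY x (y + y') = pairXY x y + pairXY x y'.
Proof. by rewrite !pairXYE linearD mulmxDr mxE. Qed.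
Lemma pairZl c x y : pairXY (c *: x) y = c * pairXY x y.
Proof. by rewrite !pairXYE -scalemxAl mxE. Qed.
Lemma pairZr c x y : pairXY x (c *: y) = c * pairXY x y.
Proof. by rewrite !pairXYE linearZ -scalemxAr mxE. Qed.
Lemma pairNl x y : pairXY (- x) y = - pairXY x y.
Proof. by rewrite -scaleN1r pairZl mulN1r. Qed.
Lemma pairNr x y : pairXY x (- y) = - pairXY x y.
Proof. by rewrite -scaleN1r pairZr mulN1r. Qed.
Lemma pairBl x x' y : pairXY (x - x') y = pairXY x y - pairXY x' y.
Proof. by rewrite pairDl pairNl. Qed.
Lemma pairBr x y y' : pairXY x (y - y') = pairXY x y - pairXY x y'.
Proof. by rewrite pairDr pairNr. Qed.
Lemma pair0l y : pairXY 0 y = 0.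
Proof. by rewrite -(scale0r 0) pairZl mul0r. Qed.
Lemma pair0r x : pairXY x 0 = 0.
Proof. by rewrite -(scale0r 0) pairZr mul0r. Qed.
Lemma pair_suml (I : finType) (P : pred I) (F : I -> 'rV[int]_(l + k)) y :
  pairXY (\sum_(i | P i) F i) y = \sum_(i | P i) pairXY (F i) y.
Proof.
apply: (big_morph (fun x => pairXY x y)) => [x x'|]; first exact: pairDl.
exact: pair0l.
Qed.
Lemma pair_sumr (I : finType) (P : pred I) (F : I -> 'rV[int]_(l + k)) x :
  pairXY x (\sum_(i | P i) F i) = \sum_(i | P i) pairXY x (F i).
Proof.
apply: (big_morph (fun y => pairXY x y)) => [y y'|]; first exact: pairDr.
exact: pair0r.
Qed.
Lemma pair_deltar x i : pairXY x (delta_mx 0 i) = x 0 i.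
Proof.
rewrite /pairXY (bigD1 i) //= mxE !eqxx mulr1 big1 ?addr0 // => j jni.
by rewrite mxE (negPf jni) andbF mulr0.
Qed.
Lemma pair_deltal y i : pairXY (delta_mx 0 i) y = y 0 i.
Proof.
rewrite /pairXY (bigD1 i) //= mxE !eqxx mul1r big1 ?addr0 // => j jni.
by rewrite mxE (negPf jni) andbF mul0r.
Qed.
Lemma pair_act w x y : w \in unitmx -> pairXY (actX w x) (actY w y) = pairXY x y.
Proof.
move=> Uw; rewrite !pairXYE /actX /actY trmx_mul -mulmxA [w^T *m _]mulmxA.
by rewrite -trmx_mul mulVmx // trmx1 mul1mx.
Qed.
Lemma actXM w w' x : actX (w *m w') x = actX w (actX w' x).
Proof. by rewrite /actX trmx_mul mulmxA. Qed.
Lemma actX1 x : actX 1%:M x = x.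
Proof. by rewrite /actX trmx1 mulmx1. Qed.
Lemma actXD w x x' : actX w (x + x') = actX w x + actX w x'.
Proof. exact: mulmxDl. Qed.
Lemma actXZ w c x : actX w (c *: x) = c *: actX w x.
Proof. by rewrite /actX scalemxAl. Qed.
Lemma actXN w x : actX w (- x) = - actX w x.
Proof. exact: mulNmx. Qed.
Lemma actXB w x x' : actX w (x - x') = actX w x - actX w x'.
Proof. by rewrite actXD actXN. Qed.
Lemma actX_inj w : (forall x, actX w x = x) -> w = 1%:M.
Proof.
move=> H; apply: trmx_inj; rewrite trmx1; apply/row_matrixP => i.
by rewrite row1 rowE -/(actX w _) H.
Qed.
Lemma actXK w x : w \in unitmx -> actX (invmx w) (actX w x) = x.
Proof. by move=> Uw; rewrite -actXM mulVmx // actX1. Qed.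
Lemma actXVK w x : w \in unitmx -> actX w (actX (invmx w) x) = x.
Proof. by move=> Uw; rewrite -actXM mulmxV // actX1. Qed.
End Pairing.

Section RootDatum.
Variables (l k N : nat) (rt crt : 'I_N -> 'rV[int]_(l + k)) (sr : 'I_l -> 'I_N).
Hypothesis HRD : based_root_datum rt crt sr.
Local Notation sref := (sref rt crt).
Implicit Types (x y : 'rV[int]_(l + k)) (w : 'M[int]_(l + k)).

Lemma rt_inj : injective rt. Proof. by case: HRD. Qed.
Lemma crt_inj : injective crt. Proof. by case: HRD => _ []. Qed.
Lemma pair2 i : pairXY (rt i) (crt i) = 2. Proof. by case: HRD => _ [_ []]. Qed.
Lemma rt_refl i j : exists m, rt m = rt j - pairXY (rt j) (crt i) *: rt i.
Proof. by case: HRD => _ [_ [_ []]]. Qed.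
Lemma crt_refl i j : exists m, crt m = crt j - pairXY (rt i) (crt j) *: crt i.
Proof. by case: HRD => _ [_ [_ [_ []]]]. Qed.
Lemma rt_reduced i j : rt j != 2%:~R *: rt i.
Proof. by case: HRD => _ [_ [_ [_ [_ []]]]]. Qed.
Lemma rt_decomp i : exists c : 'I_l -> int,
  ((forall j, 0 <= c j) \/ (forall j, c j <= 0)) /\
  rt i = \sum_(j < l) c j *: rt (sr j).
Proof. by case: HRD => _ [_ [_ [_ [_ [_ []]]]]]. Qed.
Lemma simple_free (c : 'I_l -> int) :
  \sum_(j < l) c j *: rt (sr j) = 0 -> forall j, c j = 0.
Proof. by case: HRD => _ [_ [_ [_ [_ [_ [_ [+ _]]]]]]]; apply. Qed.
Lemma crt_simple j : crt (sr j) = delta_mx 0 (lshift k j).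
Proof. by case: HRD => _ [_ [_ [_ [_ [_ [_ [_]]]]]]]. Qed.

Lemma actX_sref i x : actX (sref i) x = x - pairXY x (crt i) *: rt i.
Proof.
rewrite /actX /sref linearB /= trmx1 trmx_mul trmxK mulmxBr mulmx1 mulmxA.
by congr (_ - _); rewrite [x *m _]mx11_scalar mul_scalar_mx pairXYE.
Qed.
Lemma srefK i : sref i *m sref i = 1%:M.
Proof.
apply: actX_inj => x; rewrite actXM !actX_sref pairBl pairZl pair2.
rewrite (_ : _ - _ = - pairXY x (crt i)); last by ring.
by rewrite scaleNr opprK subrK.
Qed.
Lemma sref_unit i : sref i \in unitmx.
Proof. by case/mulmx1_unit: (srefK i). Qed.
Lemma sref_inv i : invmx (sref i) = sref i.
Proof. by rewrite -[LHS]mulmx1 -(srefK i) mulKmx ?sref_unit. Qed.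
Lemma actX_srefK i x : actX (sref i) (actX (sref i) x) = x.
Proof. by rewrite -actXM srefK actX1. Qed.
Lemma actY_sref i y : actY (sref i) y = y - pairXY (rt i) y *: crt i.
Proof.
rewrite /actY sref_inv /sref mulmxBr mulmx1 mulmxA; congr (_ - _).
rewrite [y *m _]mx11_scalar mul_scalar_mx; congr (_ *: _).
by rewrite /pairXY mxE; apply: eq_bigr => j _; rewrite mxE mulrC.
Qed.
Lemma pair_sref i x y :
  pairXY (actX (sref i) x) y = pairXY x (actY (sref i) y).
Proof. by rewrite -(pair_act _ _ (sref_unit i)) actX_srefK. Qed.
Lemma actX_rt i : actX (sref i) (rt i) = - rt i.
Proof. by rewrite actX_sref pair2 scaler_nat mulr2n opprD addrA subrr sub0r. Qed.

Lemma rt_neq0 i : rt i != 0.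
Proof. by apply/eqP => H; move: (pair2 i); rewrite H pair0l. Qed.

Lemma rperm i : exists f : 'I_N -> 'I_N,
  injective f /\ forall j, rt (f j) = actX (sref i) (rt j).
Proof.
have [f Hf] := fin_all_exists (rt_refl i); exists f.
have E j : rt (f j) = actX (sref i) (rt j) by rewrite Hf actX_sref.
split => // a b ab; apply: rt_inj.
by rewrite -(actX_srefK i (rt a)) -E ab E actX_srefK.
Qed.
Lemma cperm i : exists f : 'I_N -> 'I_N,
  injective f /\ forall j, crt (f j) = actY (sref i) (crt j).
Proof.
have [f Hf] := fin_all_exists (crt_refl i); exists f.
have E j : crt (f j) = actY (sref i) (crt j) by rewrite Hf actY_sref.
split => // a b ab; apply: crt_inj.
have /(congr1 (mulmx^~ (sref i))) : actY (sref i) (crt a) = actY (sref i) (crt b).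
  by rewrite -!E ab.
by rewrite /actY !mulmxKV ?sref_unit.
Qed.

(* The invariant form on X^*(A); it determines the coroots from the roots. *)
Definition formX x y : int := \sum_i pairXY x (crt i) * pairXY y (crt i).
Definition formY x y : int := \sum_i pairXY (rt i) x * pairXY (rt i) y.

Lemma formXC x y : formX x y = formX y x.
Proof. by apply: eq_bigr => i _; rewrite mulrC. Qed.
Lemma formXDl x x' y : formX (x + x') y = formX x y + formX x' y.
Proof.
by rewrite /formX -big_split; apply: eq_bigr => i _; rewrite pairDl mulrDl.
Qed.
Lemma formXZl c x y : formX (c *: x) y = c * formX x y.
Proof.
by rewrite /formX mulr_sumr; apply: eq_bigr => i _; rewrite pairZl mulrA.
Qed.
Lemma formXNl x y : formX (- x) y = - formX x y.
Proof. by rewrite -scaleN1r formXZl mulN1r. Qed.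
Lemma formXBl x x' y : formX (x - x') y = formX x y - formX x' y.
Proof. by rewrite formXDl formXNl. Qed.
Lemma formXDr x x' y : formX y (x + x') = formX y x + formX y x'.
Proof. by rewrite formXC formXDl !(formXC y). Qed.
Lemma formXZr c x y : formX y (c *: x) = c * formX y x.
Proof. by rewrite formXC formXZl !(formXC y). Qed.
Lemma formXNr x y : formX y (- x) = - formX y x.
Proof. by rewrite formXC formXNl !(formXC y). Qed.
Lemma formXBr x x' y : formX y (x - x') = formX y x - formX y x'.
Proof. by rewrite formXDr formXNr. Qed.
Lemma formX0l y : formX 0 y = 0.
Proof. by rewrite -(scale0r 0) formXZl mul0r. Qed.
Lemma formX_suml (c : 'I_l -> int) y :
  formX (\sum_j c j *: rt (sr j)) y = \sum_j c j * formX (rt (sr j)) y.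
Proof.
rewrite (big_morph (fun x => formX x y) (id1 := 0) (op1 := +%R)).
- by apply: eq_bigr => j _; rewrite formXZl.
- by move=> x x'; exact: formXDl.
- exact: formX0l.
Qed.
Lemma formX_ge0 x : 0 <= formX x x.
Proof. by apply: sumr_ge0 => i _; rewrite -expr2 sqr_ge0. Qed.

Lemma formX_sref j x y : formX (actX (sref j) x) (actX (sref j) y) = formX x y.
Proof.
have [f [finj Hf]] := cperm j; rewrite /formX [RHS](reindex_inj finj).
by apply: eq_bigr => i _; rewrite !pair_sref Hf.
Qed.
(** Compare the form before and after the reflection in [rt i], which negates [rt i]. Signs of
    Cartan integers can then be read off a symmetric form. *)
Lemma formX_rt x i : 2 * formX x (rt i) = pairXY x (crt i) * formX (rt i) (rt i).
Proof.
have := formX_sref i x (rt i).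
by rewrite actX_rt actX_sref formXNr formXBl formXZl; lia.
Qed.
Lemma formX_rt_gt0 i : 0 < formX (rt i) (rt i).
Proof.
rewrite /formX (bigD1 i) //= pair2 ltr_pwDl //.
by apply: sumr_ge0 => j _; rewrite -expr2 sqr_ge0.
Qed.
Lemma formY_crt y i : 2 * formY y (crt i) = pairXY (rt i) y * formY (crt i) (crt i).
Proof.
have FC u v : formY u v = formY v u by apply: eq_bigr => a _; rewrite mulrC.
have [f [finj Hf]] := rperm i.
have: formY (actY (sref i) y) (actY (sref i) (crt i)) = formY y (crt i).
  rewrite /formY [RHS](reindex_inj finj).
  by apply: eq_bigr => j _; rewrite -!pair_sref Hf.
have -> : formY (actY (sref i) y) (actY (sref i) (crt i)) =
   - formY y (crt i) + pairXY (rt i) y * formY (crt i) (crt i).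
  rewrite /formY mulr_sumr -sumrN -big_split; apply: eq_bigr => j _ /=.
  by rewrite !actY_sref !pairBr !pairZr pair2; ring.
lia.
Qed.
Lemma formY_crt_gt0 i : 0 < formY (crt i) (crt i).
Proof.
rewrite /formY (bigD1 i) //= pair2 ltr_pwDl //.
by apply: sumr_ge0 => j _; rewrite -expr2 sqr_ge0.
Qed.

Definition rootspan x := exists z : 'I_N -> int, x = \sum_i z i *: rt i.

(** Definiteness holds only on the root span, since characters killing every coroot are isotropic.
    On the span, pairing with [x] is, up to the factor [K], the dual form against a combination [d]
    of coroots. As [x] kills [d], the norm of [d] is zero, so [d] kills every root and [x] pairs to
    zero with everything. *)
Lemma formX_eq0 x : rootspan x -> formX x x = 0 -> x = 0.
Proof.
move=> [z Ex] x0.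
have x0' i : pairXY x (crt i) = 0.
  have /psumr_eq0P/(_ x0 i isT)/eqP : forall i, true ->
      0 <= pairXY x (crt i) * pairXY x (crt i).
    by move=> ? _; rewrite -expr2 sqr_ge0.
  by rewrite mulf_eq0 orbb => /eqP.
pose b i := formY (crt i) (crt i).
(* The denominators [b i] are cleared all at once, because only integer coefficients are available;
   hence the products over [j != i] in [d]. *)
pose K := \prod_i b i.
have K0 : K != 0 by apply/prodf_neq0 => i _; rewrite gt_eqF ?formY_crt_gt0.
pose d := \sum_i (2 * z i * \prod_(j | j != i) b j) *: crt i.
have Kx y : K * pairXY x y = formY y d.
  rewrite Ex pair_suml mulr_sumr.
  have -> : formY y d = \sum_i (z i * \prod_(j | j != i) b j) * (2 * formY y (crt i)).
    have -> : formY y d = \sum_j \sum_i pairXY (rt j) y *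
       ((2 * z i * \prod_(j | j != i) b j) * pairXY (rt j) (crt i)).
      apply: eq_bigr => j _; rewrite pair_sumr mulr_sumr.
      by apply: eq_bigr => i _; rewrite pairZr.
    rewrite exchange_big; apply: eq_bigr => i _ /=.
    by rewrite /formY !mulr_sumr; apply: eq_bigr => j _; ring.
  apply: eq_bigr => i _; rewrite formY_crt pairZl /K (bigD1 i) //= -/(b i).
  by ring.
have xd : pairXY x d = 0.
  by rewrite pair_sumr big1 // => i _; rewrite pairZr x0' mulr0.
have d0 i : pairXY (rt i) d = 0.
  have := Kx d; rewrite xd mulr0 => /esym dd.
  have /psumr_eq0P/(_ dd i isT)/eqP : forall i, true ->
      0 <= pairXY (rt i) d * pairXY (rt i) d.
    by move=> ? _; rewrite -expr2 sqr_ge0.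
  by rewrite mulf_eq0 orbb => /eqP.
apply/rowP => i; rewrite -pair_deltar mxE; apply: (mulfI K0).
by rewrite mulr0 Kx /formY big1 // => j _; rewrite d0 mulr0.
Qed.

Lemma rootspan_rt i : rootspan (rt i).
Proof.
exists (fun j => (j == i)%:R); rewrite (bigD1 i) //= eqxx scale1r big1 ?addr0 //.
by move=> j /negPf->; rewrite scale0r.
Qed.
Lemma rootspanD x y : rootspan x -> rootspan y -> rootspan (x + y).
Proof.
move=> [z ->] [z' ->]; exists (fun i => z i + z' i).
by rewrite -big_split; apply: eq_bigr => i _; rewrite scalerDl.
Qed.
Lemma rootspanZ c x : rootspan x -> rootspan (c *: x).
Proof.
move=> [z ->]; exists (fun i => c * z i).
by rewrite scaler_sumr; apply: eq_bigr => i _; rewrite scalerA.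
Qed.
Lemma rootspanB x y : rootspan x -> rootspan y -> rootspan (x - y).
Proof. by move=> hx hy; rewrite -scaleN1r; apply: rootspanD => //; apply: rootspanZ. Qed.

Lemma isRootN i : exists j, rt j = - rt i.
Proof.
by have [m E] := rt_refl i i; exists m; rewrite E pair2 scaler_nat mulr2n opprD addrA subrr sub0r.
Qed.

(* If both Cartan integers are at least 2 the form of the difference is nonpositive. *)
Lemma root_sub i j : 0 < pairXY (rt i) (crt j) -> i != j ->
  exists m, rt m = rt i - rt j.
Proof.
move=> ij nij.
have ji : 0 < pairXY (rt j) (crt i).
  have := formX_rt (rt i) j; have := formX_rt (rt j) i.
  rewrite (formXC (rt j)) => -> /esym H.
  by rewrite -(pmulr_lgt0 _ (formX_rt_gt0 i)) -H mulr_gt0 // formX_rt_gt0.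
have [E|ne1] := eqVneq (pairXY (rt i) (crt j)) 1.
  by have [m Hm] := rt_refl j i; exists m; rewrite Hm E scale1r.
have [E|ne2] := eqVneq (pairXY (rt j) (crt i)) 1.
  have [m Hm] := rt_refl i j; have [m' Hm'] := isRootN m.
  by exists m'; rewrite Hm' Hm E scale1r opprB.
case/eqP: nij; apply: rt_inj; apply/eqP; rewrite -subr_eq0; apply/eqP.
apply: formX_eq0; first by apply: rootspanB; exact: rootspan_rt.
apply/eqP; rewrite eq_le formX_ge0 andbT.
rewrite formXBl !formXBr (formXC (rt j) (rt i)).
have := formX_rt (rt i) j; have := formX_rt (rt j) i.
rewrite (formXC (rt j)).
have := formX_rt_gt0 i; have := formX_rt_gt0 j.
move: (pairXY _ _) (pairXY _ _) (formX _ _) (formX _ _) (formX _ _) ij ji ne1 ne2.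
by move=> p q a b c *; nia.
Qed.

Lemma pair_coroot_ge2 i j : 2 <= pairXY (rt i) (crt j) -> i != j ->
  pairXY (rt j) (crt i) = 1.
Proof.
move=> ij nij.
have ji : 0 < pairXY (rt j) (crt i).
  have := formX_rt (rt i) j; have := formX_rt (rt j) i.
  rewrite (formXC (rt j)) => -> /esym H.
  rewrite -(pmulr_lgt0 _ (formX_rt_gt0 i)) -H mulr_gt0 // ?formX_rt_gt0 //.
  exact: lt_le_trans ij.
apply/eqP/negP => /negP ne2.
case/eqP: nij; apply: rt_inj; apply/eqP; rewrite -subr_eq0; apply/eqP.
apply: formX_eq0; first by apply: rootspanB; exact: rootspan_rt.
apply/eqP; rewrite eq_le formX_ge0 andbT.
rewrite formXBl !formXBr (formXC (rt j) (rt i)).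
have := formX_rt (rt i) j; have := formX_rt (rt j) i.
rewrite (formXC (rt j)).
have := formX_rt_gt0 i; have := formX_rt_gt0 j.
move: (pairXY _ _) (pairXY _ _) (formX _ _) (formX _ _) (formX _ _) ij ji ne2.
by move=> p q a b c *; nia.
Qed.
End RootDatum.

(** * Positive roots, heights and maximal roots *)

Section Positivity.
Variables (l k N : nat) (rt crt : 'I_N -> 'rV[int]_(l + k)) (sr : 'I_l -> 'I_N).
Hypothesis HRD : based_root_datum rt crt sr.
Local Notation sref := (sref rt crt).
Local Notation formX := (formX crt).
Implicit Types (x y : 'rV[int]_(l + k)) (w : 'M[int]_(l + k)).

(** As a functional a coroot is [2 (x, alpha) / (alpha, alpha)], so an isometry matching two roots
    matches their coroots. *)
Lemma crt_equiv (f : 'rV[int]_(l + k) -> 'rV[int]_(l + k)) i j :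
  (forall x y, formX (f x) (f y) = formX x y) -> f (rt i) = rt j ->
  forall x, pairXY (f x) (crt j) = pairXY x (crt i).
Proof.
move=> Hf fi x; apply: (mulIf (lt0r_neq0 (formX_rt_gt0 HRD i))).
have E : formX (rt j) (rt j) = formX (rt i) (rt i) by rewrite -fi Hf.
by rewrite -{1}E -!(formX_rt HRD) -fi Hf.
Qed.

Lemma pairl_eq y y' : (forall x, pairXY x y = pairXY x y') -> y = y'.
Proof. by move=> H; apply/rowP => i; rewrite -!pair_deltal H. Qed.

Lemma crt_neg i j : rt j = - rt i -> crt j = - crt i.
Proof.
move=> E; apply: pairl_eq => x; rewrite pairNr.
apply: (mulIf (lt0r_neq0 (formX_rt_gt0 HRD i))).
have := formX_rt HRD x j; have := formX_rt HRD x i.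
by rewrite E !formXNr formXNl; lia.
Qed.

Lemma pair_form_gt0 x i : (0 < pairXY x (crt i)) = (0 < formX x (rt i)).
Proof.
by rewrite -(pmulr_lgt0 _ (formX_rt_gt0 HRD i)) -(formX_rt HRD) pmulr_rgt0.
Qed.
Lemma pair_form_ge0 x i : (0 <= pairXY x (crt i)) = (0 <= formX x (rt i)).
Proof.
by rewrite -(pmulr_lge0 _ (formX_rt_gt0 HRD i)) -(formX_rt HRD) pmulr_rge0.
Qed.

Definition lincomb (c : 'I_l -> int) := \sum_(j < l) c j *: rt (sr j).

Lemma lincombD c c' : lincomb c + lincomb c' = lincomb (fun j => c j + c' j).
Proof. by rewrite -big_split; apply: eq_bigr => j _; rewrite scalerDl. Qed.
Lemma lincombZ a c : a *: lincomb c = lincomb (fun j => a * c j).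
Proof. by rewrite scaler_sumr; apply: eq_bigr => j _; rewrite scalerA. Qed.
Lemma lincombN c : - lincomb c = lincomb (fun j => - c j).
Proof.
by rewrite -scaleN1r lincombZ; apply: eq_bigr => j _; rewrite mulN1r.
Qed.
Lemma lincomb_delta j : rt (sr j) = lincomb (fun i => (i == j)%:R).
Proof.
rewrite /lincomb (bigD1 j) //= eqxx scale1r big1 ?addr0 // => i /negPf->.
by rewrite scale0r.
Qed.
Lemma lincomb_inj c c' : lincomb c = lincomb c' -> c =1 c'.
Proof.
move=> E j; apply/eqP; rewrite -subr_eq0; apply/eqP.
apply: (simple_free HRD (c := fun j => c j - c' j)).
by rewrite -/(lincomb _) -lincombD -lincombN E subrr.
Qed.
Lemma lincomb_span c : rootspan rt (lincomb c).
Proof.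
rewrite /lincomb; elim/big_ind: _ => [|x y|j _].
- by exists (fun=> 0); rewrite big1 // => i _; rewrite scale0r.
- exact: rootspanD.
- by apply: rootspanZ; exact: rootspan_rt.
Qed.

Definition cone x := exists c : 'I_l -> int, (forall j, 0 <= c j) /\ x = lincomb c.
Definition posr i := cone (rt i).

Lemma cone0 : cone 0.
Proof. by exists (fun=> 0); split=> //; rewrite /lincomb big1 // => i _; rewrite scale0r. Qed.
Lemma coneD x y : cone x -> cone y -> cone (x + y).
Proof.
move=> [c [c0 ->]] [c' [c'0 ->]]; exists (fun j => c j + c' j).
by rewrite lincombD; split => // j; rewrite addr_ge0.
Qed.
Lemma coneZ a x : 0 <= a -> cone x -> cone (a *: x).
Proof.
move=> a0 [c [c0 ->]]; exists (fun j => a * c j); rewrite lincombZ.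
by split => // j; rewrite mulr_ge0.
Qed.
Lemma cone_simple j : posr (sr j).
Proof. by exists (fun i => (i == j)%:R); split => [i|]; rewrite ?ler0n // lincomb_delta. Qed.

(** The reflection changes only the coefficient of [rt (sr j)]. Some other coefficient is positive,
    because reducedness forbids proper multiples of a simple root, and it decides the common
    sign. *)
Lemma sref_pos j i m : posr i -> i != sr j ->
  rt m = actX (sref (sr j)) (rt i) -> posr m.
Proof.
move=> [c [c0 Ei]] nij Em.
have [j' j'j cj'] : exists2 j', j' != j & 0 < c j'.
  apply: contrapT => H.
  have c0' i' : i' != j -> c i' = 0.
    move=> ne; apply/eqP; rewrite eq_le c0 andbT leNgt; apply/negP => ?.
    by apply: H; exists i'.
  have E : rt i = c j *: rt (sr j).
    rewrite Ei /lincomb (bigD1 j) //= big1 ?addr0 // => i' /c0' ->.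
    by rewrite scale0r.
  have := pair2 HRD i; rewrite {1}E pairZl => E2.
  (* [rt i = c j *: rt (sr j)] gives [2 = c j * <rt (sr j), crt i>], so [c j] divides 2. *)
  have cj : c j = 1 \/ c j = 2%:~R.
    move: (c0 j) E2; move: (pairXY _ _) (c j) => p q q0 pq.
    have p0 : 0 < p by nia.
    have q2 : q <= 2 by nia.
    have q1 : q <> 0 by nia.
    lia.
  case: cj => cj.
    by move/eqP: nij; apply; apply: (rt_inj HRD); rewrite E cj scale1r.
  by move: (rt_reduced HRD (sr j) i); rewrite E cj eqxx.
pose p := pairXY (rt i) (crt (sr j)).
have [c' [sgn Em']] := rt_decomp HRD m.
have cc : c' =1 (fun i => c i + - p * (i == j)%:R).
  apply: lincomb_inj; have -> : lincomb c' = rt m by exact: esym.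
  rewrite Em actX_sref -lincombD -(lincombZ _ (fun i => (i == j)%:R)).
  by rewrite -lincomb_delta -Ei scaleNr.
exists c'; split => // j0; case: sgn => // sgn; exfalso.
by move: (sgn j'); rewrite cc (negPf j'j) mulr0 addr0 leNgt cj'.
Qed.

Lemma crt_rt i j m : rt m = actX (sref i) (rt j) -> crt m = actY (sref i) (crt j).
Proof.
move=> E; apply: pairl_eq => x; rewrite -(pair_sref HRD).
have := crt_equiv (formX_sref HRD i) (esym E) (actX (sref i) x).
by rewrite (actX_srefK HRD).
Qed.

(** This is [2 rho^vee]. Pairing with it gives twice the height, hence a measure for inductions and
    a test of positivity; rescaled, it is the base point of the fundamental alcove. *)
Definition y0 := \sum_(i | `[< posr i >]) crt i.

Lemma pair_simple_y0 j : pairXY (rt (sr j)) y0 = 2.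
Proof.
rewrite /y0 (bigD1 (sr j)) /=; last by apply/asboolP; exact: cone_simple.
rewrite pairDr (pair2 HRD); set S := \sum_(i | _) _.
(* The reflection permutes the positive coroots summed in [S], so [<rt (sr j), S>] equals its own
   negative. *)
suff -> : pairXY (rt (sr j)) S = 0 by rewrite addr0.
have [f [finj Hf]] := rperm HRD (sr j).
have fK i : f (f i) = i.
  by apply: (rt_inj HRD); rewrite !Hf (actX_srefK HRD).
have E : actY (sref (sr j)) S = S.
  rewrite {1}/S /actY mulmx_suml -/actY [RHS](reindex_inj finj) /=.
  apply: eq_big => [i|i _]; last first.
    by rewrite -/(actY _ _) -(crt_rt (Hf i)).
  apply/andP/andP => -[/asboolP pi ij]; split.
  - by apply/asboolP; apply: sref_pos (Hf i).
  - apply/eqP => fi; move: pi; rewrite -(fK i) fi => -[c [c0 Ec]].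
    have := Hf (sr j); rewrite (actX_rt HRD) Ec lincomb_delta lincombN.
    move/lincomb_inj/(_ j); rewrite eqxx => Ej; move: (c0 j); rewrite Ej; lia.
  - apply/asboolP; rewrite -(fK i); apply: sref_pos (Hf (f i)) => //.
  - apply/eqP => fi; move: pi; rewrite fi => -[c [c0 Ec]].
    have := Hf (sr j); rewrite (actX_rt HRD) Ec lincomb_delta lincombN.
    move/lincomb_inj/(_ j); rewrite eqxx => Ej; move: (c0 j); rewrite Ej; lia.
have := pair_sref HRD (sr j) (rt (sr j)) S.
rewrite E (actX_rt HRD) pairNl; lia.
Qed.

Lemma lincomb_y0 c : pairXY (lincomb c) y0 = 2 * \sum_j c j.
Proof.
rewrite /lincomb pair_suml mulr_sumr; apply: eq_bigr => j _.
by rewrite pairZl pair_simple_y0 mulrC.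
Qed.
Lemma cone_y0 x : cone x -> 0 <= pairXY x y0.
Proof. by move=> [c [c0 ->]]; rewrite lincomb_y0 mulr_ge0 // sumr_ge0. Qed.
Lemma cone_y0_eq0 x : cone x -> pairXY x y0 = 0 -> x = 0.
Proof.
move=> [c [c0 ->]]; rewrite lincomb_y0 => /eqP; rewrite mulf_eq0 /= => /eqP.
move/psumr_eq0P => H; rewrite /lincomb big1 // => j _.
by rewrite H ?scale0r // => i _; exact: c0.
Qed.
Lemma posr_y0 i : posr i -> 0 < pairXY (rt i) y0.
Proof.
move=> pi; rewrite lt_def cone_y0 // andbT; apply/eqP => /(cone_y0_eq0 pi).
by apply/eqP; exact: rt_neq0 HRD i.
Qed.

(** Strictly above every [|<alpha, y0>|], so that all roots take values strictly between -1 and 1 at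
    [y0 / hbound]. *)
Definition hbound : int := 1 + \sum_i `|pairXY (rt i) y0|.
Lemma hboundP i : `|pairXY (rt i) y0| < hbound.
Proof.
rewrite /hbound (bigD1 i) //= addrCA ltrDl ltr_pwDl //.
by apply: sumr_ge0 => *.
Qed.

Variable J : {set 'I_l}.
Local Notation inRJ := (inRM rt sr J).
Definition coneJ x := exists c : 'I_l -> int, (forall j, j \notin J -> c j = 0) /\
    (forall j, 0 <= c j) /\ x = lincomb c.
Definition posJ i := coneJ (rt i).
Definition negJ i := coneJ (- rt i).
(** The highest roots of the irreducible components of [R_M]. The local condition avoids decomposing
    the root system; [maxr_add] recovers the global one. *)
Definition maxr i := posJ i /\ forall j, j \in J -> ~ isRoot rt (rt i + rt (sr j)).

Lemma coneJ_cone x : coneJ x -> cone x.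
Proof. by move=> [c [_ ?]]; exists c. Qed.
Lemma coneJ_inRM x : coneJ x -> inRJ x.
Proof. by move=> [c [? [_ ?]]]; exists c. Qed.
Lemma coneJD x y : coneJ x -> coneJ y -> coneJ (x + y).
Proof.
move=> [c [cJ [c0 ->]]] [c' [cJ' [c'0 ->]]]; exists (fun j => c j + c' j).
rewrite lincombD; split => [j jJ|]; first by rewrite cJ // cJ'.
by split => // j; rewrite addr_ge0.
Qed.
Lemma coneJ0 : coneJ 0.
Proof.
exists (fun=> 0); split=> //; split => //.
by rewrite /lincomb big1 // => i _; rewrite scale0r.
Qed.
Lemma coneJ_simple j : j \in J -> posJ (sr j).
Proof.
move=> jJ; exists (fun i => (i == j)%:R); split=> [i|]; last first.
  by split => [i|]; rewrite ?ler0n // lincomb_delta.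
by case: eqP => // ->; rewrite jJ.
Qed.
Lemma inRMD x y : inRJ x -> inRJ y -> inRJ (x + y).
Proof.
move=> [c [cJ ->]] [c' [cJ' ->]]; exists (fun j => c j + c' j); split.
  by move=> j jJ; rewrite cJ // cJ'.
exact: lincombD.
Qed.
Lemma inRMZ a x : inRJ x -> inRJ (a *: x).
Proof.
move=> [c [cJ ->]]; exists (fun j => a * c j); split.
  by move=> j jJ; rewrite cJ // mulr0.
exact: lincombZ.
Qed.
Lemma inRMN x : inRJ x -> inRJ (- x).
Proof. by rewrite -scaleN1r; exact: inRMZ. Qed.
Lemma inRMB x y : inRJ x -> inRJ y -> inRJ (x - y).
Proof. by move=> ? ?; apply: inRMD => //; apply: inRMN. Qed.
Lemma inRM_sref i x : inRJ (rt i) -> inRJ x -> inRJ (actX (sref i) x).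
Proof. by move=> ? ?; rewrite actX_sref; apply: inRMB => //; apply: inRMZ. Qed.

Lemma posJP i : posJ i <-> inRJ (rt i) /\ 0 < pairXY (rt i) y0.
Proof.
split => [pi|[[c [cJ Ei]] y]].
  by split; [exact: coneJ_inRM | apply: posr_y0; exact: coneJ_cone].
exists c; split=> //; split => // j.
have [c' [sgn Ei']] := rt_decomp HRD i.
have cc : c =1 c' by apply: lincomb_inj; exact: etrans (esym Ei) Ei'.
rewrite cc; case: sgn => // sgn; exfalso; move: y; rewrite Ei' lincomb_y0.
by rewrite ltNge mulr_ge0_le0 // sumr_le0.
Qed.
Lemma pos_or_neg i : inRJ (rt i) -> posJ i \/ negJ i.
Proof.
move=> [c [cJ Ei]].
have [c' [sgn Ei']] := rt_decomp HRD i.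
have cc : c =1 c' by apply: lincomb_inj; exact: etrans (esym Ei) Ei'.
case: sgn => sgn; [left; exists c | right; exists (fun j => - c j)].
  by split => //; split => // j; rewrite cc.
split => [j /cJ->|]; first by rewrite oppr0.
by rewrite Ei -/(lincomb _) lincombN; split => // j; rewrite cc oppr_ge0.
Qed.
Lemma negJ_y0 i : negJ i -> pairXY (rt i) y0 < 0.
Proof.
have [m Em] := isRootN HRD i.
move=> H; have : posJ m by rewrite /posJ Em.
by move=> /posJP[_]; rewrite Em pairNl; lia.
Qed.

Lemma formX_cone c x : (forall j, 0 <= c j) ->
  (forall j, 0 < c j -> 0 <= formX (rt (sr j)) x) -> 0 <= formX (lincomb c) x.
Proof.
move=> c0 H; rewrite /lincomb formX_suml; apply: sumr_ge0 => j _.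
have [->|cj] := eqVneq (c j) 0; first by rewrite mul0r.
by rewrite mulr_ge0 // H // lt_def cj c0.
Qed.

(** A negative Cartan integer would make [rt i + rt (sr j)] a root, by [root_sub] applied to the
    opposite of the simple root. *)
Lemma maxr_dom i j : maxr i -> j \in J -> 0 <= pairXY (rt i) (crt (sr j)).
Proof.
move=> [pi mi] jJ; rewrite leNgt; apply/negP => H.
have [j' Ej'] := isRootN HRD (sr j).
have [||m Em] := @root_sub _ _ _ _ _ _ HRD i j'.
- by rewrite (crt_neg Ej') pairNr; lia.
- apply/eqP => E; move/posJP: pi => [_]; rewrite E Ej' pairNl pair_simple_y0; lia.
by apply: (mi j jJ); exists m; rewrite Em Ej' opprK.
Qed.

Lemma maxr_coneJ_ge0 i x : maxr i -> coneJ x -> 0 <= formX (rt i) x.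
Proof.
move=> mi [c [cJ [c0 ->]]]; rewrite formXC; apply: formX_cone => // j cj.
rewrite formXC -pair_form_ge0; apply: maxr_dom => //.
by apply: contraTT cj => /cJ->; rewrite ltxx.
Qed.

Lemma pos_term c x : (forall j, 0 <= c j) -> 0 < formX (lincomb c) x ->
  exists2 j, 0 < c j & 0 < formX (rt (sr j)) x.
Proof.
move=> c0 H; apply: contrapT => K; move: H; rewrite ltNge => /negP; apply.
rewrite -oppr_ge0 -formXNr; apply: formX_cone => // j cj.
rewrite formXNr oppr_ge0 leNgt; apply/negP => ?; apply: K; by exists j.
Qed.

(* Induction on the height of [x] reduces the claim to the addition of a simple root. *)
Lemma maxr_add i x : maxr i -> coneJ x -> x != 0 -> ~ isRoot rt (rt i + x).
Proof.
move=> mi [c [cJ [c0 Ex]]]; rewrite {}Ex.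
have [n En] : exists n : nat, \sum_j c j = n%:Z.
  by exists (absz (\sum_j c j)); rewrite gez0_abs // sumr_ge0.
elim: n c cJ c0 En => [|n IH] c cJ c0 En nz [m Em].
  move/eqP: nz; apply; rewrite /lincomb big1 // => j _.
  by move/psumr_eq0P: En => ->; rewrite ?scale0r.
(* A nonzero [x] has positive norm, so some simple root occurring in it pairs positively with [x],
   hence with [rt m], and can be subtracted from [rt m]. *)
have ff : 0 < formX (lincomb c) (lincomb c).
  rewrite lt_def formX_ge0 andbT; apply: contra nz => /eqP H.
  by rewrite (formX_eq0 HRD (lincomb_span c) H).
have [j cj fj] := pos_term c0 ff.
have jJ : j \in J by apply: contraTT cj => /cJ->; rewrite ltxx.
have pm : 0 < pairXY (rt m) (crt (sr j)).
  rewrite pair_form_gt0 Em formXDl (formXC _ (lincomb c)) ltr_wpDl //.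
  by rewrite -pair_form_ge0; exact: maxr_dom.
pose c' j' := c j' - (j' == j)%:R.
have Ec' : lincomb c - rt (sr j) = lincomb c'.
  by rewrite (lincomb_delta j) lincombN lincombD.
have sc' : \sum_j c' j = n%:Z.
  rewrite sumrB En (bigD1 j) //= eqxx big1 => [|j' /negPf->//]; lia.
have c'0 j' : 0 <= c' j'.
  by rewrite /c'; case: eqP => [->|_]; rewrite ?subr0 // subr_ge0.
have [nm|nm] := eqVneq m (sr j).
  have := congr1 (fun x => pairXY x y0) Em; rewrite /= nm pairDl pair_simple_y0 lincomb_y0.
  by case: mi => /posJP[_ +] _; rewrite En; lia.
have [m' Em'] := root_sub HRD pm nm.
have [E0|E0] := eqVneq (lincomb c') 0.
  apply: (proj2 mi j jJ); exists m; rewrite Em; congr (_ + _).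
  by apply/eqP; rewrite -subr_eq0 Ec' E0.
apply: (IH c') => //.
  by move=> j' j'J; rewrite /c' cJ //; case: eqP j'J => // ->; rewrite jJ.
by exists m'; rewrite Em' Em -addrA Ec'.
Qed.

(** Otherwise [gamma = rt i - rt j] is a root, positive by maximality, and dominance of [rt i]
    forces it to be orthogonal to [rt i]. Reflecting [rt j = rt i - gamma] in [gamma] then yields
    the root [rt i + gamma], against maximality. *)
Lemma maxr_pair_lt2 i j : maxr i -> inRJ (rt j) -> j != i ->
  pairXY (rt j) (crt i) < 2.
Proof.
move=> mi hj nij; rewrite ltNge; apply/negP => p2.
have ij := pair_coroot_ge2 HRD p2 nij.
have [m Em] := rt_refl HRD j i; rewrite ij scale1r in Em.
have hm : inRJ (rt m) by rewrite Em; apply: inRMB => //; apply: coneJ_inRM; case: mi.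
have [pm|nm] := pos_or_neg hm; last first.
  apply: (maxr_add mi nm); first by rewrite oppr_eq0 (rt_neq0 HRD).
  by exists j; rewrite Em opprB addrC subrK.
have p0 : pairXY (rt m) (crt i) = 0.
  have : 0 <= pairXY (rt m) (crt i).
    by rewrite pair_form_ge0 formXC; exact: maxr_coneJ_ge0.
  by rewrite Em pairBl (pair2 HRD); lia.
have p0' : pairXY (rt i) (crt m) = 0.
  have := formX_rt HRD (rt i) m; have := formX_rt HRD (rt m) i.
  rewrite p0 (formXC crt (rt m)); have := formX_rt_gt0 HRD m.
  by move: (formX _ _) (formX _ _) (formX _ _) (pairXY _ _) => *; nia.
have [m' Em'] := rt_refl HRD m j.
have Ej : rt j = rt i - rt m by rewrite Em opprB addrC subrK.
apply: (maxr_add mi pm (rt_neq0 HRD m)); exists m'.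
rewrite Em' Ej pairBl p0' (pair2 HRD) sub0r scaleNr opprK scaler_nat mulr2n.
by rewrite addrA subrK.
Qed.

Lemma maxr_sub i j : maxr i -> inRJ (rt j) -> pairXY (rt j) (crt i) = 1 ->
  exists2 m, rt m = rt i - rt j & posJ m.
Proof.
move=> mi hj p1.
have [m' Em'] := rt_refl HRD i j; rewrite p1 scale1r in Em'.
have [m Em] := isRootN HRD m'; exists m; first by rewrite Em Em' opprB.
have hm : inRJ (rt m).
  rewrite Em Em'; apply: inRMN; apply: inRMB => //; apply: coneJ_inRM.
  by case: mi.
have [//|nm] := pos_or_neg hm; exfalso.
apply: (maxr_add mi nm); first by rewrite oppr_eq0 (rt_neq0 HRD).
by exists j; rewrite Em opprK Em' addrC subrK.
Qed.

Lemma climb i : posJ i -> exists2 t, maxr t & coneJ (rt t - rt i).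
Proof.
have [n] : exists n : nat, n%:Z = hbound - pairXY (rt i) y0.
  exists `|hbound - pairXY (rt i) y0|%N; rewrite gez0_abs //.
  by have := hboundP i; lia.
elim/ltn_ind: n i => n IH i En pi.
have [mi|mi] := pselect (maxr i).
  by exists i => //; rewrite subrr; exact: coneJ0.
have [j jJ [m Em]] : exists2 j, j \in J & isRoot rt (rt i + rt (sr j)).
  apply: contrapT => H; apply: mi; split => // j jJ ?; apply: H; by exists j.
have pm : posJ m by rewrite /posJ Em; apply: coneJD => //; exact: coneJ_simple.
have yE : pairXY (rt m) y0 = pairXY (rt i) y0 + 2 by rewrite Em pairDl pair_simple_y0.
have lt_n : (absz (hbound - pairXY (rt m) y0) < n)%N by have := hboundP m; rewrite yE; lia.
have Ea : absz (hbound - pairXY (rt m) y0) = hbound - pairXY (rt m) y0 :> int.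
  by rewrite gez0_abs //; have := hboundP m; lia.
have [t mt ct] := IH _ lt_n m Ea pm.
exists t => //; have -> : rt t - rt i = rt t - rt m + rt (sr j).
  by rewrite Em opprD addrA subrK.
by apply: coneJD => //; exact: coneJ_simple.
Qed.
End Positivity.

(** * Affine roots and the affine Weyl group *)

Lemma invmx_mul (R : comUnitRingType) n (A B : 'M[R]_n) :
  A \in unitmx -> B \in unitmx -> invmx (A *m B) = invmx B *m invmx A.
Proof.
move=> UA UB; have UAB : A *m B \in unitmx by rewrite unitmx_mul UA.
have E : invmx B *m invmx A *m (A *m B) = 1%:M by rewrite mulmxA mulmxKV ?mulVmx.
by rewrite -[RHS](mulmxK UAB) E mul1mx.
Qed.

Section AffineRoots.
Variables (l k N : nat) (rt crt : 'I_N -> 'rV[int]_(l + k)) (sr : 'I_l -> 'I_N).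
Hypothesis HRD : based_root_datum rt crt sr.
Variable J : {set 'I_l}.
Local Notation sref := (sref rt crt).
Local Notation inW := (inW rt crt).
Local Notation inWJ := (inWM rt crt sr J).
Local Notation inRJ := (inRM rt sr J).
Local Notation posJ := (posJ rt sr J).
Local Notation maxr := (maxr rt sr J).
Local Notation formX := (formX crt).
Local Notation y0 := (y0 rt crt sr).
Local Notation H := (hbound rt crt sr).
Local Notation V := ('rV[int]_(l + k) * int)%type.
Implicit Types (x y : 'rV[int]_(l + k)) (w : 'M[int]_(l + k)) (b : V) (a : 'I_N * int).

(* The pair [(x, m)] stands for the affine functional [v |-> <x, v> + m]. *)
Definition el a : V := (rt a.1, a.2).
Definition saff a b : V :=
  (b.1 - pairXY b.1 (crt a.1) *: rt a.1, b.2 - pairXY b.1 (crt a.1) * a.2).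
Definition oppV b : V := (- b.1, - b.2).
(* [mu] is, up to scaling, evaluation at the point [y0 / H] of the fundamental alcove. *)
Definition mu b : int := pairXY b.1 y0 + H * b.2.
Definition affr b := exists i, inRJ (rt i) /\ b.1 = rt i.
Definition posA b := affr b /\ 0 < mu b.
Definition simpF a := exists2 j, j \in J & a = (sr j, 0).
(** Besides the simple roots, the functionals [1 - theta] for [theta] maximal: the walls of the
    alcove, with one affine node per component. *)
Definition simpA a := simpF a \/ (exists t, [/\ maxr t, rt a.1 = - rt t & a.2 = 1]).
Definition act (u : seq ('I_N * int)) b := foldr saff b u.
Definition word (P : 'I_N * int -> Prop) (u : seq ('I_N * int)) := forall a, a \in u -> P a.

Lemma saff1 a b : (saff a b).1 = actX (sref a.1) b.1.
Proof. by rewrite actX_sref. Qed.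
Lemma saffK a b : saff a (saff a b) = b.
Proof.
case: b => x m; congr pair; first by rewrite /= -!actX_sref (actX_srefK HRD).
by rewrite /= pairBl pairZl (pair2 HRD); ring.
Qed.
Lemma saff_el a : saff a (el a) = oppV (el a).
Proof.
rewrite /saff /oppV /= (pair2 HRD); congr pair; last by ring.
by rewrite scaler_nat mulr2n opprD addrA subrr sub0r.
Qed.
Lemma mu_opp b : mu (oppV b) = - mu b.
Proof. by rewrite /mu /= pairNl; ring. Qed.
Lemma mu_saff a b : mu (saff a b) = mu b - pairXY b.1 (crt a.1) * mu (el a).
Proof. by rewrite /mu /saff /= pairBl pairZl; ring. Qed.
Lemma affr_saff a b : inRJ (rt a.1) -> affr b -> affr (saff a b).
Proof.
move=> ha [i [hi Eb]]; have [m Em] := rt_refl HRD a.1 i.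
by exists m; rewrite Em /= Eb; split=> //; apply: inRMB => //; exact: inRMZ.
Qed.
Lemma affr_opp b : affr b -> affr (oppV b).
Proof.
move=> [i [hi Eb]]; have [m Em] := isRootN HRD i.
by exists m; rewrite Em /= Eb; split => //; exact: inRMN.
Qed.

(** As [|p| < H], the integer [m] dominates: positivity of an affine root at [y0 / H] is
    lexicographic in [(m, p)]. *)
Lemma mu_sign (p m : int) : p != 0 -> `|p| < H -> 0 < p + H * m ->
  (0 < p /\ 0 <= m) \/ (p < 0 /\ 1 <= m).
Proof.
move=> p0 pH h; have H0 : 0 < H by apply: le_lt_trans pH.
have [m0|m1] := lerP 1 m.
  by case: (ltrgtP p 0) p0 => // hp _; [right|left; split=> //; lia].
have [m0|m0] := lerP 0 m; last by exfalso; nia.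
have E : m = 0 by lia.
by move: h; rewrite E mulr0 addr0 => h; left.
Qed.
Lemma mu_signV (p m : int) : `|p| < H ->
  (0 < p /\ 0 <= m) \/ (p < 0 /\ 1 <= m) -> 0 < p + H * m.
Proof. 
move=> pH h; have H0 : 0 < H by apply: le_lt_trans pH.
by case: h => -[h1 h2]; nia.
Qed.

Lemma rt_y0_neq0 i : inRJ (rt i) -> pairXY (rt i) y0 != 0.
Proof.
by move=> /(pos_or_neg HRD)[/(posJP HRD)[_ ?]|/(negJ_y0 HRD) ?]; lia.
Qed.
Lemma posA_dich b : affr b -> posA b \/ posA (oppV b).
Proof.
move=> hb; suff : mu b != 0.
  rewrite neq_lt => /orP[h|h]; [right|left]; split => //.
    exact: affr_opp.
  by rewrite mu_opp oppr_gt0.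
case: hb => i [hi Eb]; have := rt_y0_neq0 hi; have := hboundP rt crt sr i.
rewrite /mu Eb; move: (pairXY _ _) H (b.2) => p h m *.
apply/eqP => E.
have [m0|m0] := eqVneq m 0; first by move: E; rewrite m0 mulr0 addr0; lia.
by nia.
Qed.
Lemma posA_opp b : posA b -> ~ posA (oppV b).
Proof. by move=> [_ h] [_]; rewrite mu_opp; lia. Qed.

Lemma maxr_inRM t : maxr t -> inRJ (rt t).
Proof. by move=> [/coneJ_inRM]. Qed.
Lemma simpA_inRM a : simpA a -> inRJ (rt a.1).
Proof.
case=> [[j jJ ->]|[t [/maxr_inRM mt -> _]]]; last exact: inRMN.
by apply: coneJ_inRM; exact: coneJ_simple.
Qed.
Lemma simpA_pos a : simpA a -> posA (el a).
Proof.
move=> sa; split; first by exists a.1; split => //; exact: simpA_inRM.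
case: sa => [[j jJ ->]|[t [mt E E1]]]; rewrite /mu /=.
  by rewrite mulr0 addr0 pair_simple_y0.
by rewrite E E1 mulr1 pairNl; have := hboundP rt crt sr t; lia.
Qed.

Lemma posA_cases b i : b.1 = rt i -> posA b -> (posJ i /\ 0 <= b.2) \/
  (0 < - pairXY (rt i) y0 /\ 1 <= b.2).
Proof.
move=> Eb [[i' [hi Eb']] m]; have /(rt_inj HRD) ii := etrans (esym Eb) Eb'; subst i'.
have := mu_sign (rt_y0_neq0 hi) (hboundP rt crt sr i).
rewrite /mu Eb in m => /(_ _ m)[[h1 h2]|[h1 h2]]; [left|right; lia].
by split=> //; apply/(posJP HRD).
Qed.

(** The affine counterpart of [sref_pos]. For the wall [1 - theta] it rests on [<beta, theta^vee>]
    being -1, 0 or 1 unless [beta] is [theta] or [- theta]. *)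
Lemma saff_posA a b : simpA a -> posA b -> b <> el a -> posA (saff a b).
Proof.
move=> sa pb nb.
have hS : affr (saff a b) by apply: affr_saff (pb.1); exact: simpA_inRM.
split => //; have [[i [hi Eb]] _] := pb.
have cb := posA_cases Eb pb.
have [m [hm Em]] := hS.
rewrite /mu Em; apply: mu_signV; first exact: hboundP.
have [i' Ei'] := isRootN HRD i.
have hi' : inRJ (rt i') by rewrite Ei'; exact: inRMN.
case: sa => [[j jJ Ea]|[t [mt Et Et1]]].
  rewrite Ea /= mulr0 subr0.
  have Em' : rt m = actX (sref (sr j)) (rt i) by rewrite -Em saff1 Eb Ea.
  case: cb => [[pi b0]|[ni b1]].
    have [ij|nij] := eqVneq i (sr j); [right|left].
      split; first by rewrite Em' ij (actX_rt HRD) pairNl (pair_simple_y0 HRD).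
      have b0' : b.2 <> 0.
        by move=> b0'; apply: nb; rewrite [b]surjective_pairing Eb ij b0' Ea.
      by lia.
    by split=> //; apply: (posr_y0 HRD); apply: (sref_pos HRD (coneJ_cone pi) nij Em').
  have pi' : posJ i' by apply/(posJP HRD); split => //; rewrite Ei' pairNl.
  have [ij|nij] := eqVneq i' (sr j); [left|right].
    split; last by lia.
    have -> : rt m = - actX (sref (sr j)) (rt i') by rewrite Em' Ei' actXN opprK.
    by rewrite ij (actX_rt HRD) opprK (pair_simple_y0 HRD).
  split=> //; have [m' Em2] := isRootN HRD m.
  have /(posr_y0 HRD) : posr rt sr m'.
    apply: (sref_pos HRD (coneJ_cone pi') nij).
    by rewrite Em2 Em' Ei' actXN.
  by rewrite Em2 pairNl; lia.
have ca := crt_neg HRD Et.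
have Em' : rt m = rt i - pairXY (rt i) (crt t) *: rt t.
  by rewrite -Em /= Eb Et ca pairNr scalerN scaleNr opprK.
have E2 : (saff a b).2 = b.2 + pairXY (rt i) (crt t).
  by rewrite /= Eb ca Et1 pairNr; ring.
rewrite E2.
have pt : 0 < pairXY (rt t) y0 by case: (mt) => /(posJP HRD)[].
(* Here [theta + m] with [m >= 0] becomes [- theta + (m + 2)]. *)
have [it|nit] := eqVneq i t.
  rewrite Em' it (pair2 HRD) pairBl pairZl.
  right; split; first by lia.
  by case: cb => -[]; [lia|rewrite it; lia].
(* Here [- theta + m] with [m >= 1] becomes [theta + (m - 2)]; the wall itself, [m = 1], is
   excluded, so [m >= 2]. *)
have [i't|ni't] := eqVneq i' t.
  have Eti : rt i = - rt t by rewrite -i't Ei' opprK.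
  rewrite Em' Eti pairNl (pair2 HRD) pairBl pairNl pairZl.
  left; split; first by lia.
  have nb1 : b.2 <> 1.
    by move=> b1; apply: nb; rewrite [b]surjective_pairing Eb Eti b1 /el Et Et1.
  case: cb => -[]; last by lia.
  by move/(posJP HRD) => [_]; rewrite Eti pairNl; lia.
have p1 := maxr_pair_lt2 HRD mt hi nit.
have := maxr_pair_lt2 HRD mt hi' ni't; rewrite Ei' pairNl => p2.
have [p0|p0] := eqVneq (pairXY (rt i) (crt t)) 0.
  rewrite Em' p0 scale0r subr0 addr0.
  by case: cb => [[/(posJP HRD)[_ ?] ?]|[? ?]]; [left|right; lia].
have [pe|pe] := eqVneq (pairXY (rt i) (crt t)) 1.
  have [m' E' /(posJP HRD)[_]] := maxr_sub HRD mt hi pe.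
  rewrite E' Em' pe scale1r !pairBl => ?; right; split; first by lia.
  by case: cb => -[]; lia.
have pe' : pairXY (rt i') (crt t) = 1 by rewrite Ei' pairNl; lia.
have [m' E' /(posJP HRD)[_]] := maxr_sub HRD mt hi' pe'.
rewrite E' Em' Ei' (_ : pairXY (rt i) (crt t) = -1); last by lia.
rewrite scaleN1r pairBl pairNl => ?; left; split; first by rewrite pairBl pairNl; lia.
case: cb => -[]; last by lia.
move=> /(maxr_coneJ_ge0 HRD mt); rewrite formXC -(pair_form_ge0 HRD); lia.
Qed.

Lemma descentF i : posJ i -> exists2 j, j \in J & 0 < pairXY (rt i) (crt (sr j)).
Proof.
move=> [c [cJ [c0 Ei]]].
have : 0 < formX (lincomb rt sr c) (rt i) by rewrite -Ei (formX_rt_gt0 HRD).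
move/(pos_term c0) => [j cj fj]; exists j.
  by apply: contraTT cj => /cJ->; rewrite ltxx.
by rewrite (pair_form_gt0 HRD) formXC.
Qed.

(** For a negative gradient [- beta'], take a maximal root [theta] above [beta']. If no simple root
    serves, [beta'] pairs nonnegatively with those in [J], so [(beta', theta) >= (beta', beta') > 0]
    and the wall [1 - theta] serves. *)
Lemma descentA b : posA b -> exists2 a, simpA a & 0 < pairXY b.1 (crt a.1).
Proof.
move=> pb; have [[i [hi Eb]] _] := pb.
have [pi|ni] := pos_or_neg HRD hi.
  by have [j jJ ?] := descentF pi; exists (sr j, 0); rewrite ?Eb //; left; exists j.
have [i' Ei'] := isRootN HRD i.
have pi' : posJ i' by rewrite /posJ Ei'.
apply: contrapT => K.
have [t mt [c [cJ [c0 Et]]]] := climb HRD pi'.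
have [t' Et'] := isRootN HRD t.
have : 0 <= pairXY (rt i) (crt t).
  rewrite leNgt; apply/negP => ?; apply: K; exists (t', 1).
    by right; exists t.
  by rewrite /= Eb (crt_neg HRD Et') pairNr; lia.
rewrite (pair_form_ge0 HRD).
have -> : rt t = rt i' + lincomb rt sr c by rewrite -Et addrC subrK.
rewrite -[rt i]opprK -Ei' formXNl formXDr oppr_ge0 leNgt => /negP; apply.
rewrite ltr_pwDl ?(formX_rt_gt0 HRD) // formXC; apply: formX_cone => // j cj.
have jJ : j \in J by apply: contraTT cj => /cJ->; rewrite ltxx.
rewrite formXC Ei' formXNl oppr_ge0 leNgt -(pair_form_gt0 HRD); apply/negP => h.
by apply: K; exists (sr j, 0); rewrite ?Eb //; left; exists j.
Qed.

Lemma act_cat u v b : act (u ++ v) b = act u (act v b).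
Proof. by rewrite /act foldr_cat. Qed.
Lemma act_rev u b : act u (act (rev u) b) = b.
Proof.
elim: u b => [|a u IH] b //; rewrite rev_cons -cats1 act_cat /= IH.
exact: saffK.
Qed.
Lemma act_lin u (p : int) b b' :
  act u (b.1 - p *: b'.1, b.2 - p * b'.2) =
  ((act u b).1 - p *: (act u b').1, (act u b).2 - p * (act u b').2).
Proof.
elim: u => //= a u ->; rewrite /saff /= pairBl pairZl; congr pair; last by ring.
rewrite scalerBl scalerBr scalerA !opprD !opprK -!addrA; congr (_ + _).
by rewrite addrCA.
Qed.
Lemma act_opp u b : act u (oppV b) = oppV (act u b).
Proof.
elim: u => //= a u ->; rewrite /saff /oppV /= pairNl; congr pair; last by ring.
by rewrite scaleNr opprB opprK addrC.
Qed.
Lemma act_form u b b' : formX (act u b).1 (act u b').1 = formX b.1 b'.1.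
Proof. by elim: u => //= a u <-; rewrite -!actX_sref (formX_sref HRD). Qed.

(** Conjugating a reflection by [u] gives the reflection in the image root, because [u] preserves
    the form and the form determines coroots. *)
Lemma act_conj u a c b : act u (el a) = el c -> act u (saff a b) = saff c (act u b).
Proof.
move=> E; have E1 : (act u (el a)).1 = rt c.1 by rewrite E.
have Ep : pairXY b.1 (crt a.1) = pairXY (act u b).1 (crt c.1).
  apply: (mulIf (lt0r_neq0 (formX_rt_gt0 HRD a.1))).
  rewrite -(formX_rt HRD) -(act_form u b (el a)) E1.
  by rewrite -[in RHS](act_form u (el a) (el a)) E1 -(formX_rt HRD).
by rewrite {1}/saff (act_lin u _ b (el a)) E Ep.
Qed.

Lemma wordP_cat P u v : word P u -> word P v -> word P (u ++ v).
Proof. by move=> hu hv a; rewrite mem_cat => /orP[/hu|/hv]. Qed.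
Lemma word_rev P u : word P u -> word P (rev u).
Proof. by move=> hu a; rewrite mem_rev => /hu. Qed.

(* The exchange argument: if the last letter's root is sent to a negative root, some
   suffix sends it to a simple root and two letters cancel. *)
Lemma reduced_word P u : (forall a, P a -> simpA a) -> word P u ->
  exists u', [/\ word P u', act u' =1 act u, (size u' <= size u)%N &
    u' = [::] \/ exists u'' a, u' = rcons u'' a /\ posA (act u'' (el a))].
Proof.
move=> PS; have [n] := ubnP (size u); elim: n u => // n IH u un hu.
case/lastP: u un hu => [|u a] un hu; first by exists [::]; split=> //; left.
have ha : simpA a by apply: PS; apply: hu; rewrite mem_rcons mem_head.
have hu' : word P u by move=> c cu; apply: hu; rewrite mem_rcons inE cu orbT.
have [pu|npu] := pselect (posA (act u (el a))).
  by exists (rcons u a); split => //; right; exists u, a.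
suff [p [c [q [Eu Eq]]]] : exists p c q, u = p ++ c :: q /\ act q (el a) = el c.
  have hpq : word P (p ++ q).
    by move=> d; rewrite mem_cat => dpq; apply: hu'; rewrite Eu mem_cat inE orbCA dpq orbT.
  have spq : (size (p ++ q) < n)%N.
    by move: un; rewrite size_rcons Eu !size_cat /=; lia.
  have [u' [h1 h2 h3 h4]] := IH _ spq hpq; exists u'; split => // [b|].
    by rewrite h2 -cats1 Eu !act_cat /= (act_conj b Eq) saffK.
  by apply: leq_trans h3 _; rewrite size_rcons Eu !size_cat /=; lia.
elim: u npu hu' {un hu} => [|c q IHq] /= npu hq.
  by case: npu; exact: simpA_pos.
have hq' : word P q by move=> d dq; apply: hq; rewrite inE dq orbT.
have [pq|npq] := pselect (posA (act q (el a))).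
  exists [::], c, q; split => //; apply: contrapT => ne; apply: npu.
  by apply: saff_posA => //; apply: PS; apply: hq; rewrite mem_head.
by have [p [d [r [-> Er]]]] := IHq npq hq'; exists (c :: p), d, r.
Qed.

(** A nonempty reduced word sends the root of its last letter to a negative one. This is the
    freeness half of simple transitivity. *)
Lemma word_trivial u : word simpA u ->
  (forall b, posA b -> posA (act u b)) -> forall b, act u b = b.
Proof.
move=> hu pu b; have [u' [hu' E _ [E0|[u'' [a [Eu' pa]]]]]] := reduced_word (fun=> id) hu.
  by rewrite -E E0.
exfalso; have ha : simpA a by apply: hu'; rewrite Eu' mem_rcons mem_head.
have := pu _ (simpA_pos ha); rewrite -E Eu' -cats1 act_cat /= saff_el act_opp.
exact: posA_opp.
Qed.

(** Each reflection lowers [mu], so the descent ends at a simple root. The invariant [Q] serves the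
    finite case, where the constant term must stay zero. *)
Lemma generation (P : 'I_N * int -> Prop) (Q : V -> Prop) :
  (forall b, Q b -> posA b -> (exists2 a, P a & b = el a) \/
     (exists a, [/\ P a, Q (saff a b), posA (saff a b) & mu (saff a b) < mu b])) ->
  forall b, Q b -> posA b -> exists u a, word P (a :: u) /\ b = act u (el a).
Proof.
move=> step b; have [n] : exists n : nat, mu b <= n%:Z.
  by exists (absz (mu b)); lia.
elim: n b => [|n IH] b bn qb pb; first by move: (pb.2); lia.
case: (step b qb pb) => [[a Pa Ea]|[a [Pa qa pa ma]]].
  by exists [::], a; split=> // c; rewrite inE => /eqP->.
have [||//|u [c [hu Eu]]] := IH (saff a b); [by lia|by []|].
exists (a :: u), c; split; last by rewrite /= -Eu saffK.
by move=> d; rewrite !inE => /or3P[/eqP->|/eqP->|du] //; apply: hu; rewrite inE ?eqxx ?du ?orbT.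
Qed.

Lemma reflection_word P u a c : word P (a :: u) -> el c = act u (el a) ->
  exists2 v, word P v & saff c =1 act v.
Proof.
move=> hu Ec; exists (u ++ [:: a] ++ rev u).
  have hu' : word P u by move=> d du; apply: hu; rewrite inE du orbT.
  apply: wordP_cat => //; apply: wordP_cat; last exact: word_rev.
  by move=> d; rewrite inE => /eqP ->; apply: hu; rewrite mem_head.
move=> b; rewrite act_cat /= (act_conj (c := c)) ?act_rev //.
Qed.

Lemma saff_neg i i' (m : int) b : rt i' = - rt i -> saff (i', - m) b = saff (i, m) b.
Proof.
move=> E; rewrite /saff /= E (crt_neg HRD E) pairNr; congr pair; last by ring.
by rewrite scalerN scaleNr opprK.
Qed.

Lemma reflectionA i m : inRJ (rt i) -> exists2 v, word simpA v & saff (i, m) =1 act v.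
Proof.
have gen i1 m1 : posA (el (i1, m1)) -> exists2 v, word simpA v & saff (i1, m1) =1 act v.
  move=> p1; have step b : True -> posA b -> (exists2 a, simpA a & b = el a) \/
     (exists a, [/\ simpA a, True, posA (saff a b) & mu (saff a b) < mu b]).
    move=> _ pb; have [a sa pa] := descentA pb.
    have [E|nE] := pselect (b = el a); first by left; exists a.
    right; exists a; split => //; first exact: saff_posA.
    by rewrite mu_saff gtrBl mulr_gt0 //; case: (simpA_pos sa).
  have [u [a [hu Eu]]] := @generation simpA (fun=> True) step (el (i1, m1)) I p1.
  exact: reflection_word hu Eu.
move=> hi; have : affr (el (i, m)) by exists i.
case/posA_dich => [/gen//|p1].
have [i' Ei'] := isRootN HRD i.
have [|v hv Ev] := gen i' (- m); first by rewrite /el /= Ei'.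
by exists v => // b; rewrite -Ev (saff_neg _ _ Ei').
Qed.

Lemma reflectionF i : inRJ (rt i) -> exists2 v, word simpF v & saff (i, 0) =1 act v.
Proof.
have gen i1 : posJ i1 -> exists2 v, word simpF v & saff (i1, 0) =1 act v.
  move=> p1; have [||//|u [a [hu Eu]]] :=
    @generation simpF (fun b => b.2 = 0) _ (el (i1, 0)).
  - move=> b b0 pb; have [[i2 [hi2 Eb]] _] := pb.
    have /descentF[j jJ pj] : posJ i2.
      by case: (posA_cases Eb pb) => [[]//|[]]; rewrite b0.
    have sj : simpA (sr j, 0) by left; exists j.
    have [E|nE] := pselect (b = el (sr j, 0)); first by left; exists (sr j, 0) => //; exists j.
    right; exists (sr j, 0); split; [by exists j| |exact: saff_posA|].
      by rewrite /= b0 mulr0 subr0.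
    by rewrite mu_saff Eb gtrBl mulr_gt0 //; case: (simpA_pos sj).
  - by [].
  - split; first by exists i1; split=> //; exact: coneJ_inRM.
    by rewrite /mu /= mulr0 addr0; case/(posJP HRD): p1.
  exact: reflection_word hu Eu.
move=> hi; case: (pos_or_neg HRD hi) => [/gen//|p1].
have [i' Ei'] := isRootN HRD i.
have [|v hv Ev] := gen i'; first by rewrite /posJ Ei'.
by exists v => // b; rewrite -Ev -(saff_neg 0 b Ei') oppr0.
Qed.

(* [actF w q b] is the affine functional [b] composed with [v |-> w v + q]. *)
Definition actF w q b : V := (actX (invmx w) b.1, b.2 + pairXY b.1 q).

Lemma inWM_unit w : inWJ w -> w \in unitmx.
Proof.
elim=> [|i {}w _ _ IH]; first exact: unitmx1.
by rewrite unitmx_mul (sref_unit HRD).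
Qed.

Lemma inW_unit w : inW w -> w \in unitmx.
Proof.
elim=> [|i {}w _ IH]; first exact: unitmx1.
by rewrite unitmx_mul (sref_unit HRD).
Qed.
(** Single reflections are words by [reflectionA]; translation by a coroot is the product of two
    parallel reflections, so [q] is built up term by term. *)
Lemma actF_word w : inWJ w -> forall q, corootM rt crt sr J q ->
  exists2 v, word simpA v & actF w q =1 act v.
Proof.
pose G (f : V -> V) := exists2 v, word simpA v & f =1 act v.
have Gcomp f g : G f -> G g -> G (f \o g).
  move=> [u hu Eu] [v hv Ev]; exists (u ++ v); first exact: wordP_cat.
  by move=> b; rewrite act_cat /= Eu Ev.
have Gext f g : f =1 g -> G g -> G f.
  by move=> E [u hu Eu]; exists u => // b; rewrite E Eu.
move=> ww q [z [z0 Eq]].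
have Gw : G (actF w 0).
  elim: ww => [|i {}w hi ww IH].
    by exists [::] => // -[x m]; rewrite /actF invmx1 actX1 pair0r addr0.
  apply: Gext (Gcomp _ _ IH (reflectionA 0 hi)) => -[x m].
  rewrite /actF /= !pair0r !addr0 mulr0 subr0 -actX_sref -actXM; congr (actX _ _, _).
  by rewrite invmx_mul ?(sref_inv HRD) ?(sref_unit HRD) ?(inWM_unit ww).
have G0 : G (actF 1%:M 0).
  by exists [::] => // -[x m]; rewrite /actF invmx1 actX1 pair0r addr0.
have GD p p' : G (actF 1%:M p) -> G (actF 1%:M p') -> G (actF 1%:M (p + p')).
  move=> h h'; apply: Gext (Gcomp _ _ h h') => -[x m].
  by rewrite /actF /= !invmx1 !actX1 pairDr addrAC addrA.
have Gi i : inRJ (rt i) -> G (actF 1%:M (crt i)).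
  move=> hi; apply: Gext (Gcomp _ _ (reflectionA 1 hi) (reflectionA 0 hi)) => -[x m].
  rewrite /actF /saff /= !invmx1 !actX1 pairBl pairZl (pair2 HRD); congr pair; last by ring.
  rewrite (_ : _ - _ = - pairXY x (crt i)); last by ring.
  by rewrite scaleNr opprK subrK.
have Gz i (c : int) : inRJ (rt i) -> G (actF 1%:M (c *: crt i)).
  move=> hi; have [i' Ei'] := isRootN HRD i.
  have hi' : inRJ (rt i') by rewrite Ei'; exact: inRMN.
  have Ec := crt_neg HRD Ei'.
  elim/int_ind: c => [|n IH|n IH]; first by rewrite scale0r.
    by rewrite intS scalerDl scale1r; apply: GD => //; exact: Gi.
  rewrite intS opprD scalerDl scaleN1r -Ec; apply: GD => //; exact: Gi.
have Gq : G (actF 1%:M q).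
  rewrite Eq; elim/big_ind: _ => // i _.
  have [hi|hi] := pselect (inRJ (rt i)); first exact: Gz.
  by rewrite z0 // scale0r.
apply: Gext (Gcomp _ _ Gw Gq) => -[x m].
by rewrite /actF /= invmx1 actX1 pair0r addr0.
Qed.
End AffineRoots.

(** * The pairing with real cocharacters *)

Section RealPairing.
Variables (R : realType) (l k : nat).
Implicit Types (x y : 'rV[int]_(l + k)) (w : 'M[int]_(l + k)) (v : 'rV[R]_(l + k)).
Local Notation intv := (@intv R l k).

Lemma pairXAE x v : pairXA x v = (map_mx intr x *m v^T) 0 0.
Proof. by rewrite mxE; apply: eq_bigr => i _; rewrite !mxE. Qed.
Lemma pADl x x' v : pairXA (x + x') v = pairXA x v + pairXA x' v.
Proof. by rewrite !pairXAE map_mxD mulmxDl mxE. Qed.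
Lemma pADr x v v' : pairXA x (v + v') = pairXA x v + pairXA x v'.
Proof. by rewrite !pairXAE linearD mulmxDr mxE. Qed.
Lemma pAZr x c v : pairXA x (c *: v) = c * pairXA x v.
Proof. by rewrite !pairXAE linearZ -scalemxAr mxE. Qed.
Lemma pAZl c x v : pairXA (c *: x) v = c%:~R * pairXA x v.
Proof.
rewrite /pairXA mulr_sumr; apply: eq_bigr => i _.
by rewrite mxE rmorphM /= mulrA.
Qed.
Lemma pANl x v : pairXA (- x) v = - pairXA x v.
Proof. by rewrite -scaleN1r pAZl rmorphN1 mulN1r. Qed.
Lemma pANr x v : pairXA x (- v) = - pairXA x v.
Proof. by rewrite -scaleN1r pAZr mulN1r. Qed.
Lemma pABl x x' v : pairXA (x - x') v = pairXA x v - pairXA x' v.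
Proof. by rewrite pADl pANl. Qed.
Lemma pABr x v v' : pairXA x (v - v') = pairXA x v - pairXA x v'.
Proof. by rewrite pADr pANr. Qed.
Lemma pA0l v : pairXA 0 v = 0.
Proof. by rewrite -(scale0r 0) pAZl mul0r. Qed.
Lemma pA0r x : pairXA x (0 : 'rV[R]_(l + k)) = 0.
Proof. by rewrite -(scale0r 0) pAZr mul0r. Qed.
Lemma pA_sumr (I : Type) (s : seq I) (F : I -> 'rV[R]_(l + k)) x :
  pairXA x (\sum_(i <- s) F i) = \sum_(i <- s) pairXA x (F i).
Proof.
apply: (big_morph (fun v => pairXA x v)) => [v v'|]; first exact: pADr.
exact: pA0r.
Qed.
Lemma pA_suml (I : finType) (c : I -> int) (F : I -> 'rV[int]_(l + k)) v :
  pairXA (\sum_i c i *: F i) v = \sum_i (c i)%:~R * pairXA (F i) v.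
Proof.
rewrite (big_morph (fun x => pairXA x v) (id1 := 0) (op1 := +%R)).
- by apply: eq_bigr => i _; rewrite pAZl.
- by move=> x x'; exact: pADl.
- exact: pA0l.
Qed.
Lemma pA_intv x y : pairXA x (intv y) = (pairXY x y)%:~R.
Proof. by rewrite rmorph_sum; apply: eq_bigr => i _; rewrite mxE rmorphM. Qed.
Lemma pA_delta v i : pairXA (delta_mx 0 i) v = v 0 i.
Proof.
rewrite /pairXA (bigD1 i) //= mxE !eqxx mul1r big1 ?addr0 // => j jni.
by rewrite mxE (negPf jni) andbF mul0r.
Qed.
Lemma pA_eq v v' : (forall x, pairXA x v = pairXA x v') -> v = v'.
Proof. by move=> H; apply/rowP => i; rewrite -!pA_delta H. Qed.
Lemma pA_actA w x v : pairXA x (actA w v) = pairXA (actX (invmx w) x) v.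
Proof.
rewrite !pairXAE /actA /actX trmx_mul mulmxA map_mxM -map_trmx //.
Qed.

Lemma intvD y y' : intv (y + y') = intv y + intv y'.
Proof. by rewrite /Defs.intv map_mxD. Qed.
Lemma intvZ (c : int) y : intv (c *: y) = c%:~R *: intv y.
Proof. by apply/rowP => i; rewrite !mxE rmorphM. Qed.
Lemma intvN y : intv (- y) = - intv y.
Proof. by rewrite -scaleN1r intvZ rmorphN1 scaleN1r. Qed.
Lemma intvB y y' : intv (y - y') = intv y - intv y'.
Proof. by rewrite intvD intvN. Qed.
Lemma intv0 : intv 0 = 0.
Proof. by rewrite -(scale0r 0) intvZ scale0r. Qed.
Lemma actA_intv w y : actA w (intv y) = intv (actY w y).
Proof. by rewrite /actA /Defs.intv /actY map_mxM. Qed.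
Lemma actAD w v v' : actA w (v + v') = actA w v + actA w v'.
Proof. exact: mulmxDl. Qed.
Lemma actAZ w c v : actA w (c *: v) = c *: actA w v.
Proof. by rewrite /actA scalemxAl. Qed.
Lemma actAN w v : actA w (- v) = - actA w v.
Proof. exact: mulNmx. Qed.
Lemma actA_sum w (I : Type) (s : seq I) (F : I -> 'rV[R]_(l + k)) :
  actA w (\sum_(i <- s) F i) = \sum_(i <- s) actA w (F i).
Proof. by rewrite /actA mulmx_suml. Qed.
Lemma actA1 v : actA 1%:M v = v.
Proof. by rewrite /actA invmx1 map_mx1 mulmx1. Qed.
Lemma actAM w w' v : w \in unitmx -> w' \in unitmx ->
  actA (w *m w') v = actA w (actA w' v).
Proof. by move=> U U'; rewrite /actA invmx_mul // map_mxM mulmxA. Qed.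
Lemma actAK w v : w \in unitmx -> actA (invmx w) (actA w v) = v.
Proof. by move=> U; rewrite -actAM ?unitmx_inv // mulVmx // actA1. Qed.
End RealPairing.

(** * Finiteness of the Weyl group; the coroot lattice of a Levi subgroup *)

Section Weyl.
Variables (l k N : nat) (rt crt : 'I_N -> 'rV[int]_(l + k)) (sr : 'I_l -> 'I_N).
Hypothesis HRD : based_root_datum rt crt sr.
Local Notation sref := (sref rt crt).
Local Notation inW := (inW rt crt).
Local Notation formX := (formX crt).
Implicit Types (x y : 'rV[int]_(l + k)) (w : 'M[int]_(l + k)).

Lemma actY1 y : actY 1%:M y = y.
Proof. by rewrite /actY invmx1 mulmx1. Qed.
Lemma actYM w w' y : w \in unitmx -> w' \in unitmx ->
  actY (w *m w') y = actY w (actY w' y).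
Proof. by move=> U U'; rewrite /actY invmx_mul // mulmxA. Qed.

Lemma inW_sref i : inW (sref i).
Proof. by rewrite -[sref i]mulmx1; constructor; constructor. Qed.
Lemma inW_mul w w' : inW w -> inW w' -> inW (w *m w').
Proof.
move=> h h'; elim: h => [|i u _ IH]; first by rewrite mul1mx.
by rewrite -mulmxA; constructor.
Qed.
Lemma inW_inv w : inW w -> inW (invmx w).
Proof.
elim=> [|i u hu IH]; first by rewrite invmx1; constructor.
rewrite invmx_mul ?(sref_unit HRD) ?(inW_unit HRD hu) // (sref_inv HRD).
by apply: inW_mul => //; exact: inW_sref.
Qed.
Lemma inW_form w x y : inW w -> formX (actX w x) (actX w y) = formX x y.
Proof.
elim=> [|i u hu <-]; first by rewrite !actX1.
by rewrite !actXM (formX_sref HRD).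
Qed.
Lemma inW_root w i : inW w -> exists m, rt m = actX w (rt i).
Proof.
elim=> [|j u hu [m Em]]; first by exists i; rewrite actX1.
have [m' Em'] := rt_refl HRD j m; exists m'.
by rewrite Em' -actX_sref Em actXM.
Qed.
Lemma inW_diff w x : inW w -> rootspan rt (actX w x - x).
Proof.
elim=> [|j u hu IH].
  by rewrite actX1 subrr -(scale0r x) -(subrr 1) scalerBl subrr;
     exists (fun=> 0); rewrite big1 // => i _; rewrite scale0r.
rewrite actXM actX_sref addrAC; apply: rootspanB => //.
by apply: rootspanZ; exact: rootspan_rt.
Qed.
Lemma formX_sum0 x d : rootspan rt d -> (forall i, formX x (rt i) = 0) -> formX x d = 0.
Proof.
move=> [z ->] h; elim/big_ind: _ => [|a b ha hb|i _].
- by rewrite formXC formX0l.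
- by rewrite formXDr ha hb addr0.
- by rewrite formXZr h mulr0.
Qed.
(** The form is definite only on the root span, hence the detour through [actX w x - x], which lies
    in that span and is orthogonal to every root. *)
Lemma inW_faithful w : inW w -> (forall i, actX w (rt i) = rt i) -> w = 1%:M.
Proof.
move=> hw h; apply: actX_inj => x; apply/eqP; rewrite -subr_eq0; apply/eqP.
apply: (formX_eq0 HRD (inW_diff x hw)); apply: (formX_sum0 (inW_diff x hw)) => i.
by rewrite formXBl -{1}(h i) inW_form // subrr.
Qed.

(** By faithfulness an element is determined by its action on the indices of roots; [f] picks one
    element per realised map and falls back on the identity, which is in [W] as well. *)
Lemma finite_W : exists s : seq 'M[int]_(l + k), uniq s /\ forall w, w \in s <-> inW w.
Proof.
pose P (p : {ffun 'I_N -> 'I_N}) w := inW w /\ forall i, rt (p i) = actX w (rt i).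
pose f p : 'M[int]_(l + k) := xget 1%:M [set w | P p w].
have hf p : inW (f p).
  rewrite /f; case: xgetP => [w _ []//|_]; exact: inW1.
exists (undup (codom f)); split=> [|w]; first exact: undup_uniq.
rewrite mem_undup; split=> [/codomP[p ->]//|hw].
have [p Hp] := fin_all_exists (fun i => inW_root i hw).
apply/codomP; exists [ffun i => p i]; rewrite /f; case: xgetP => [w' _ [hw' Ew']|].
  apply/esym; rewrite -[LHS]mul1mx -(mulmxV (inW_unit HRD hw)) -mulmxA.
  rewrite [invmx w *m w'](@inW_faithful _ _) ?mulmx1 //.
    by apply: inW_mul => //; exact: inW_inv.
  by move=> i; rewrite actXM -Ew' ffunE Hp actXK // (inW_unit HRD).
move=> /(_ w) []; split => // i; by rewrite ffunE.
Qed.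

Variable J : {set 'I_l}.
Local Notation inWJ := (inWM rt crt sr J).
Local Notation inRJ := (inRM rt sr J).
Local Notation corootM := (corootM rt crt sr J).
Lemma inWM_inW w : inWJ w -> inW w.
Proof. by elim=> [|i u _ _ IH]; constructor. Qed.
Lemma inWM_sref i : inRJ (rt i) -> inWJ (sref i).
Proof. by move=> hi; rewrite -[sref i]mulmx1; constructor => //; constructor. Qed.
Lemma inWM_mul w w' : inWJ w -> inWJ w' -> inWJ (w *m w').
Proof.
move=> h h'; elim: h => [|i u hi _ IH]; first by rewrite mul1mx.
by rewrite -mulmxA; constructor.
Qed.
Lemma inWM_inv w : inWJ w -> inWJ (invmx w).
Proof.
elim=> [|i u hi hu IH]; first by rewrite invmx1; constructor.
rewrite invmx_mul ?(sref_unit HRD) ?(inWM_unit HRD hu) // (sref_inv HRD).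
by apply: inWM_mul => //; exact: inWM_sref.
Qed.
Lemma inWM_inRM w x : inWJ w -> inRJ x -> inRJ (actX w x).
Proof.
move=> + hx; elim=> [|i u hi hu IH]; first by rewrite actX1.
by rewrite actXM; exact: inRM_sref.
Qed.
Lemma finite_WM : exists s : seq 'M[int]_(l + k), uniq s /\ forall w, w \in s <-> inWJ w.
Proof.
have [s [us hs]] := finite_W; exists [seq w <- s | `[< inWJ w >]].
split=> [|w]; first exact: filter_uniq.
rewrite mem_filter; split=> [/andP[/asboolP]//|hw].
by rewrite asboolT //=; apply/hs; exact: inWM_inW.
Qed.

Lemma corootM0 : corootM 0.
Proof. by exists (fun=> 0); split => //; rewrite big1 // => i _; rewrite scale0r. Qed.
Lemma corootMD q q' : corootM q -> corootM q' -> corootM (q + q').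
Proof.
move=> [z [h ->]] [z' [h' ->]]; exists (fun i => z i + z' i); split.
  by move=> i hi; rewrite h ?h'.
by rewrite -big_split; apply: eq_bigr => i _; rewrite scalerDl.
Qed.
Lemma corootMZ c q : corootM q -> corootM (c *: q).
Proof.
move=> [z [h ->]]; exists (fun i => c * z i); split.
  by move=> i hi; rewrite h // mulr0.
by rewrite scaler_sumr; apply: eq_bigr => i _; rewrite scalerA.
Qed.
Lemma corootMN q : corootM q -> corootM (- q).
Proof. by rewrite -scaleN1r; exact: corootMZ. Qed.
Lemma corootM_crt i : inRJ (rt i) -> corootM (crt i).
Proof.
move=> hi; exists (fun j => (j == i)%:R); split.
  by move=> j; case: eqP => // ->.
by rewrite (bigD1 i) //= eqxx scale1r big1 ?addr0 // => j /negPf->; rewrite scale0r.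
Qed.
Lemma corootM_diff w y : inWJ w -> corootM (actY w y - y).
Proof.
elim=> [|i u hi hu IH]; first by rewrite actY1 subrr; exact: corootM0.
rewrite actYM ?(sref_unit HRD) ?(inWM_unit HRD hu) // (actY_sref HRD) addrAC.
by apply: corootMD => //; apply: corootMN; apply: corootMZ; exact: corootM_crt.
Qed.
Lemma corootM_act w q : inWJ w -> corootM q -> corootM (actY w q).
Proof. by move=> hw hq; rewrite -[actY w q](subrK q); apply: corootMD => //; exact: corootM_diff. Qed.

(** Simple coroots are standard basis vectors, because the derived group is simply connected. So
    vanishing coordinates describe the coroot lattice of [M], which is therefore saturated. *)
Definition suppJ y := forall i, (forall j, j \in J -> i != lshift k j) -> y 0 i = 0.
Lemma crt_suppJ i : inRJ (rt i) -> suppJ (crt i).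
Proof.
have gen n i1 : pairXY (rt i1) (y0 rt crt sr) <= n%:Z -> posJ rt sr J i1 -> suppJ (crt i1).
  elim: n i1 => [|n IH] i1 hn pi; first by move/(posJP HRD): pi => [_]; lia.
  have [j jJ pj] := descentF HRD pi.
  have [->|nij] := eqVneq i1 (sr j).
    move=> i2 /(_ j jJ) h; rewrite (crt_simple HRD) mxE eqxx /=.
    by rewrite (negPf h).
  have [m Em] := rt_refl HRD (sr j) i1; rewrite -actX_sref in Em.
  have pm : posJ rt sr J m.
    apply/(posJP HRD); split; last first.
      by apply: (posr_y0 HRD); apply: (sref_pos HRD (coneJ_cone pi) nij Em).
    rewrite Em; apply: inRM_sref; last exact: coneJ_inRM.
    by apply: coneJ_inRM; exact: coneJ_simple.
  have hm : pairXY (rt m) (y0 rt crt sr) <= n%:Z.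
    by rewrite Em actX_sref pairBl pairZl (pair_simple_y0 HRD); lia.
  have Ei : rt i1 = actX (sref (sr j)) (rt m) by rewrite Em (actX_srefK HRD).
  move=> i2 h; rewrite (crt_rt HRD Ei) (actY_sref HRD) !mxE (IH m hm pm) //.
  by rewrite (crt_simple HRD) !mxE eqxx (negPf (h j jJ)) mulr0 subr0.
move=> hi; have pp i1 : posJ rt sr J i1 -> suppJ (crt i1).
  by apply: (gen (absz (pairXY (rt i1) (y0 rt crt sr)))); lia.
case: (pos_or_neg HRD hi) => [/pp//|ni].
have [m Em] := isRootN HRD i.
move=> i2 h; have := pp m; rewrite /posJ Em => /(_ ni i2 h).
by rewrite (crt_neg HRD Em) mxE => /eqP; rewrite oppr_eq0 => /eqP.
Qed.
Lemma suppJ_corootM q : suppJ q -> corootM q.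
Proof.
move=> hq; have -> : q = \sum_(j in J) q 0 (lshift k j) *: crt (sr j).
  apply/rowP => i; rewrite summxE.
  have [[j jJ ->]|h] := pselect (exists2 j, j \in J & i = lshift k j).
    rewrite (bigD1 j) //= big1 ?addr0 => [|j' /andP[_ nj]].
      by rewrite (crt_simple HRD) !mxE !eqxx mulr1.
    rewrite (crt_simple HRD) !mxE eqxx /= (inj_eq (@lshift_inj _ _)).
    by rewrite eq_sym (negPf nj) mulr0.
  have h' j : j \in J -> i != lshift k j.
    by move=> jJ; apply/eqP => E; apply: h; exists j.
  rewrite hq // big1 // => j jJ.
  by rewrite (crt_simple HRD) !mxE eqxx /= (negPf (h' j jJ)) mulr0.
apply: big_ind => [|? ? ? ?|j jJ]; [exact: corootM0|exact: corootMD|].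
apply: corootMZ; apply: corootM_crt; apply: coneJ_inRM; exact: coneJ_simple.
Qed.
Lemma corootM_suppJ q : corootM q -> suppJ q.
Proof.
move=> [z [z0 ->]] i hi; rewrite summxE big1 // => j _; rewrite mxE.
have [hj|hj] := pselect (inRJ (rt j)); first by rewrite crt_suppJ // mulr0.
by rewrite z0 // mul0r.
Qed.
End Weyl.

(** * Alcoves *)

Section Alcove.
Variables (R : realType) (l k N : nat) (rt crt : 'I_N -> 'rV[int]_(l + k)) (sr : 'I_l -> 'I_N).
Hypothesis HRD : based_root_datum rt crt sr.
Variable J : {set 'I_l}.
Local Notation sref := (sref rt crt).
Local Notation inWJ := (inWM rt crt sr J).
Local Notation inRJ := (inRM rt sr J).
Local Notation posJ := (posJ rt sr J).
Local Notation maxr := (maxr rt sr J).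
Local Notation corootM := (corootM rt crt sr J).
Local Notation simpA := (simpA rt sr J).
Local Notation posA := (posA rt crt sr J).
Local Notation affr := (affr rt sr J).
Local Notation el := (el rt).
Local Notation saff := (saff rt crt).
Local Notation y0 := (y0 rt crt sr).
Local Notation H := (hbound rt crt sr).
Local Notation V := ('rV[int]_(l + k) * int)%type.
Local Notation intv := (@intv R l k).
Local Notation alcove := (@alcove R l k N rt sr J).
Local Notation avg := (@avg R l k N rt crt sr J).
Implicit Types (x y q : 'rV[int]_(l + k)) (w : 'M[int]_(l + k)) (v nu : 'rV[R]_(l + k)) (b : V).

Definition evr b v : R := pairXA b.1 v + b.2%:~R.

Lemma evr_opp b v : evr (oppV b) v = - evr b v.
Proof. by rewrite /evr /= pANl rmorphN opprD. Qed.
Lemma evr_actF w q b v : evr (actF w q b) v = evr b (actA w v + intv q).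
Proof. by rewrite /evr /= pADr pA_actA pA_intv rmorphD /= addrA addrAC. Qed.

Definition refl_pt (a : 'I_N * int) v := v - evr (el a) v *: intv (crt a.1).
Lemma evr_saff a b v : evr (saff a b) v = evr b (refl_pt a v).
Proof.
rewrite /evr /refl_pt /= pABl pAZl pABr pAZr pA_intv rmorphB rmorphM /= /evr /=.
by ring.
Qed.
Lemma refl_ptE a v : refl_pt a v = actA (sref a.1) v + intv (- a.2 *: crt a.1).
Proof.
apply: pA_eq => x; rewrite pADr pA_actA (sref_inv HRD) actX_sref pA_intv /refl_pt.
rewrite pABr pAZr pA_intv pABl pAZl /evr /= pairZr rmorphM rmorphN /=; ring.
Qed.

Lemma posRM_posJ i : posRM rt sr J (rt i) <-> posJ i.
Proof.
split=> [[_ [c [? [? ?]]]]|[c [? [? ?]]]]; first by exists c.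
by split; [exists i | exists c].
Qed.

Lemma alcove_simple v : alcove v -> forall j, j \in J -> 0 < pairXA (rt (sr j)) v.
Proof. by case. Qed.
Lemma alcove_max v t : alcove v -> maxr t -> pairXA (rt t) v < 1.
Proof. by move=> [_ h] [pt ht]; apply: h => //; apply/posRM_posJ. Qed.

Lemma coneJ_ge0 v x : alcove v -> coneJ rt sr J x -> 0 <= pairXA x v.
Proof.
move=> hv [c [cJ [c0 ->]]]; rewrite pA_suml; apply: sumr_ge0 => j _.
have [jJ|/cJ->] := boolP (j \in J); last by rewrite mul0r.
by rewrite mulr_ge0 ?ler0z // ltW // alcove_simple.
Qed.
Lemma posJ_range v i : alcove v -> posJ i -> 0 < pairXA (rt i) v < 1.
Proof.
move=> hv pi; apply/andP; split.
  have [n] : exists n : nat, pairXY (rt i) y0 <= n%:Z.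
    by exists (absz (pairXY (rt i) y0)); lia.
  have [c [cJ [c0 Ei]]] := pi => _.
  have [j cj] : exists j, 0 < c j.
    apply: contrapT => h; apply/negP: (rt_neq0 HRD i); rewrite negbK Ei /lincomb big1 // => j _.
    have -> : c j = 0; last by rewrite scale0r.
    by apply/eqP; rewrite eq_le c0 leNgt andbT; apply/negP => ?; apply: h; exists j.
  have jJ : j \in J by apply: contraTT cj => /cJ->; rewrite ltxx.
  have -> : rt i = rt (sr j) + (rt i - rt (sr j)) by rewrite addrC subrK.
  rewrite pADl ltr_pwDl ?alcove_simple // coneJ_ge0 //.
  exists (fun j' => c j' - (j' == j)%:R); split=> [j' j'J|].
    by rewrite cJ //; case: eqP j'J => // ->; rewrite jJ.
  split=> [j'|]; first by case: eqP => [->|_]; [move: cj; lia|rewrite subr0].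
  by rewrite {1}Ei (lincomb_delta rt sr j) lincombN lincombD.
have [t mt ct] := climb HRD pi.
apply: le_lt_trans (alcove_max hv mt).
by rewrite -subr_ge0 -pABl coneJ_ge0.
Qed.
Lemma alcove_posA v b : alcove v -> posA b -> 0 < evr b v.
Proof.
move=> hv pb; have [[i [hi Eb]] _] := pb.
rewrite /evr Eb; have [[pi b0]|[ni b1]] := posA_cases HRD Eb pb.
  have /andP[h _] := posJ_range hv pi.
  by rewrite ltr_pwDl // ler0z.
have [i' Ei'] := isRootN HRD i.
have pi' : posJ i'.
  by apply/(posJP HRD); rewrite Ei' pairNl; split => //; exact: inRMN.
have /andP[_] := posJ_range hv pi'; rewrite Ei' pANl => h.
have : (1%:~R : R) <= (b.2)%:~R by rewrite ler_int.
rewrite (_ : 1%:~R = 1 :> R) //; lra.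
Qed.
Lemma alcove_of_simple v : (forall a, simpA a -> 0 < evr (el a) v) -> alcove v.
Proof.
move=> h; split=> [j jJ|x [[t Et] [c [cJ [c0 Ex]]]] hx].
  have /h : simpA (sr j, 0) by left; exists j.
  by rewrite /evr /= addr0.
have [t' Et'] := isRootN HRD t.
have /h : simpA (t', 1).
  by right; exists t; split => //; split; [exists c; rewrite Et | rewrite Et].
by rewrite /evr /= Et' pANl Et (_ : 1%:~R = 1 :> R) //; lra.
Qed.
Lemma alcoveP v : alcove v <-> forall b, posA b -> 0 < evr b v.
Proof.
split=> [hv b|h]; first exact: alcove_posA.
by apply: alcove_of_simple => a /(simpA_pos HRD)/h.
Qed.

Lemma hbound_gt0 : 0 < H.
Proof. by rewrite /hbound ltr_pwDl // sumr_ge0. Qed.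
Definition alcove_pt : 'rV[R]_(l + k) := (H%:~R)^-1 *: intv y0.
Lemma alcove_ptP : alcove alcove_pt.
Proof.
have H0 : 0 < (H%:~R : R) by rewrite ltr0z hbound_gt0.
apply/alcoveP => b [_]; rewrite /mu /evr /alcove_pt pAZr pA_intv => h.
rewrite -(pmulr_rgt0 _ H0) mulrDr mulrA divff ?gt_eqF // mul1r -rmorphM -rmorphD /=.
by rewrite ltr0z.
Qed.

Lemma affr_actF w q b : inWJ w -> affr b -> affr (actF w q b).
Proof.
move=> hw [i [hi Eb]].
have [m Em] := inW_root HRD i (inWM_inW (inWM_inv HRD hw)).
exists m; split; rewrite ?Em /= ?Eb //; apply: (inWM_inRM (inWM_inv HRD hw) hi).
Qed.

(** An affine root has constant sign on the alcove, so one point mapped into the alcove decides the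
    sign of the pulled-back functional. *)
Lemma alcove_aff w q v : inWJ w -> alcove v -> alcove (actA w v + intv q) ->
  forall b, posA b -> posA (actF w q b).
Proof.
move=> hw hv hv' b pb.
have [//|po] := posA_dich HRD (affr_actF q hw pb.1).
have := alcove_posA hv po; rewrite evr_opp evr_actF.
by have := alcove_posA hv' pb; lra.
Qed.
Lemma alcove_map w q v v' : inWJ w -> alcove v -> alcove (actA w v + intv q) ->
  alcove v' -> alcove (actA w v' + intv q).
Proof.
move=> hw hv hv1 hv'; apply/alcoveP => b pb.
by rewrite -evr_actF; apply: alcove_posA => //; exact: alcove_aff hv1 _ pb.
Qed.

(** The map is a word in simple reflections that keeps positive affine roots positive, hence trivial
    by [word_trivial]. *)
Lemma alcove_fix w q v : inWJ w -> corootM q -> alcove v ->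
  alcove (actA w v + intv q) -> w = 1%:M.
Proof.
move=> hw hq hv hv'.
have [u hu Eu] := actF_word HRD hw hq.
have tr := word_trivial HRD hu.
have E b : actF w q b = b by rewrite Eu tr // => b' pb'; rewrite -Eu; exact: alcove_aff hv' _ pb'.
have : invmx w = 1%:M by apply: actX_inj => x; have := congr1 fst (E (x, 0)).
by move=> Ew; rewrite -[w]mulmx1 -Ew mulmxV // (inWM_unit HRD hw).
Qed.

Lemma inWM_comp w w' q q' v : inWJ w -> inWJ w' ->
  actA w (actA w' v + intv q') + intv q = actA (w *m w') v + intv (actY w q' + q).
Proof.
move=> hw hw'; by rewrite actAM ?(inWM_unit HRD hw) ?(inWM_unit HRD hw') // actAD actA_intv intvD addrA.
Qed.

Lemma avgE s v : uniq s -> (forall w, w \in s <-> inWJ w) ->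
  avg v = ((size s)%:R)^-1 *: \sum_(w <- s) actA w v.
Proof.
move=> us hs; rewrite /Defs.avg; have -> : WMset rt crt sr J = [set` s]%classic.
  by apply/seteqP; split => w /= /hs.
by rewrite -!fsbig_seq // big_const_seq count_predT iter_addr_0.
Qed.
Lemma avgD v v' : avg (v + v') = avg v + avg v'.
Proof.
have [s [us hs]] := finite_WM HRD J; rewrite !(avgE _ us hs) -scalerDr -big_split.
by congr (_ *: _); apply: eq_bigr => w _; rewrite actAD.
Qed.
Lemma avgZ c v : avg (c *: v) = c *: avg v.
Proof.
have [s [us hs]] := finite_WM HRD J; rewrite !(avgE _ us hs).
have -> : \sum_(w <- s) actA w (c *: v) = c *: \sum_(w <- s) actA w v.
  by rewrite scaler_sumr; apply: eq_bigr => w _; rewrite actAZ.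
by rewrite !scalerA mulrC.
Qed.
Lemma avgN v : avg (- v) = - avg v.
Proof. by rewrite -scaleN1r avgZ scaleN1r. Qed.
Lemma avgB v v' : avg (v - v') = avg v - avg v'.
Proof. by rewrite avgD avgN. Qed.
Lemma avg_size s : (forall w, w \in s <-> inWJ w) -> (size s)%:R != 0 :> R.
Proof.
move=> hs; rewrite pnatr_eq0; case: s hs => // hs.
by have /hs : inWJ 1%:M by constructor.
Qed.
Lemma avg_act w v : inWJ w -> avg (actA w v) = avg v.
Proof.
move=> hw; have [s [us hs]] := finite_WM HRD J; rewrite !(avgE _ us hs).
have U := inWM_unit HRD hw; congr (_ *: _).
have -> : \sum_(u <- s) actA u (actA w v) = \sum_(u <- [seq u *m w | u <- s]) actA u v.
  rewrite big_map; apply: eq_big_seq => u /hs hu.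
  by rewrite actAM // (inWM_unit HRD hu).
apply: perm_big; apply: uniq_perm => //.
  by rewrite map_inj_uniq // => u u' /(congr1 (fun a => a *m invmx w)); rewrite !mulmxK.
move=> u; apply/mapP/idP => [[u' /hs hu' ->]|/hs hu].
  by apply/hs; apply: inWM_mul.
exists (u *m invmx w); last by rewrite mulmxKV.
by apply/hs; apply: inWM_mul => //; apply: inWM_inv.
Qed.
Lemma avg_fixed v : (forall w, inWJ w -> actA w v = v) -> avg v = v.
Proof.
move=> h; have [s [us hs]] := finite_WM HRD J; rewrite !(avgE _ us hs).
rewrite (eq_big_seq (fun=> v)) => [|w /hs/h//].
rewrite big_const_seq count_predT iter_addr_0 -scaler_nat scalerA mulVf ?scale1r //.
exact: avg_size hs.
Qed.
Lemma actA_avg w v : inWJ w -> actA w (avg v) = avg v.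
Proof.
move=> hw; have [s [us hs]] := finite_WM HRD J; rewrite !(avgE _ us hs).
have U := inWM_unit HRD hw; rewrite actAZ actA_sum; congr (_ *: _).
have -> : \sum_(u <- s) actA w (actA u v) = \sum_(u <- [seq w *m u | u <- s]) actA u v.
  rewrite big_map; apply: eq_big_seq => u /hs hu.
  by rewrite actAM // (inWM_unit HRD hu).
apply: perm_big; apply: uniq_perm => //.
  by rewrite map_inj_uniq // => u u' /(congr1 (fun a => invmx w *m a)); rewrite !mulKmx.
move=> u; apply/mapP/idP => [[u' /hs hu' ->]|/hs hu].
  by apply/hs; apply: inWM_mul.
exists (invmx w *m u); last by rewrite mulKVmx.
by apply/hs; apply: inWM_mul => //; apply: inWM_inv.
Qed.
Lemma avg_coroot q : corootM q -> avg (intv q) = 0.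
Proof.
move=> [z [z0 ->]].
have avg0 : avg 0 = 0 by have := avgZ 0 0; rewrite !scale0r.
elim/big_ind: _ => [|x y hx hy|i _]; first by rewrite intv0.
  by rewrite intvD avgD hx hy addr0.
rewrite intvZ avgZ; have [hi|hi] := pselect (inRJ (rt i)); last first.
  by rewrite z0 // scale0r.
have := avg_act (intv (crt i)) (inWM_sref crt hi).
rewrite actA_intv (actY_sref HRD) (pair2 HRD) scaler_nat mulr2n opprD addrA subrr sub0r.
rewrite intvN avgN => /eqP; rewrite -subr_eq0 -opprD oppr_eq0 -mulr2n.
by rewrite -scaler_nat scaler_eq0 pnatr_eq0 /= => /eqP ->; rewrite scaler0.
Qed.
(** When the average vanishes, summing [w y - y] over [W_M] gives [- |W_M| y]; each term is a coroot
    combination, so its coordinates outside [J] vanish, and with them those of [y]. With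
    [avg_coroot] this is [Lambda_M = X_*(A) / Q(R_M^vee)]. *)
Lemma avg0_coroot y : avg (intv y) = 0 -> corootM y.
Proof.
move=> h; apply: (suppJ_corootM HRD) => i hi.
have [s [us hs]] := finite_WM HRD J; move: h; rewrite (avgE _ us hs) => /eqP.
rewrite scaler_eq0 invr_eq0 (negPf (avg_size hs)) /= => /eqP h.
have : \sum_(w <- s) (actA w (intv y) - intv y) = - (size s)%:R *: intv y.
  by rewrite sumrB h sub0r big_const_seq count_predT iter_addr_0 scaleNr scaler_nat.
move/(congr1 (fun v => v 0 i)).
have -> : (\sum_(w <- s) (actA w (intv y) - intv y)) 0 i = 0.
  rewrite summxE big_seq big1 // => w /hs hw.
  rewrite actA_intv -intvB mxE.
  by rewrite (corootM_suppJ HRD (corootM_diff HRD y hw)).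
rewrite !mxE => /esym/eqP; rewrite mulf_eq0 oppr_eq0 (negPf (avg_size hs)) intr_eq0.
by move/eqP.
Qed.

(** One alcove point replaces the equivalence over all [v] in [IsWnu], and the coroot translation is
    absorbed in [y]. This form is easier to produce and, thanks to [alcove_map], equivalent. *)
Definition weakW nu w := inWJ w /\ exists y, avg (intv y) = nu /\
  exists v, alcove v /\ alcove (actA w v + intv y).

Lemma IsWnu_weak nu w : IsWnu rt crt sr J nu w -> weakW nu w.
Proof.
move=> [hw [y [ay [q [hq hv]]]]]; split => //; exists (y + q).
rewrite intvD avgD (avg_coroot hq) addr0; split => //.
exists alcove_pt; split; first exact: alcove_ptP.
by rewrite -intvD; apply/(proj1 (hv _)); exact: alcove_ptP.
Qed.

Lemma weak_IsWnu nu w : weakW nu w -> IsWnu rt crt sr J nu w.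
Proof.
move=> [hw [y [ay [v [hv hv']]]]]; split=> //; exists y; split => //; exists 0.
split; first exact: corootM0.
move=> u; rewrite addr0; split=> [hu|hu]; first exact: alcove_map hv hv' hu.
have U := inWM_unit HRD hw.
have inv z : actA (invmx w) (actA w z + intv y) + intv (- actY (invmx w) y) = z.
  by rewrite actAD actAK // actA_intv intvN addrK.
by rewrite -[u]inv; apply: (alcove_map (inWM_inv HRD hw) hv' _ hu); rewrite inv.
Qed.

(** The two translations have the same average, so [w *m invmx w'] comes with a coroot translation:
    it is the linear part of an affine Weyl group element preserving the alcove. *)
Lemma weakW_uniq nu w w' : weakW nu w -> weakW nu w' -> w = w'.
Proof.
move=> [hw [y [ay [v [hv hv1]]]]] [hw' [y' [ay' [v' [hv' hv1']]]]].
have U' := inWM_unit HRD hw'.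
have hi := inWM_inv HRD hw'.
have h2 := alcove_map hw hv hv1 hv'.
have E : actA w v' + intv y = actA (w *m invmx w') (actA w' v' + intv y') +
    intv (y - actY (w *m invmx w') y').
  rewrite actAD -actAM ?unitmx_mul ?unitmx_inv ?(inWM_unit HRD hw) //.
  rewrite mulmxKV // actA_intv intvB -!addrA; congr (_ + _).
  by rewrite addrCA subrr addr0.
have hww : inWJ (w *m invmx w') by apply: inWM_mul.
suff : w *m invmx w' = 1%:M.
  by move/(congr1 (fun a => a *m w')); rewrite mulmxKV // mul1mx.
apply: (alcove_fix (q := y - actY (w *m invmx w') y') hww _ hv1'); last by rewrite -E.
by apply: avg0_coroot; rewrite intvB avgB -actA_intv avg_act // ay ay' subrr.
Qed.
End Alcove.

(** * Transitivity of the affine Weyl group on alcoves *)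

Lemma floorDint (R : realType) (x : R) (m : int) :
  Num.floor (x + m%:~R) = Num.floor x + m.
Proof.
apply: floor_def; have /andP[h1 h2] := floor_itv x.
by move: h2; rewrite !rmorphD /= => h2; rewrite lerD2r h1; lra.
Qed.
Lemma floorNn (R : realType) (x : R) : (forall m : int, x != m%:~R) ->
  Num.floor (- x) = - Num.floor x - 1.
Proof.
move=> nx; apply: floor_def; have /andP[h1 h2] := floor_itv x.
have h3 := nx (Num.floor x).
move: h2; rewrite !(rmorphD, rmorphN, rmorphB) /= => h2.
have h4 : (Num.floor x)%:~R < x by rewrite lt_def h3.
by apply/andP; split; lra.
Qed.

Section Transitivity.
Variables (R : realType) (l k N : nat) (rt crt : 'I_N -> 'rV[int]_(l + k)) (sr : 'I_l -> 'I_N).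
Hypothesis HRD : based_root_datum rt crt sr.
Variable J : {set 'I_l}.
Local Notation sref := (sref rt crt).
Local Notation inWJ := (inWM rt crt sr J).
Local Notation inRJ := (inRM rt sr J).
Local Notation posJ := (posJ rt sr J).
Local Notation corootM := (corootM rt crt sr J).
Local Notation simpA := (simpA rt sr J).
Local Notation posA := (posA rt crt sr J).
Local Notation affr := (affr rt sr J).
Local Notation el := (el rt).
Local Notation intv := (@intv R l k).
Local Notation alcove := (@alcove R l k N rt sr J).
Local Notation avg := (@avg R l k N rt crt sr J).
Local Notation v0 := (alcove_pt R rt crt sr).
Local Notation refl_pt := (@refl_pt R l k N rt crt).
Implicit Types (x y q : 'rV[int]_(l + k)) (w : 'M[int]_(l + k)) (v nu : 'rV[R]_(l + k)).

Definition regJ v := forall i (m : int), inRJ (rt i) -> pairXA (rt i) v != m%:~R.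

Lemma simp_range a v : alcove v -> simpA a -> 0 < evr (el a) v < 1.
Proof.
move=> hv sa; rewrite (alcove_posA HRD hv (simpA_pos HRD sa)) /=.
case: sa => [[j jJ ->]|[t [[pt _] E E1]]]; rewrite /evr /=.
  by rewrite addr0; have /andP[] := posJ_range HRD hv (coneJ_simple rt sr jJ).
rewrite E E1 pANl; have /andP[h _] := posJ_range HRD hv pt.
by rewrite (_ : 1%:~R = 1 :> R) //; lra.
Qed.

Lemma regJ_alcove v : alcove v -> regJ v.
Proof.
have pos i m : alcove v -> posJ i -> pairXA (rt i) v != m%:~R.
  move=> hv /(posJ_range HRD hv)/andP[h1 h2]; apply/eqP => E; move: h1 h2.
  by rewrite E ltr0z -(ltr_int R) (_ : 1 = 1%:~R :> R) // !ltr_int; lia.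
move=> hv i m hi; case: (pos_or_neg HRD hi) => [/pos|ni]; first exact.
have [i' Ei'] := isRootN HRD i.
have pi' : posJ i' by rewrite /posJ Ei'.
by have := pos i' (- m) hv pi'; rewrite Ei' pANl rmorphN eqr_opp.
Qed.
Lemma regJ_aff w y v : inWJ w -> regJ v -> regJ (actA w v + intv y).
Proof.
move=> hw rv i m hi; rewrite pADr pA_actA pA_intv.
have hw' := inWM_inv HRD hw.
have [i' Ei'] := inW_root HRD i (inWM_inW hw').
have hi' : inRJ (rt i') by rewrite Ei'; exact: inWM_inRM hw' hi.
by have := rv i' (m - pairXY (rt i) y) hi'; rewrite Ei' rmorphB /= eq_sym subr_eq eq_sym.
Qed.
Lemma regJ_evr a v : regJ v -> inRJ (rt a.1) -> forall m : int, evr (el a) v != m%:~R.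
Proof.
move=> rv ha m; rewrite /evr /=; apply/eqP => E.
have /eqP := rv a.1 (m - a.2) ha; apply; rewrite rmorphB /= -E; ring.
Qed.
Lemma regJ_refl a v : inRJ (rt a.1) -> regJ v -> regJ (refl_pt a v).
Proof.
by move=> ha rv; rewrite (refl_ptE HRD); apply: regJ_aff => //; exact: inWM_sref.
Qed.

(** For regular [v], the number of hyperplanes [rt i = m] separating [v] from the base point. In
    [nsep] each hyperplane counts twice, once for each sign of the root. *)
Definition sepn i v : nat := absz (Num.floor (pairXA (rt i) v) - Num.floor (pairXA (rt i) v0)).
Definition nsep v : nat := \sum_(i | `[< inRJ (rt i) >]) sepn i v.

Lemma floor_refl a i v m : rt m = actX (sref a.1) (rt i) ->
  Num.floor (pairXA (rt i) (refl_pt a v)) =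
  Num.floor (pairXA (rt m) v) - pairXY (rt i) (crt a.1) * a.2.
Proof.
move=> Em; have := evr_saff rt crt a (rt i, 0) v; rewrite {2}/evr /= addr0 => <-.
by rewrite /evr /= sub0r -actX_sref -Em floorDint.
Qed.

(** Only the wall of [a] separates [v0] from its mirror image: the functionals bounding [rt i] from
    below and above at [v0] are positive affine roots other than [a], and stay positive by
    [saff_posA]. *)
Lemma floor_wall a i : simpA a -> inRJ (rt i) -> rt i <> rt a.1 -> rt i <> - rt a.1 ->
  Num.floor (pairXA (rt i) (refl_pt a v0)) = Num.floor (pairXA (rt i) v0).
Proof.
move=> sa hi n1 n2; apply: floor_def.
have hv := alcove_ptP R HRD J.
have rv := regJ_alcove hv.
set m := Num.floor _; have /andP[h1 h2] := floor_itv (pairXA (rt i) v0).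
rewrite -/m in h1 h2.
have pos b : affr b -> 0 < evr b v0 -> posA b.
  move=> hb eb; have [//|/(alcove_posA HRD hv)] := posA_dich HRD hb.
  by rewrite evr_opp; lra.
have [i' Ei'] := isRootN HRD i.
have p1 : posA (rt i, - m).
  apply: pos; first by exists i.
  by rewrite /evr /= rmorphN subr_gt0 lt_def h1 rv.
have p2 : posA (rt i', m + 1).
  apply: pos; first by exists i'; split=> //; rewrite Ei'; exact: inRMN.
  by rewrite /evr /= Ei' pANl addrC subr_gt0.
have /(saff_posA HRD sa p1) : (rt i, - m) <> el a by case.
have /(saff_posA HRD sa p2) : (rt i', m + 1) <> el a.
  by case; rewrite Ei' => E _; apply: n2; rewrite -E opprK.
move=> /(alcove_posA HRD hv) e2 /(alcove_posA HRD hv).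
move: e2; rewrite !evr_saff /evr /= Ei' pANl rmorphN => e2 e1.
by apply/andP; split; lra.
Qed.

Lemma nsep_lt a v : simpA a -> regJ v -> evr (el a) v < 0 -> (nsep (refl_pt a v) < nsep v)%N.
Proof.
move=> sa rv ev; have ha := simpA_inRM sa.
have hv := alcove_ptP R HRD J.
have [f [finj Hf]] := rperm HRD a.1.
have hf i : inRJ (rt (f i)) = inRJ (rt i).
  apply/propext; split => h; last by rewrite Hf; exact: inRM_sref.
  by rewrite -(actX_srefK HRD a.1 (rt i)) -Hf; exact: inRM_sref.
have fl0 : Num.floor (pairXA (rt a.1) v0) = - a.2.
  have /andP[h1 h2] := simp_range hv sa; apply: floor_def.
  by move: h1 h2; rewrite /evr /= rmorphD rmorphN /= => *; apply/andP; split; lra.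
(* [e] measures how far [v] lies beyond the wall. For the root of [a] and its opposite the
   separation drops from [floor e + 1] to [floor e]; for the other roots the reflection only
   permutes the separations. *)
set e := - evr (el a) v.
have e0 : 0 < e by rewrite oppr_gt0.
have ne (m : int) : e != m%:~R.
  apply/eqP => E; have /eqP := regJ_evr rv ha (- m); apply.
  by rewrite mulrNz -E /e opprK.
have Ea : pairXA (rt a.1) v = - e + (- a.2)%:~R.
  by rewrite /e /evr /= rmorphN; ring.
have fe : 0 <= Num.floor e.
  have /andP[_ h] := floor_itv e; have : 0 < (Num.floor e + 1)%:~R :> R by apply: lt_trans h.
  by rewrite ltr0z; lia.
have nv0 (m : int) : pairXA (rt a.1) v0 != m%:~R by exact: regJ_alcove.
have k1 i m : rt i = rt a.1 -> rt m = - rt a.1 ->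
    sepn i (refl_pt a v) = absz (Num.floor e) /\ sepn m v = absz (Num.floor e + 1).
  move=> Ei Em; rewrite /sepn (@floor_refl a i v m) ?Ei ?(actX_rt HRD) // Em !pANl Ea.
  rewrite opprD opprK -rmorphN opprK floorDint (pair2 HRD) floorNn // fl0.
  by split; congr absz; ring.
have k2 i m : rt i = - rt a.1 -> rt m = rt a.1 ->
    sepn i (refl_pt a v) = absz (Num.floor e) /\ sepn m v = absz (Num.floor e + 1).
  move=> Ei Em; rewrite /sepn (@floor_refl a i v m); last first.
    by rewrite Ei actXN (actX_rt HRD) opprK.
  rewrite Em Ei !pANl Ea floorDint pairNl (pair2 HRD) (floorNn ne) (floorNn nv0) fl0.
  by split; rewrite -[RHS]abszN; congr absz; ring.
have le i : inRJ (rt i) -> (sepn i (refl_pt a v) <= sepn (f i) v)%N.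
  move=> hi; have [E1|n1] := pselect (rt i = rt a.1).
    have Em : rt (f i) = - rt a.1 by rewrite Hf E1 (actX_rt HRD).
    by have [-> ->] := k1 i (f i) E1 Em; lia.
  have [E2|n2] := pselect (rt i = - rt a.1).
    have Em : rt (f i) = rt a.1 by rewrite Hf E2 actXN (actX_rt HRD) opprK.
    by have [-> ->] := k2 i (f i) E2 Em; lia.
  have := floor_wall sa hi n1 n2; rewrite /sepn !(floor_refl _ (Hf i)) => <-.
  by rewrite opprB addrA subrK.
rewrite /nsep [X in (_ < X)%N](reindex_inj finj) /=.
rewrite [X in (_ < X)%N](eq_bigl (fun i => `[< inRJ (rt i) >])); last by move=> i; rewrite hf.
have ab : `[< inRJ (rt a.1) >] by apply/asboolP.
rewrite (bigD1 a.1) // [X in (_ < X)%N](bigD1 a.1) //=.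
rewrite -addSn leq_add //.
  have Em : rt (f a.1) = - rt a.1 by rewrite Hf (actX_rt HRD).
  by have [-> ->] := k1 a.1 (f a.1) erefl Em; lia.
by apply: leq_sum => i /andP[/asboolP/le].
Qed.

Lemma alcove_trans v : regJ v ->
  exists w q, [/\ inWJ w, corootM q & alcove (actA w v + intv q)].
Proof.
have [n] := ubnP (nsep v); elim: n v => // n IH v hn rv.
have [hv|hv] := pselect (alcove v).
  by exists 1%:M, 0; split; [constructor|exact: corootM0|rewrite actA1 intv0 addr0].
have [a sa ea] : exists2 a, simpA a & evr (el a) v < 0.
  apply: contrapT => h; apply: hv; apply: (alcove_of_simple HRD) => a sa.
  rewrite lt_def (regJ_evr rv (simpA_inRM sa) 0) leNgt /=.
  by apply/negP => ?; apply: h; exists a.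
have ha := simpA_inRM sa.
have [|w [q [hw hq]]] := IH (refl_pt a v) _ (regJ_refl ha rv).
  by apply: leq_trans (nsep_lt sa rv ea) _; rewrite -ltnS.
rewrite (refl_ptE HRD) (@inWM_comp _ _ _ _ _ _ _ HRD J w (sref a.1) q _ v hw (inWM_sref crt ha)).
exists (w *m sref a.1), (actY w (- a.2 *: crt a.1) + q); split => //.
  by apply: inWM_mul => //; exact: inWM_sref.
apply: corootMD => //; apply: (corootM_act HRD) => //.
by apply: corootMZ; exact: corootM_crt.
Qed.

(** [w] is the linear part of the element that brings the translated base point [v0 + y] back into
    the alcove. *)
Lemma weakW_exists y : exists w, weakW rt crt sr J (avg (intv y)) w.
Proof.
have hv := alcove_ptP R HRD J.
have [|w [q [hw hq ha]]] := @alcove_trans (v0 + intv y).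
  by rewrite -[v0]actA1; apply: regJ_aff; [constructor|exact: regJ_alcove].
exists w; split=> //; exists (actY w y + q); split.
  by rewrite intvD (avgD HRD) (avg_coroot R HRD hq) addr0 -actA_intv (avg_act HRD).
by exists v0; split => //; move: ha; rewrite actAD actA_intv intvD addrA.
Qed.

Lemma wnu_weak nu : inNG rt crt sr J nu -> weakW rt crt sr J nu (wnu rt crt sr J nu).
Proof.
move=> [[y ->] _]; apply: (IsWnu_weak HRD).
rewrite /wnu; apply: ClassicalEpsilon.epsilon_spec.
by have [w hw] := weakW_exists y; exists w; exact: weak_IsWnu.
Qed.

Lemma pA_inRM_eq0 x v : (forall j, j \in J -> pairXA (rt (sr j)) v = 0) ->
  inRJ x -> pairXA x v = 0.
Proof.
move=> h [c [cJ ->]]; rewrite pA_suml big1 // => j _.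
by have [/h->|/cJ->] := boolP (j \in J); rewrite ?mulr0 // mul0r.
Qed.
Lemma actA_fixed v w : (forall j, j \in J -> pairXA (rt (sr j)) v = 0) ->
  inWJ w -> actA w v = v.
Proof.
move=> h; elim=> [|i u hi hu IH]; first by rewrite actA1.
rewrite actAM ?(sref_unit HRD) ?(inWM_unit HRD hu) // IH.
apply: pA_eq => x; rewrite pA_actA (sref_inv HRD) actX_sref pABl pAZl.
by rewrite (pA_inRM_eq0 h hi) mulr0 subr0.
Qed.
Lemma avg_simple0 v j : j \in J -> pairXA (rt (sr j)) (avg v) = 0.
Proof.
move=> jJ; have hj : inRJ (rt (sr j)) by apply: coneJ_inRM; exact: coneJ_simple.
have := congr1 (pairXA (rt (sr j))) (actA_avg HRD v (inWM_sref crt hj)).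
by rewrite pA_actA (sref_inv HRD) (actX_rt HRD) pANl; lra.
Qed.
Lemma alcove_shift v nu : (forall j, j \in J -> pairXA (rt (sr j)) nu = 0) ->
  alcove v -> alcove (v + nu).
Proof.
move=> h hv; apply/(alcoveP HRD) => b pb; have := alcove_posA HRD hv pb.
rewrite /evr pADr; have [[i [hi ->]] _] := pb.
by rewrite (pA_inRM_eq0 h hi) addr0.
Qed.

(** Conjugate by the element [(u, q)] that moves [v] into the alcove. The equation survives because
    [W_M] fixes [nu], and the alcove is stable under translation by [nu], on which all roots of [M]
    vanish. The corrections to the translation part average to zero. *)
Lemma conj_weak g nu v y : inWJ g -> regJ v -> nu = avg nu ->
  actA g v + intv y = v + nu ->
  exists2 u, inWJ u & weakW rt crt sr J nu (u *m g *m invmx u).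
Proof.
move=> hg rv nuE Eg; have [u [q [hu hq ha]]] := alcove_trans rv; exists u => //.
have hu' := inWM_inv HRD hu.
have hc : inWJ (u *m g *m invmx u) by do 2!apply: inWM_mul => //.
have nu0 j : j \in J -> pairXA (rt (sr j)) nu = 0.
  by move=> jJ; rewrite nuE avg_simple0.
split => //; exists (actY u y + (q - actY (u *m g *m invmx u) q)); split.
  have hd : corootM (q - actY (u *m g *m invmx u) q).
    by rewrite -opprB; apply: corootMN; exact: corootM_diff.
  rewrite intvD (avgD HRD) (avg_coroot R HRD hd) addr0 -actA_intv (avg_act HRD) //.
  have := congr1 avg Eg; rewrite !(avgD HRD) (avg_act HRD) // => /addrI ->.
  by rewrite -nuE.
exists (actA u v + intv q); split => //.
have -> : actA (u *m g *m invmx u) (actA u v + intv q) +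
    intv (actY u y + (q - actY (u *m g *m invmx u) q)) = actA u v + intv q + nu.
  have Uu := inWM_unit HRD hu; have Ug := inWM_unit HRD hg.
  have -> : actA u v + intv q + nu = actA u (v + nu) + intv q.
    by rewrite actAD (actA_fixed nu0 hu) addrAC.
  rewrite -Eg !intvD intvN -!actA_intv !actAD -actAM ?unitmx_mul ?Uu ?Ug ?unitmx_inv //.
  rewrite mulmxKV // [actA (u *m g) v]actAM // -!addrA; congr (_ + _).
  by rewrite addrCA; congr (_ + _); rewrite addrCA subrr addr0.
exact: alcove_shift.
Qed.

(* Averaging an orbit of the alcove-preserving map gives a fixed point up to [nu]. *)
Lemma weakW_fixed nu w : weakW rt crt sr J nu w ->
  exists v y, alcove v /\ actA w v + intv y = v + nu.
Proof.
move=> [hw [y [ay [v [hv hv1]]]]].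
pose P i := iter i (mulmx w) 1%:M.
have hP i : inWJ (P i) by elim: i => [|i IH] /=; [constructor|exact: inWM_mul].
have PD i j : P (i + j)%N = P i *m P j.
  by elim: i => [|i IH]; rewrite ?mul1mx // addSn /= IH mulmxA.
(* Pigeonhole in the finite group: two powers of [w] agree, so some positive power [m] is
   trivial. *)
have [m m0 Pm] : exists2 m, (0 < m)%N & P m = 1%:M.
  have [s [us hs]] := finite_WM HRD J.
  have : ~~ uniq (map P (iota 0 (size s).+1)).
    apply/negP => /(fun u => uniq_leq_size (s2 := s) u)/(_ _).
    rewrite size_map size_iota ltnn => h; have : false by apply: h => x /mapP[i _ ->]; apply/hs.
    by [].
  move/(uniqPn 1%:M) => [i [j [ij]]]; rewrite size_map size_iota => jn.
  rewrite !(nth_map 0%N) ?size_iota ?(ltn_trans ij jn) // !nth_iota ?(ltn_trans ij jn) //.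
  rewrite !add0n => E; exists (j - i)%N; first by rewrite subn_gt0.
  have := PD i (j - i)%N; rewrite subnKC ?(ltnW ij) // -E => /(congr1 (mulmx (invmx (P i)))).
  by rewrite mulKmx ?mulVmx // (inWM_unit HRD (hP i)).
pose T u := actA w u + intv y.
have hT u : alcove u -> alcove (T u) by exact: (alcove_map HRD hw hv hv1).
have hTi i u : alcove u -> alcove (iter i T u).
  by move=> hu; elim: i => //= i IH; exact: hT.
have Ti i : exists t, forall u, iter i T u = actA (P i) u + intv t.
  elim: i => [|i [t Ht]]; first by exists 0 => u; rewrite actA1 intv0 addr0.
  by exists (actY w t + y) => u; rewrite /= Ht /T (@inWM_comp _ _ _ _ _ _ _ HRD J w (P i) y t u hw (hP i)).
have [t Ht] := Ti m.
(* The [m]-th iterate is the translation by [t] and preserves the alcove, where simple roots range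
   in an interval of length 1; the integer [<rt (sr j), t>] is therefore 0. *)
have t0 j : j \in J -> pairXA (rt (sr j)) (intv t) = 0.
  move=> jJ; have pj := coneJ_simple rt sr jJ.
  have /andP[a1 a2] := posJ_range HRD hv pj.
  have /andP[] := posJ_range HRD (hTi m v hv) pj.
  rewrite Ht Pm actA1 pADr pA_intv => b1 b2.
  have c1 : (pairXY (rt (sr j)) t)%:~R < 1%:~R :> R by rewrite (_ : 1%:~R = 1 :> R) //; lra.
  have c2 : (-1)%:~R < (pairXY (rt (sr j)) t)%:~R :> R.
    by rewrite rmorphN1; lra.
  by move: c1 c2; rewrite !ltr_int => c1 c2; have -> : pairXY (rt (sr j)) t = 0 by lia.
have m0' : (m%:R : R) != 0 by rewrite pnatr_eq0 -lt0n.
pose vb := (m%:R)^-1 *: \sum_(0 <= i < m) iter i T v.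
have Evb : actA w vb + intv y = vb + (m%:R)^-1 *: intv t.
  have -> : intv y = (m%:R)^-1 *: \sum_(0 <= i < m) intv y.
    by rewrite sumr_const_nat subn0 -scaler_nat scalerA mulVf // scale1r.
  rewrite actAZ -!scalerDr actA_sum -big_split /=; congr (_ *: _).
  have -> : \sum_(0 <= i < m) (actA w (iter i T v) + intv y) = \sum_(0 <= i < m) iter i.+1 T v.
    by apply: eq_bigr.
  have E1 : \sum_(0 <= i < m.+1) iter i T v = \sum_(0 <= i < m) iter i T v + iter m T v.
    by rewrite big_nat_recr.
  move: E1; rewrite big_nat_recl // Ht Pm actA1 => E1.
  by apply: (addrI v); apply: etrans E1 _; rewrite addrCA.
have avb : alcove vb.
  apply/(alcoveP HRD) => b pb; rewrite /evr /vb pAZr pA_sumr.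
  have mp : (0 : R) < m%:R by rewrite ltr0n.
  rewrite -(pmulr_rgt0 _ mp) mulrDr mulrA divff // mul1r mulr_natl.
  rewrite -[m in _ *+ m]subn0 -sumr_const_nat -big_split /= big_ltn //.
  rewrite ltr_pwDl //; first exact: alcove_posA (hTi 0%N v hv) pb.
  by apply: sumr_ge0 => i _; apply: ltW; apply: (alcove_posA HRD (hTi i v hv) pb).
exists vb, y; split => //; rewrite Evb; congr (_ + _).
(* Averaging identifies [t / m] with [nu], since [t / m], being killed by the roots of [M], is its
   own average. *)
have := congr1 avg Evb; rewrite !(avgD HRD) (avg_act HRD) // ay => /addrI ->.
rewrite (avg_fixed HRD) // => u hu; apply: actA_fixed => // j jJ.
by rewrite pAZr t0 // mulr0.
Qed.
End Transitivity.

(** * Dominant weights and orbit sums *)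

Lemma seq_argmax (T : eqType) (s : seq T) (f : T -> int) :
  s != [::] -> exists2 x, x \in s & forall y, y \in s -> f y <= f x.
Proof.
case: s => // a s _; elim: s a => [|b s IH] a.
  by exists a => [|y]; rewrite inE // => /eqP->.
have [x xs hx] := IH b; have [h|h] := lerP (f a) (f x).
  exists x; first by rewrite inE xs orbT.
  by move=> y; rewrite inE => /orP[/eqP->|/hx].
exists a; first exact: mem_head.
move=> y; rewrite inE => /orP[/eqP->|/hx hy] //.
exact: le_trans hy (ltW h).
Qed.

Section Dominance.
Variables (l k N : nat) (rt crt : 'I_N -> 'rV[int]_(l + k)) (sr : 'I_l -> 'I_N).
Hypothesis HRD : based_root_datum rt crt sr.
Local Notation sref := (sref rt crt).
Local Notation inW := (inW rt crt).
Local Notation formX := (formX crt).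
Local Notation posr := (posr rt sr).
Local Notation cone := (cone rt sr).
Local Notation y0 := (y0 rt crt sr).
Local Notation JT := [set: 'I_l]%SET.
Implicit Types (x y : 'rV[int]_(l + k)) (w : 'M[int]_(l + k)).

Lemma actX_ext w w' : (forall x, actX w x = actX w' x) -> w = w'.
Proof.
by move=> H; apply: trmx_inj; apply/row_matrixP => i; rewrite !rowE; exact: H.
Qed.
Lemma inRM_setT i : inRM rt sr JT (rt i).
Proof.
by have [c [_ Ei]] := rt_decomp HRD i; exists c; split => // j; rewrite inE.
Qed.
Lemma posJ_setT i : posJ rt sr JT i <-> posr i.
Proof.
split=> [/coneJ_cone//|[c [c0 Ei]]].
by exists c; split => // j; rewrite inE.
Qed.

Definition wmat (u : seq ('I_N * int)) := foldr (fun a w => sref a.1 *m w) 1%:M u.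
Lemma act_wmat u (b : 'rV[int]_(l + k) * int) : (act rt crt u b).1 = actX (wmat u) b.1.
Proof. by elim: u => [|a u IH]; rewrite ?actX1 //= actXM -IH actX_sref. Qed.
Lemma inW_wmat u : inW (wmat u).
Proof. by elim: u => [|a u IH] /=; constructor. Qed.
Lemma act_simpF2 u (b : 'rV[int]_(l + k) * int) : word (simpF sr JT) u -> (act rt crt u b).2 = b.2.
Proof.
elim: u => //= a u IH hu; rewrite IH => [|c cu]; last by apply: hu; rewrite inE cu orbT.
by have [j _ ->] := hu a (mem_head _ _); rewrite mulr0 subr0.
Qed.
Lemma wmat_cat u v : wmat (u ++ v) = wmat u *m wmat v.
Proof. by elim: u => [|a u IH] /=; rewrite ?mul1mx // IH mulmxA. Qed.
Lemma inW_word w : inW w -> exists2 u, word (simpF sr JT) u & wmat u = w.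
Proof.
elim=> [|i {}w hw [u hu <-]]; first by exists [::].
have [v hv Ev] := reflectionF HRD (inRM_setT i).
exists (v ++ u); first exact: wordP_cat.
rewrite wmat_cat; congr (_ *m _); apply: actX_ext => x.
by rewrite -(act_wmat v (x, 0)) -Ev actX_sref.
Qed.

(** Induction along a reduced word: the condition that [w] keeps [rt (sr j)] positive says that
    appending the letter raises the length. [dom_max] and [stabilizer] live off this sign. *)
Lemma W_ind (P : 'M[int]_(l + k) -> Prop) : P 1%:M ->
  (forall w j m, inW w -> P w -> posr m -> rt m = actX w (rt (sr j)) -> P (w *m sref (sr j))) ->
  forall w, inW w -> P w.
Proof.
move=> P1 PS w /inW_word[u]; have [n] := ubnP (size u).
elim: n u w => // n IH u w un hu Ew.
have FA a : simpF sr JT a -> simpA rt sr JT a by left.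
have [u' [hu' Eu' su' [E0|[u'' [a [Er pa]]]]]] := reduced_word HRD FA hu.
  suff -> : w = 1%:M by [].
  by apply: actX_inj => x; rewrite -Ew -(act_wmat u (x, 0)) -Eu' E0.
have ha : simpF sr JT a by apply: hu'; rewrite Er mem_rcons mem_head.
have hu'' : word (simpF sr JT) u'' by move=> c cu; apply: hu'; rewrite Er mem_rcons inE cu orbT.
have Ew' : w = wmat u'' *m sref a.1.
  apply: actX_ext => x; rewrite -Ew -(act_wmat u (x, 0)) -Eu' act_wmat Er.
  by rewrite -cats1 wmat_cat /= mulmx1.
have [j _ Ea] := ha; have [[m [_ Em]] mm] := pa.
have hm : rt m = actX (wmat u'') (rt (sr j)) by rewrite -Em act_wmat Ea.
rewrite Ew' Ea; apply: (PS _ _ m) => //; first exact: inW_wmat.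
  apply: (IH u'') => //; move: un su'; rewrite Er size_rcons; lia.
apply/posJ_setT/(posJP HRD); split; first exact: inRM_setT.
by move: mm; rewrite /mu act_simpF2 // Em Ea /= mulr0 addr0.
Qed.

Lemma inW_crt w i m : inW w -> rt m = actX w (rt i) -> crt m = actY w (crt i).
Proof.
move=> hw E; have U := inW_unit HRD hw; apply: pairl_eq => x.
rewrite -[x](actXVK _ U) pair_act //.
by apply: (crt_equiv HRD _ (esym E)) => ? ?; exact: (inW_form HRD _ _ hw).
Qed.

(** A lift of [rho]: strictly dominant, hence positive on every positive coroot. *)
Definition rhoX : 'rV[int]_(l + k) := \sum_(j < l) delta_mx 0 (lshift k j).
Lemma pair_rho j : pairXY rhoX (crt (sr j)) = 1.
Proof.
rewrite /rhoX pair_suml (bigD1 j) //= pair_deltal (crt_simple HRD) mxE !eqxx.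
rewrite big1 ?addr0 // => j' nj; rewrite pair_deltal mxE eqxx /=.
by rewrite (inj_eq (@lshift_inj _ _)) (negPf nj).
Qed.
Definition dom x := forall j, 0 <= pairXY x (crt (sr j)).

Lemma cone_dom_ge0 x y : cone x -> dom y -> 0 <= formX x y.
Proof.
move=> [c [c0 ->]] dy; apply: formX_cone => // j _.
by rewrite formXC -(pair_form_ge0 HRD).
Qed.
Lemma pair_rho_pos m : posr m -> 0 < pairXY rhoX (crt m).
Proof.
move=> pm; have [c [c0 Em]] := pm.
have dr : dom rhoX by move=> j; rewrite pair_rho.
rewrite lt_def (pair_form_ge0 HRD) formXC cone_dom_ge0 // andbT.
apply/eqP => h; have := formX_rt HRD rhoX m; rewrite h mul0r => /eqP.
rewrite mulf_eq0 /= formXC Em /lincomb formX_suml => /eqP/psumr_eq0P h0.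
case/eqP: (rt_neq0 HRD m); rewrite Em /lincomb big1 // => j _.
have /eqP : c j * formX (rt (sr j)) rhoX = 0.
  apply: h0 => // i _; rewrite mulr_ge0 // formXC -(pair_form_ge0 HRD); exact: dr.
rewrite mulf_eq0 => /orP[/eqP->|/eqP h1]; first by rewrite scale0r.
have := pair_rho j; have := formX_rt HRD rhoX (sr j).
by rewrite formXC h1 mulr0 => h2 h3; move: h2; rewrite h3 mul1r => /eqP;
  rewrite eq_sym gt_eqF // (formX_rt_gt0 HRD).
Qed.

(** Each step of [W_ind] subtracts a nonnegative multiple of the positive root [w alpha_j]. *)
Lemma dom_max x w : dom x -> inW w -> cone (x - actX w x).
Proof.
move=> dx; move: w; apply: W_ind => [|w j m hw IH pm Em].
  by rewrite actX1 subrr; exact: cone0.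
rewrite actXM actX_sref actXB actXZ -Em opprB addrCA addrC.
by apply: coneD => //; apply: coneZ.
Qed.

(** An element of the finite orbit with largest pairing with [y0] is dominant, otherwise a simple
    reflection would raise that pairing. *)
Lemma dom_conj x : exists2 w, inW w & dom (actX w x).
Proof.
have [s [us hs]] := finite_W HRD.
have s0 : s != [::].
  have /hs : inW 1%:M by constructor.
  by case: s {us hs}.
have [w /hs hw mw] := seq_argmax (fun w => pairXY (actX w x) y0) s0.
exists w => // j; have /hs/mw : inW (sref (sr j) *m w) by constructor.
by rewrite actXM actX_sref pairBl pairZl (pair_simple_y0 HRD); lia.
Qed.

(** The difference of norms is [(x - y, x) + (x - y, y)], a sum of two nonnegative terms. So the
    norm can serve as the measure of the triangular induction. *)
Lemma dom_form x y : dom x -> dom y -> cone (x - y) ->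
  formX y y <= formX x x /\ (formX y y = formX x x -> y = x).
Proof.
move=> dx dy cxy.
have h1 := cone_dom_ge0 cxy dx; have h2 := cone_dom_ge0 cxy dy.
move: (h1) (h2); rewrite !formXBl (formXC _ y x) => h1' h2'.
split; first by lia.
move=> E; apply/eqP; rewrite eq_sym -subr_eq0; apply/eqP.
have [c [_ Ec]] := cxy.
apply: (formX_eq0 HRD); first by rewrite Ec; exact: lincomb_span.
by rewrite formXBr !formXBl (formXC _ y x); lia.
Qed.

(** [phi w = <rho, nu - w nu>] never decreases along a reduced word: letter [j] adds
    [<alpha_j, nu> <rho, w alpha_j^vee>], whose second factor is positive. If [phi] vanishes, every
    letter has [<alpha_j, nu> = 0] and so lies in [J]. *)
Lemma stabilizer (R : realType) (J : {set 'I_l}) (nu : 'rV[R]_(l + k)) w :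
  (forall j, 0 <= pairXA (rt (sr j)) nu) -> (forall j, j \notin J -> 0 < pairXA (rt (sr j)) nu) ->
  inW w -> actA w nu = nu -> inWM rt crt sr J w.
Proof.
move=> nu0 nuJ; pose phi w := pairXA rhoX (nu - actA w nu).
have main u : inW u -> 0 <= phi u /\ (phi u = 0 -> inWM rt crt sr J u).
  move: u; apply: W_ind => [|u j m hu [IH1 IH2] pm Em].
    by rewrite /phi actA1 subrr pA0r; split => // _; constructor.
  have Ep : phi (u *m sref (sr j)) = phi u +
      pairXA (rt (sr j)) nu * (pairXY rhoX (crt m))%:~R.
    have Es : actA (sref (sr j)) nu = nu - pairXA (rt (sr j)) nu *: intv R (crt (sr j)).
      apply: pA_eq => x; rewrite pA_actA (sref_inv HRD) actX_sref pABl pAZl.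
      by rewrite pABr pAZr pA_intv mulrC.
    rewrite /phi actAM ?(inW_unit HRD hu) ?(sref_unit HRD) // Es actAD actAN actAZ.
    rewrite actA_intv -(inW_crt hu Em) !pABr pAZr pA_intv; ring.
  have r0 : (0 : R) < (pairXY rhoX (crt m))%:~R by rewrite ltr0z pair_rho_pos.
  have t0 : 0 <= pairXA (rt (sr j)) nu * (pairXY rhoX (crt m))%:~R.
    by rewrite mulr_ge0 // ltW.
  rewrite Ep; split=> [|E]; first by rewrite addr_ge0.
  have p0 : phi u = 0 by lra.
  have /eqP : pairXA (rt (sr j)) nu * (pairXY rhoX (crt m))%:~R = 0 by lra.
  rewrite mulf_eq0 (gt_eqF r0) orbF => /eqP nj.
  have jJ : j \in J by apply: contraT => /nuJ; rewrite nj ltxx.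
  apply: inWM_mul; first exact: IH2.
  by apply: inWM_sref; apply: coneJ_inRM; exact: coneJ_simple.
by move=> hw E; apply: (main w hw).2; rewrite /phi E subrr pA0r.
Qed.

Definition lsum (L : seq 'I_l) : 'rV[int]_(l + k) := \sum_(j <- L) delta_mx 0 (lshift k j).
Lemma lsum_dom L : dom (lsum L).
Proof.
move=> j; rewrite /lsum; elim/big_ind: _ => [|x y hx hy|i _].
- by rewrite pair0l.
- by rewrite pairDl addr_ge0.
- by rewrite pair_deltal (crt_simple HRD) mxE ler0n.
Qed.

Lemma crt_rshift i j : crt i 0 (rshift l j) = 0.
Proof.
apply: (crt_suppJ HRD (inRM_setT i)) => j' _.
by rewrite eq_sym eq_lrshift.
Qed.
(** All coroots live in the first [l] coordinates, so a remainder supported on the last [k] is fixed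
    by [W]. Dominance makes the multiplicities in [L] natural numbers. *)
Lemma dom_decomp x : dom x -> exists L y,
  [/\ x = lsum L + y, forall j, y 0 (lshift k j) = 0 & forall w, inW w -> actX w y = y].
Proof.
move=> dx.
pose L := flatten [seq nseq (absz (x 0 (lshift k j))) j | j <- enum 'I_l].
have EL : lsum L = \sum_(j < l) x 0 (lshift k j) *: delta_mx 0 (lshift k j).
  rewrite /lsum /L big_flatten big_map big_enum; apply: eq_bigr => j _ /=.
  rewrite big_nseq iter_addr_0 -scaler_nat; congr (_ *: _).
  have := dx j; rewrite (crt_simple HRD) pair_deltar => h.
  by rewrite natz gez0_abs.
have y00 j : (x - lsum L) 0 (lshift k j) = 0.
  rewrite !mxE EL summxE (bigD1 j) //= !mxE !eqxx mulr1 big1 ?addr0 ?subrr //.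
  move=> i ni; rewrite !mxE eqxx /= (inj_eq (@lshift_inj _ _)) eq_sym (negPf ni).
  by rewrite mulr0.
exists L, (x - lsum L); split => //; first by rewrite addrC subrK.
have p0 i : pairXY (x - lsum L) (crt i) = 0.
  rewrite /pairXY big_split_ord /= big1 ?add0r => [|j _]; last by rewrite y00 mul0r.
  by rewrite big1 // => j _; rewrite crt_rshift mulr0.
move=> w; elim=> [|i u hu IH]; first by rewrite actX1.
by rewrite actXM IH actX_sref p0 scale0r subr0.
Qed.

(* [msum orb L] lists the weights of the product of the orbit sums indexed by [L]. *)
Variable orb : 'I_l -> seq 'rV[int]_(l + k).
Hypothesis orbP : forall j x, x \in orb j <->
  exists w, inW w /\ x = actX w (delta_mx 0 (lshift k j)).
Definition msum (L : seq 'I_l) : seq 'rV[int]_(l + k) :=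
  foldr (fun j t => [seq x + y | x <- orb j, y <- t]) [:: 0] L.

Lemma dom_delta j : dom (delta_mx 0 (lshift k j)).
Proof. by move=> i; rewrite pair_deltal (crt_simple HRD) mxE ler0n. Qed.
Lemma msum_cone L x w : x \in msum L -> inW w -> cone (lsum L - actX w x).
Proof.
move=> + hw; elim: L x => [|j L IH] x.
  rewrite inE => /eqP->; rewrite /lsum big_nil /actX mul0mx subr0; exact: cone0.
move=> /allpairsP[[a b] /= [/orbP[u [hu ->]] /IH hb ->]].
rewrite /lsum big_cons -/(lsum L) actXD opprD addrACA; apply: coneD => //.
by rewrite -actXM; apply: dom_max; [exact: dom_delta|exact: inW_mul].
Qed.
Lemma mem_msum L : lsum L \in msum L.
Proof.
elim: L => [|j L IH]; first by rewrite /lsum big_nil mem_head.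
rewrite /lsum big_cons -/(lsum L); apply/allpairsP.
exists (delta_mx 0 (lshift k j), lsum L); split => //=.
by apply/orbP; exists 1%:M; rewrite actX1; split=> //; constructor.
Qed.
(** This is the triangularity: the dominant conjugate of a weight of the product lies below
    [lsum L], hence equals it or is strictly shorter. *)
Lemma msum_dich L x : x \in msum L ->
  (exists2 w, inW w & actX w x = lsum L) \/ formX x x < formX (lsum L) (lsum L).
Proof.
move=> xL; have [w hw dw] := dom_conj x.
have [] := dom_form (@lsum_dom L) dw (msum_cone xL hw).
rewrite (inW_form HRD _ _ hw) => h1 h2; have [/h2 E|ne] := eqVneq (formX x x) (formX (lsum L) (lsum L)).
  by left; exists w.
by right; rewrite lt_def eq_sym ne.
Qed.
End Dominance.

(** Linear independence of characters, in a form that tolerates repetitions. A character differing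
    from [chi] at [z] is eliminated by subtracting [psi i z] times the relation at [x] from the
    relation at [x + z]. *)
Lemma dedekind (X : zmodType) (F : idomainType) (I : eqType) (psi : I -> X -> F)
    (chi : X -> F) :
  (forall i x y, psi i (x + y) = psi i x * psi i y) ->
  (forall x y, chi (x + y) = chi x * chi y) -> chi 0 = 1 ->
  forall (s : seq I) (c : I -> F) d, (forall x, \sum_(i <- s) c i * psi i x = d * chi x) ->
  \sum_(i <- s | `[< psi i = chi >]) c i = d.
Proof.
move=> psiD chiD chi0; elim=> [|i s IH] c d H.
  by have := H 0; rewrite !big_nil chi0 mulr1.
rewrite big_cons; case: asboolP => [Ei|ni].
  rewrite (IH c (d - c i)) => [|x]; first by rewrite addrC subrK.
  by have := H x; rewrite big_cons Ei mulrBl => <-; rewrite addrC addKr.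
have [z hz] : exists z, psi i z != chi z.
  apply: contrapT => h; apply: ni; apply/funext => z; apply/eqP.
  by apply/negP => /negP ?; apply: h; exists z.
have nz : chi z - psi i z != 0 by rewrite subr_eq0 eq_sym.
have main : \sum_(j <- s | `[< psi j = chi >]) (c j * (psi j z - psi i z)) =
    d * (chi z - psi i z).
  apply: IH => x; have h1 := H (x + z); have h2 := H x.
  have -> : d * (chi z - psi i z) * chi x = d * chi (x + z) - psi i z * (d * chi x).
    by rewrite chiD; ring.
  rewrite -h1 -h2 !big_cons psiD mulrDr mulr_sumr opprD addrACA -sumrB.
  rewrite (_ : _ - _ = 0) ?add0r; last by ring.
  by apply: eq_bigr => j _; rewrite psiD; ring.
apply: (mulIf nz); rewrite -main mulr_suml.
by apply: eq_bigr => j /asboolP ->.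
Qed.

(** * Separation of Weyl orbits of characters by orbit sums *)

Section Orbits.
Variables (l k N : nat) (rt crt : 'I_N -> 'rV[int]_(l + k)) (sr : 'I_l -> 'I_N).
Hypothesis HRD : based_root_datum rt crt sr.
Local Notation inW := (inW rt crt).
Local Notation formX := (formX crt).
Implicit Types (x y : 'rV[int]_(l + k)) (w : 'M[int]_(l + k)).
Variable F : idomainType.
Hypothesis char0 : forall n : nat, n.+1%:R != 0 :> F.
Variables (orb : 'I_l -> seq 'rV[int]_(l + k)) (s : seq 'M[int]_(l + k)).
Hypothesis orb_uniq : forall j, uniq (orb j).
Hypothesis orbP : forall j x, x \in orb j <->
  exists w, inW w /\ x = actX w (delta_mx 0 (lshift k j)).
Hypothesis s_uniq : uniq s.
Hypothesis sP : forall w, w \in s <-> inW w.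
(** The sum runs over the group, not over the orbit: elements are repeated according to their
    stabiliser, which spares listing the orbits of arbitrary weights. *)
Definition osum (chi : 'rV[int]_(l + k) -> F) x := \sum_(w <- s) chi (actX w x).

Definition ismorph (chi : 'rV[int]_(l + k) -> F) :=
  (forall x y, chi (x + y) = chi x * chi y) /\ chi 0 = 1.

Lemma osum_act chi w x : inW w -> osum chi (actX w x) = osum chi x.
Proof.
move=> hw; have U := inW_unit HRD hw; rewrite /osum.
have -> : \sum_(u <- s) chi (actX u (actX w x)) = \sum_(u <- [seq u *m w | u <- s]) chi (actX u x).
  by rewrite big_map; apply: eq_bigr => u _; rewrite actXM.
apply: perm_big; apply: uniq_perm => //.
  by rewrite map_inj_uniq // => u u' /(congr1 (fun a => a *m invmx w)); rewrite !mulmxK.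
move=> u; apply/mapP/idP => [[u' /sP hu' ->]|/sP hu].
  by apply/sP; apply: inW_mul.
exists (u *m invmx w); last by rewrite mulmxKV.
by apply/sP; apply: inW_mul => //; exact: (inW_inv HRD).
Qed.

Lemma orb_act (G : 'rV[int]_(l + k) -> F) j w : inW w ->
  \sum_(x <- orb j) G (actX w x) = \sum_(x <- orb j) G x.
Proof.
move=> hw; have U := inW_unit HRD hw.
rewrite -(big_map (actX w) xpredT G); apply: perm_big; apply: uniq_perm => //.
  by rewrite map_inj_uniq // => x y /(congr1 (actX (invmx w))); rewrite !actXK.
move=> x; apply/mapP/idP => [[y /orbP[u [hu ->]] ->]|/orbP[u [hu ->]]].
  by apply/orbP; exists (w *m u); rewrite actXM; split=> //; exact: inW_mul.
exists (actX (invmx w *m u) (delta_mx 0 (lshift k j))).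
  by apply/orbP; exists (invmx w *m u); split=> //; apply: inW_mul => //; exact: (inW_inv HRD).
by rewrite actXM actXVK.
Qed.

Lemma prod_orb chi L : ismorph chi ->
  \prod_(j <- L) \sum_(x <- orb j) chi x = \sum_(x <- msum orb L) chi x.
Proof.
move=> [chiD chi0]; elim: L => [|j L IH]; first by rewrite big_nil /= big_seq1 chi0.
rewrite big_cons IH /= big_allpairs_dep /= mulr_suml; apply: eq_bigr => x _.
by rewrite mulr_sumr; apply: eq_bigr => y _; rewrite chiD.
Qed.

(** The product of orbit sums is [W]-invariant; summing it over [W] turns its expansion into weights
    into a sum of [osum]. *)
Lemma osum_prod chi L : ismorph chi ->
  (size s)%:R * \prod_(j <- L) \sum_(x <- orb j) chi x = \sum_(x <- msum orb L) osum chi x.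
Proof.
move=> hchi; rewrite /osum exchange_big /= mulr_natl -[RHS]/(\sum_(w <- s) _).
rewrite -[size s]/(size s) -(count_predT s) -iter_addr_0 -big_const_seq big_seq [RHS]big_seq.
apply: eq_bigr => w /sP hw; have [chiD chi0] := hchi.
rewrite -(@prod_orb (fun x => chi (actX w x))); last first.
  by split=> [x y|]; rewrite ?actXD ?chiD // /actX mul0mx.
by apply: eq_bigr => j _; rewrite orb_act.
Qed.

Lemma morph_inv chi x : ismorph chi -> chi x * chi (- x) = 1.
Proof. by move=> [chiD <-]; rewrite -chiD subrr. Qed.
Lemma morph_neq0 chi x : ismorph chi -> chi x != 0.
Proof.
move=> h; apply/eqP => E; have := morph_inv x h; rewrite E mul0r.
by move/esym/eqP; rewrite oner_eq0.
Qed.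
Lemma morph_eqN chi chi' x : ismorph chi -> ismorph chi' -> chi x = chi' x ->
  chi (- x) = chi' (- x).
Proof.
move=> h h' E; apply: (mulfI (morph_neq0 x h)).
by rewrite (morph_inv x h) E (morph_inv x h').
Qed.
Lemma morph_eqZ chi chi' x c : ismorph chi -> ismorph chi' -> chi x = chi' x ->
  chi (c *: x) = chi' (c *: x).
Proof.
move=> h h' E; have En (n : nat) : chi (n%:Z *: x) = chi' (n%:Z *: x).
  elim: n => [|n IH]; first by rewrite scale0r h.2 h'.2.
  by rewrite intS scalerDl scale1r h.1 h'.1 E IH.
case: c => n; first exact: En.
by rewrite NegzE scaleNr; apply: morph_eqN => //; exact: En.
Qed.

Lemma osum_eq chi chi' : ismorph chi -> ismorph chi' ->
  (forall j, \sum_(x <- orb j) chi x = \sum_(x <- orb j) chi' x) ->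
  (forall i, chi (delta_mx 0 (rshift l i)) = chi' (delta_mx 0 (rshift l i))) ->
  forall x, osum chi x = osum chi' x.
Proof.
move=> hc hc' Ec Er x.
(* The induction is on the norm, a nonnegative integer constant on orbits. *)
have [n] : exists n : nat, formX x x < n%:Z by exists (absz (formX x x)).+1; lia.
elim: n x => [|n IH] x hx; first by move: hx; have := formX_ge0 crt x; lia.
have [u hu du] := dom_conj HRD x.
rewrite -(osum_act chi x hu) -(osum_act chi' x hu).
have [L [y [Ey y00 yW]]] := dom_decomp HRD du.
have oD c : ismorph c -> osum c (lsum k L + y) = osum c (lsum k L) * c y.
  move=> [cD _]; rewrite /osum mulr_suml big_seq [RHS]big_seq; apply: eq_bigr => w /sP hw.
  by rewrite actXD cD yW.
rewrite Ey !oD //.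
have -> : chi y = chi' y.
  have -> : y = \sum_(i < k) y 0 (rshift l i) *: delta_mx 0 (rshift l i).
    apply/rowP => i; rewrite summxE; case: (split_ordP i) => j ->.
      rewrite y00 big1 // => i' _; rewrite !mxE eqxx /= eq_lrshift mulr0 //.
    rewrite (bigD1 j) //= !mxE !eqxx mulr1 big1 ?addr0 // => i' ni.
    by rewrite !mxE eqxx /= (inj_eq (@rshift_inj _ _)) eq_sym (negPf ni) mulr0.
  have sm c : ismorph c -> c (\sum_(i < k) y 0 (rshift l i) *: delta_mx 0 (rshift l i)) =
      \prod_(i < k) c (y 0 (rshift l i) *: delta_mx 0 (rshift l i)).
    by move=> [cD c0]; apply: (big_morph c cD c0).
  by rewrite !sm //; apply: eq_bigr => i _; apply: morph_eqZ.
congr (_ * _).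
have p0 i : pairXY y (crt i) = 0.
  rewrite /pairXY big_split_ord /= big1 ?add0r => [|j _]; last by rewrite y00 mul0r.
  by rewrite big1 // => j _; rewrite (crt_rshift HRD) mulr0.
(* Splitting off [y] leaves the norm unchanged because [y] kills every coroot, so the induction
   hypothesis covers the shorter weights of the product. *)
have fL : formX (lsum k L) (lsum k L) = formX x x.
  rewrite -(inW_form HRD x x hu) Ey /formX; apply: eq_bigr => i _.
  by rewrite pairDl p0 addr0.
have := osum_prod L hc; have := osum_prod L hc'.
have -> : \prod_(j <- L) \sum_(x <- orb j) chi' x = \prod_(j <- L) \sum_(x <- orb j) chi x.
  by apply: eq_bigr => j _; rewrite Ec.
(* [A] selects the weights conjugate to [lsum k L]: they contribute a positive integer multiple of
   the unknown [osum], which characteristic zero allows to cancel. *)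
pose A z := `[< exists2 w, inW w & actX w z = lsum k L >].
move=> -> ; rewrite (bigID A) /= [X in _ = X](bigID A) /=.
have oA c : \sum_(z <- msum orb L | A z) osum c z = osum c (lsum k L) *+ count A (msum orb L).
  rewrite -iter_addr_0 -big_const_seq.
  by apply: eq_bigr => z /asboolP[w hw <-]; rewrite osum_act.
rewrite !oA.
have -> : \sum_(z <- msum orb L | ~~ A z) osum chi' z = \sum_(z <- msum orb L | ~~ A z) osum chi z.
  rewrite big_seq_cond [RHS]big_seq_cond; apply: eq_bigr => z /andP[zL /asboolP nz].
  apply/esym/IH; have [//|lt] := msum_dich HRD orbP zL.
  by move: lt; rewrite fL; lia.
move/addIr; have : (0 < count A (msum orb L))%N.
  rewrite -has_count; apply/hasP; exists (lsum k L); first exact: (mem_msum orbP).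
  by apply/asboolP; exists 1%:M; [constructor|rewrite actX1].
case: (count _ _) => // m _ Em; apply/esym/(mulIf (char0 m)).
by rewrite !mulr_natr.
Qed.

(** If [chi'] were no translate of [chi], applying [dedekind] to [osum chi - osum chi' = 0] would
    make the coefficient of [chi'] vanish; but it is minus the number of [w] in [s] fixing [chi'],
    which is nonzero in characteristic zero. *)
Lemma orbit_separation chi chi' : ismorph chi -> ismorph chi' ->
  (forall j, \sum_(x <- orb j) chi x = \sum_(x <- orb j) chi' x) ->
  (forall i, chi (delta_mx 0 (rshift l i)) = chi' (delta_mx 0 (rshift l i))) ->
  exists2 w, inW w & forall x, chi' x = chi (actX w x).
Proof.
move=> hc hc' Ec Er; have E := osum_eq hc hc' Ec Er.
have hcomp c w : ismorph c -> ismorph (fun x => c (actX w x)).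
  by move=> [cD c0]; split => [x y|]; rewrite ?actXD ?cD // /actX mul0mx.
apply: contrapT => no.
pose psi (i : 'M[int]_(l + k) + 'M[int]_(l + k)) x :=
  match i with inl w => chi (actX w x) | inr w => chi' (actX w x) end.
pose c (i : 'M[int]_(l + k) + 'M[int]_(l + k)) : F := if i is inl _ then 1 else -1.
have psiD i x y : psi i (x + y) = psi i x * psi i y.
  by case: i => w; rewrite /psi actXD ?hc.1 ?hc'.1.
have H0 x : \sum_(i <- [seq inl w | w <- s] ++ [seq inr w | w <- s]) c i * psi i x = 0 * chi' x.
  rewrite big_cat !big_map /= mul0r.
  under eq_bigr do rewrite mul1r.
  under [X in _ + X]eq_bigr do rewrite mulN1r.
  by rewrite sumrN -/(osum chi x) -/(osum chi' x) E subrr.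
have := dedekind psiD hc'.1 hc'.2 H0.
rewrite big_cat !big_map /= big_seq_cond big1 ?add0r; last first.
  move=> w /andP[/sP hw /asboolP Ew]; exfalso; apply: no; exists w => // x.
  by rewrite -Ew.
rewrite sumrN => /eqP; rewrite oppr_eq0 big_const_seq iter_addr_0.
have : (0 < count (fun w => `[< psi (inr w) = chi' >]) s)%N.
  rewrite -has_count; apply/hasP; exists 1%:M; first by apply/sP; constructor.
  by apply/asboolP/funext => x; rewrite /psi actX1.
by case: (count _ _) => // m _; rewrite (negPf (char0 m)).
Qed.
End Orbits.

(** * The ring of Puiseux series *)

Section PuiseuxArith.
Variable R : realType.
Local Notation C := R[i].
Implicit Types (f g h : puis R) (q r : rat).

(** Exponents [(i - L) / D] with [i] natural encode a common denominator and a lower bound at once.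
    Series put on a common grid multiply by convolution over [i]. *)
Definition grid (D L i : nat) : rat := (i%:R - L%:R) / D%:R.
Definition onGrid (D L : nat) f := forall q, f q != 0 -> exists i, q = grid D L i.

Lemma grid_inj D L : (0 < D)%N -> injective (grid D L).
Proof.
move=> D0 i j; rewrite /grid => /(mulIf _) h.
have /h/addIr/eqP : D%:R^-1 != 0 :> rat by rewrite invr_eq0 pnatr_eq0 -lt0n.
by rewrite eqr_nat => /eqP.
Qed.
Lemma gridB D L1 L2 i j : (j <= i)%N ->
  grid D (L1 + L2) i - grid D L1 j = grid D L2 (i - j).
Proof. by move=> ji; rewrite /grid -mulrBl natrD natrB //; congr (_ / _); ring. Qed.
Lemma gridD D L1 L2 i j : grid D L1 i + grid D L2 j = grid D (L1 + L2) (i + j).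
Proof. by rewrite /grid -mulrDl !natrD; congr (_ / _); ring. Qed.

Lemma onGridW D L f E M : (0 < D)%N -> (0 < E)%N -> onGrid D L f -> onGrid (D * E) (L * E + M) f.
Proof.
move=> D0 E0 hf q /hf[i ->]; exists (i * E + M)%N.
have d0 : (D%:R : rat) != 0 by rewrite pnatr_eq0 -lt0n.
have e0 : (E%:R : rat) != 0 by rewrite pnatr_eq0 -lt0n.
by rewrite /grid !natrD !natrM; field; rewrite d0 e0.
Qed.

Lemma isPuisP f : isPuis f <-> exists D L, (0 < D)%N /\ onGrid D L f.
Proof.
split=> [[D [D0 [q0 hf]]]|[D [L [D0 hf]]]].
  exists D, (absz (Num.floor (q0 * D%:R))); split => // q /hf [h [m Em]].
  have d0 : (0 : rat) < D%:R by rewrite ltr0n.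
  have hm : Num.floor (q0 * D%:R) <= m.
    rewrite -(ler_int rat); apply: le_trans (floor_le _) _.
    by rewrite -ler_pdivlMr // -Em.
  exists (absz (m + absz (Num.floor (q0 * D%:R)))).
  rewrite Em /grid; congr (_ / _).
  have -> : forall a b : nat, (a%:R - b%:R : rat) = (a%:Z - b%:Z)%:~R.
    by move=> a b; rewrite rmorphB.
  by congr (_%:~R); lia.
exists D; split => //; exists (grid D L 0) => q /hf[i ->]; split.
  rewrite /grid ler_pM2r ?invr_gt0 ?ltr0n // lerD2r ler_nat //.
exists (i%:Z - L%:Z); rewrite /grid; congr (_ / _); by rewrite rmorphB.
Qed.

Lemma isPuis2 f g : isPuis f -> isPuis g ->
  exists D L, [/\ (0 < D)%N, onGrid D L f & onGrid D L g].
Proof.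
move=> /isPuisP[D [L [D0 hf]]] /isPuisP[E [M [E0 hg]]].
exists (D * E)%N, (L * E + M * D)%N; split; first by rewrite muln_gt0 D0.
  exact: onGridW.
by rewrite mulnC addnC; exact: onGridW.
Qed.
Lemma isPuis3 f g h : isPuis f -> isPuis g -> isPuis h ->
  exists D L, [/\ (0 < D)%N, onGrid D L f, onGrid D L g & onGrid D L h].
Proof.
move=> hf hg /isPuisP[E [M [E0 hh]]].
have [D [L [D0 hf' hg']]] := isPuis2 hf hg.
exists (D * E)%N, (L * E + M * D)%N; split; first by rewrite muln_gt0 D0.
- exact: onGridW.
- exact: onGridW.
- by rewrite mulnC addnC; exact: onGridW.
Qed.

Lemma pmul_grid D L1 L2 f g i : (0 < D)%N -> onGrid D L1 f -> onGrid D L2 g ->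
  pmul f g (grid D (L1 + L2) i) =
  \sum_(j < i.+1) f (grid D L1 j) * g (grid D L2 (i - j)).
Proof.
move=> D0 hf hg; rewrite /pmul (fsbigE [seq grid D L1 j | j <- index_iota 0 i.+1]).
- rewrite big_map big_mkcond /= big_mkord.
  apply: eq_bigr => j _; rewrite in_setT gridB //; by rewrite -ltnS.
- by rewrite map_inj_uniq; [exact: iota_uniq|exact: grid_inj].
- by [].
move=> q _ hq; have [->|/eqP fq] := eqVneq (f q) 0; first by rewrite mul0r.
have [j Eq] : exists j, q = grid D L1 j by apply: hf; apply/eqP.
have [->|gq] := eqVneq (g (grid D (L1 + L2) i - q)) 0; first by rewrite mulr0.
have [m Em] := hg _ gq; exfalso; move/negP: hq; apply.
have /grid_inj : grid D (L1 + L2) i = grid D (L1 + L2) (j + m).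
  by rewrite -gridD -Eq -Em addrC subrK.
by move=> /(_ D0) Ei; rewrite Eq; apply: map_f; rewrite mem_index_iota Ei; lia.
Qed.
Lemma pmul_onGrid D L1 L2 f g : onGrid D L1 f -> onGrid D L2 g ->
  onGrid D (L1 + L2) (pmul f g).
Proof.
move=> hf hg q hq; apply: contrapT => no; move/eqP: hq; apply.
rewrite /pmul fsbig1 // => r _.
have [->|/hf[i Ei]] := eqVneq (f r) 0; first by rewrite mul0r.
have [->|/hg[j Ej]] := eqVneq (g (q - r)) 0; first by rewrite mulr0.
by exfalso; apply: no; exists (i + j)%N; rewrite -gridD -Ei -Ej addrC subrK.
Qed.

(** Up to a given index the product of series is a product of polynomials, from which commutativity
    and associativity are inherited. *)
Definition trunc D L K f : {poly C} := \poly_(j < K) f (grid D L j).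
Lemma pmul_trunc D L1 L2 f g i K : (0 < D)%N -> onGrid D L1 f -> onGrid D L2 g ->
  (i < K)%N -> pmul f g (grid D (L1 + L2) i) = (trunc D L1 K f * trunc D L2 K g)`_i.
Proof.
move=> D0 hf hg iK; rewrite pmul_grid // coefM; apply: eq_bigr => j _.
by rewrite !coef_poly !(leq_ltn_trans _ iK) ?leq_subr // -ltnS.
Qed.

Lemma grid_ext D L f g : onGrid D L f -> onGrid D L g ->
  (forall i, f (grid D L i) = g (grid D L i)) -> f = g.
Proof.
move=> hf hg h; apply/funext => q.
have [[i ->]//|no] := pselect (exists i, q = grid D L i).
have -> : f q = 0 by apply/eqP/negPn/negP => /hf.
by apply/esym/eqP/negPn/negP => /hg.
Qed.

Lemma isPuis_mul f g : isPuis f -> isPuis g -> isPuis (pmul f g).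
Proof.
move=> hf hg; have [D [L [D0 hf' hg']]] := isPuis2 hf hg.
by apply/isPuisP; exists D, (L + L)%N; split => //; exact: pmul_onGrid.
Qed.
Lemma pmulC f g : isPuis f -> isPuis g -> pmul f g = pmul g f.
Proof.
move=> hf hg; have [D [L [D0 hf' hg']]] := isPuis2 hf hg.
apply: (@grid_ext D (L + L)) => [||i]; try exact: pmul_onGrid.
by rewrite !(pmul_trunc (K := i.+1)) // mulrC.
Qed.
Lemma pmulA f g h : isPuis f -> isPuis g -> isPuis h ->
  pmul f (pmul g h) = pmul (pmul f g) h.
Proof.
move=> hf hg hh; have [D [L [D0 hf' hg' hh']]] := isPuis3 hf hg hh.
have hgh := pmul_onGrid hg' hh'; have hfg := pmul_onGrid hf' hg'.
apply: (@grid_ext D (L + (L + L))); [exact: pmul_onGrid|rewrite addnA; exact: pmul_onGrid|].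
move=> i; rewrite (pmul_trunc (K := i.+1)) // addnA (pmul_trunc (K := i.+1)) //.
transitivity (trunc D L i.+1 f * (trunc D L i.+1 g * trunc D L i.+1 h))`_i.
  rewrite !coefM; apply: eq_bigr => j _; congr (_ * _).
  have ij : (i - j < i.+1)%N by rewrite ltnS leq_subr.
  by rewrite coef_poly ij (pmul_trunc D0 hg' hh' ij).
rewrite mulrA !coefM; apply: eq_bigr => j _; congr (_ * _).
by rewrite coef_poly ltn_ord (pmul_trunc D0 hf' hg' (ltn_ord j)).
Qed.
Definition padd f g : puis R := fun q => f q + g q.
Definition popp f : puis R := fun q => - f q.
Definition pzero : puis R := fun=> 0.
Lemma onGrid_add D L f g : onGrid D L f -> onGrid D L g -> onGrid D L (padd f g).
Proof.
move=> hf hg q; rewrite /padd.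
have [->|/hf//] := eqVneq (f q) 0.
by rewrite add0r => /hg.
Qed.
Lemma isPuis_add f g : isPuis f -> isPuis g -> isPuis (padd f g).
Proof.
move=> hf hg; have [D [L [D0 hf' hg']]] := isPuis2 hf hg.
by apply/isPuisP; exists D, L; split => //; exact: onGrid_add.
Qed.
Lemma isPuis_opp f : isPuis f -> isPuis (popp f).
Proof.
move=> /isPuisP[D [L [D0 hf]]]; apply/isPuisP; exists D, L; split => // q.
by rewrite /popp oppr_eq0; exact: hf.
Qed.
Lemma isPuis0 : isPuis pzero.
Proof. by exists 1%N; split => //; exists 0 => q; rewrite eqxx. Qed.
Lemma pmulDl f g h : isPuis f -> isPuis g -> isPuis h ->
  pmul (padd f g) h = padd (pmul f h) (pmul g h).
Proof.
move=> hf hg hh; have [D [L [D0 hf' hg' hh']]] := isPuis3 hf hg hh.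
have hfg := onGrid_add hf' hg'.
apply: (@grid_ext D (L + L)); first exact: pmul_onGrid.
  by apply: onGrid_add; exact: pmul_onGrid.
move=> i; rewrite /padd !pmul_grid // -big_split; apply: eq_bigr => j _.
by rewrite mulrDl.
Qed.

Definition pmono (c : C) q : puis R := fun r => if r == q then c else 0.
Lemma pone_mono : pone R = pmono 1 0.
Proof. by []. Qed.
Lemma isPuis_mono c q : isPuis (pmono c q).
Proof.
have [n [D [D0 Eq]]] : exists (n : int) (D : nat), (0 < D)%N /\ q = n%:~R / D%:R.
  exists (numq q), (absz (denq q)); split; first by rewrite absz_gt0 denq_neq0.
  by rewrite -[LHS]divq_num_den natr_absz ger0_norm // denq_ge0.
exists D; split => //; exists q => r; rewrite /pmono; have [->|_] := eqVneq r q; last by rewrite eqxx.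
by move=> _; split => //; exists n.
Qed.
Lemma pmul_mono c q f r : pmul (pmono c q) f r = c * f (r - q).
Proof.
rewrite /pmul (fsbigE [:: q]) //.
  by rewrite big_mkcond big_seq1 in_setT /pmono eqxx.
by move=> s _; rewrite inE /pmono => /negPf->; rewrite mul0r.
Qed.
Lemma pmul1l f : pmul (pone R) f = f.
Proof. by apply/funext => q; rewrite pone_mono pmul_mono mul1r subr0. Qed.
Lemma pmonoM c q c' q' : pmul (pmono c q) (pmono c' q') = pmono (c * c') (q + q').
Proof.
apply/funext => r; rewrite pmul_mono /pmono subr_eq [q' + q]addrC.
by case: eqP => // _; rewrite mulr0.
Qed.

(** Leading exponent and coefficient; the valuation is minus the exponent, as [val epsilon = -1]. *)
Definition lead f q c := [/\ f q = c, c != 0 & forall r, r < q -> f r = 0].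
Lemma lead_uniq f q c q' c' : lead f q c -> lead f q' c' -> q = q' /\ c = c'.
Proof.
move=> [E n h] [E' n' h']; case: (ltrgtP q q') => [/h'|/h|Eq].
- by rewrite E => /eqP; rewrite (negPf n).
- by rewrite E' => /eqP; rewrite (negPf n').
by rewrite -E -E' Eq.
Qed.
Lemma lead_mul f g q c q' c' : lead f q c -> lead g q' c' ->
  lead (pmul f g) (q + q') (c * c').
Proof.
move=> [E n h] [E' n' h']; split; last 1 first.
- move=> r rq; rewrite /pmul fsbig1 // => s _.
  have [sq|qs] := ltrP s q; first by rewrite h // mul0r.
  by rewrite h' ?mulr0 // ltrBlDl (lt_le_trans rq) // lerD2r.
- rewrite /pmul (fsbigE [:: q]) //.
    by rewrite big_mkcond big_seq1 in_setT addrAC subrr add0r E E'.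
  move=> s _; rewrite inE => nsq; have [sq|qs] := ltrP s q.
    by rewrite h // mul0r.
  rewrite h' ?mulr0 // ltrBlDl addrC [s + _]addrC ltrD2l lt_def qs andbT //.
- exact: mulf_neq0.
Qed.
Lemma lead_exists f : isPuis f -> f <> pzero -> exists q c, lead f q c.
Proof.
move=> /isPuisP[D [L [D0 hf]]] nf.
have ex : exists i, f (grid D L i) != 0.
  apply: contrapT => no; apply: nf; apply: (grid_ext hf) => [q|i]; first by rewrite eqxx.
  by apply/eqP/negPn/negP => h; apply: no; exists i.
exists (grid D L (ex_minn ex)), (f (grid D L (ex_minn ex))).
case: ex_minnP => m hm mmin; split => // r rm.
apply/eqP/negPn/negP => hr; have [i Ei] := hf _ hr; subst r.
have := mmin i hr; apply/negP; rewrite -ltnNge.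
by move: rm; rewrite /grid ltr_pM2r ?invr_gt0 ?ltr0n // ltrD2r ltr_nat.
Qed.
End PuiseuxArith.

(** * Puiseux series as an integral domain *)

Section PuiseuxRing.
Variable R : realType.
Record puiseux := Puiseux { pval :> puis R; pvalP : isPuis pval }.
Lemma pval_inj : injective pval.
Proof.
move=> [f hf] [g hg] /= E; subst g; congr Puiseux; exact: Prop_irrelevance.
Qed.
HB.instance Definition _ := gen_eqMixin puiseux.
HB.instance Definition _ := gen_choiceMixin puiseux.
Implicit Types f g h : puiseux.

Definition Padd f g := Puiseux (isPuis_add (pvalP f) (pvalP g)).
Definition Popp f := Puiseux (isPuis_opp (pvalP f)).
Definition Pzero := Puiseux (isPuis0 R).
Definition Pmul f g := Puiseux (isPuis_mul (pvalP f) (pvalP g)).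
Definition Pmono c q := Puiseux (isPuis_mono (R := R) c q).
Definition Pone := Pmono 1 0.

Lemma PaddA : associative Padd.
Proof. by move=> f g h; apply/pval_inj/funext => q; rewrite /= /padd addrA. Qed.
Lemma PaddC : commutative Padd.
Proof. by move=> f g; apply/pval_inj/funext => q; rewrite /= /padd addrC. Qed.
Lemma Padd0 : left_id Pzero Padd.
Proof. by move=> f; apply/pval_inj/funext => q; rewrite /= /padd add0r. Qed.
Lemma PaddN : left_inverse Pzero Popp Padd.
Proof. by move=> f; apply/pval_inj/funext => q; rewrite /= /padd addNr. Qed.
HB.instance Definition _ := GRing.isZmodule.Build puiseux PaddA PaddC Padd0 PaddN.

Lemma PmulA : associative Pmul.
Proof. by move=> f g h; apply: pval_inj; apply: pmulA; exact: pvalP. Qed.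
Lemma PmulC : commutative Pmul.
Proof. by move=> f g; apply: pval_inj; apply: pmulC; exact: pvalP. Qed.
Lemma Pmul1 : left_id Pone Pmul.
Proof. by move=> f; apply: pval_inj; exact: pmul1l. Qed.
Lemma PmulDl : left_distributive Pmul Padd.
Proof. by move=> f g h; apply: pval_inj; apply: pmulDl; exact: pvalP. Qed.
Lemma Pone_neq0 : Pone != 0.
Proof.
apply/eqP => /(congr1 pval)/(congr1 (fun f : puis R => f 0)); rewrite /= /pmono eqxx => /eqP.
by rewrite oner_eq0.
Qed.
HB.instance Definition _ :=
  GRing.Zmodule_isComNzRing.Build puiseux PmulA PmulC Pmul1 PmulDl Pone_neq0.

Definition Punit : pred puiseux := fun f => `[< exists g, g * f = 1 >].
Definition Pinv f := if `[< exists g, g * f = 1 >] then xget f [set g | g * f = 1] else f.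
Lemma PmulV : {in Punit, left_inverse 1 Pinv *%R}.
Proof.
move=> f hf; rewrite /Pinv; have -> : `[< exists g, g * f = 1 >] by exact: hf.
case: xgetP => [g _ //|no]; have /asboolP[g hg] : `[< exists g, g * f = 1 >] by exact: hf.
by case: (no g).
Qed.
Lemma Punit_ex f g : g * f = 1 -> Punit f.
Proof. by move=> h; apply/asboolP; exists g. Qed.
Lemma Pinv_out : {in [predC Punit], Pinv =1 id}.
Proof. by move=> f; rewrite inE /= unfold_in /Pinv /Punit => /negPf->. Qed.
HB.instance Definition _ :=
  GRing.ComNzRing_hasMulInverse.Build puiseux PmulV Punit_ex Pinv_out.

Lemma Plead f : f != 0 -> exists q c, lead f q c.
Proof.
move=> nf; apply: lead_exists (pvalP f) _ => E; move/eqP: nf; apply.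
exact: pval_inj.
Qed.
Lemma Pdomain f g : f * g = 0 -> (f == 0) || (g == 0).
Proof.
move=> E; apply/norP => -[/Plead[q [c hf]] /Plead[q' [c' hg]]].
have [+ + _] := lead_mul hf hg.
have -> : pmul f g = pval (f * g) by [].
by rewrite E /= /pzero => <-; rewrite eqxx.
Qed.
HB.instance Definition _ := GRing.ComUnitRing_isIntegral.Build puiseux Pdomain.

Lemma pval1 : pval 1 = pone R. Proof. by []. Qed.
Lemma pvalM f g : pval (f * g) = pmul f g. Proof. by []. Qed.
Lemma pvalB f g : pval (f - g) = psub f g. Proof. by []. Qed.
Lemma pvalD f g q : pval (f + g) q = pval f q + pval g q. Proof. by []. Qed.
Lemma puiseux_char0 (n : nat) : n.+1%:R != 0 :> puiseux.
Proof.
have E m : pval (m%:R : puiseux) 0 = m%:R.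
  by elim: m => [|m IH] //; rewrite -addn1 !natrD pvalD IH.
by apply/eqP => /(congr1 (fun f => pval f 0)); rewrite E => /eqP; rewrite pnatr_eq0.
Qed.
End PuiseuxRing.

(** * The complex exponential *)

Section ComplexExp.
Variable R : realType.
Local Notation C := R[i].
Local Notation tau := (pi *+ 2 : R).

(* [pexp r t = exp (r + 2 pi i t)]. *)
Definition pexp (r t : R) : C :=
  ((expR r * cos (t * tau)) +i* (expR r * sin (t * tau)))%C.

Lemma tau_gt0 : 0 < tau. Proof. by rewrite mulrn_wgt0 // pi_gt0. Qed.

Lemma pexpD r r' t t' : pexp (r + r') (t + t') = pexp r t * pexp r' t'.
Proof.
rewrite /pexp expRD mulrDl cosD sinD; apply/eqP; rewrite eq_complex /=.
by apply/andP; split; apply/eqP; ring.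
Qed.
Lemma pexp0 : pexp 0 0 = 1.
Proof.
by rewrite /pexp expR0 !mul0r cos0 sin0 mulr1 mulr0; apply/eqP; rewrite eq_complex /= !eqxx.
Qed.
Lemma pexp_int (m : int) : pexp 0 m%:~R = 1.
Proof.
have p1 : pexp 0 1 = 1.
  by rewrite /pexp expR0 !mul1r cos2pi sin2pi; apply/eqP; rewrite eq_complex /= !eqxx.
have pn (n : nat) : pexp 0 (n%:Z)%:~R = 1.
  elim: n => [|n IH]; first exact: pexp0.
  by rewrite intS rmorphD /= -{1}(addr0 0) pexpD IH p1 mulr1.
case: m => n; first exact: pn.
have := pexpD 0 0 (Negz n)%:~R (n.+1%:Z)%:~R.
by rewrite addr0 -rmorphD NegzE /= addNr pexp0 pn mulr1.
Qed.
Lemma pexpN r t : pexp (- r) (- t) = (pexp r t)^-1.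
Proof.
have h : pexp (- r) (- t) * pexp r t = 1 by rewrite -pexpD !addNr pexp0.
have nz : pexp r t != 0.
  by apply/eqP => E; move/eqP: h; rewrite E mulr0 eq_sym oner_eq0.
by rewrite -[LHS](mulfK nz) h mul1r.
Qed.
Lemma pexp_neq0 r t : pexp r t != 0.
Proof.
have h : pexp (- r) (- t) * pexp r t = 1 by rewrite -pexpD !addNr pexp0.
by apply/eqP => E; move/eqP: h; rewrite E mulr0 eq_sym oner_eq0.
Qed.
Lemma pexpXn r t n : pexp r t ^+ n = pexp (n%:R * r) (n%:R * t).
Proof.
elim: n => [|n IH]; first by rewrite !mul0r pexp0.
by rewrite exprS IH -pexpD -natr1 !mulrDl !mul1r [r + _]addrC [t + _]addrC.
Qed.
Lemma pexpXz r t (m : int) : pexp r t ^ m = pexp (m%:~R * r) (m%:~R * t).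
Proof.
case: m => n; first by rewrite -exprnP pexpXn.
by rewrite NegzE -exprnN pexpXn rmorphN /= !mulNr pexpN.
Qed.

Lemma cos_eq1 (u : R) : cos (u * tau) = 1 -> exists m : int, u = m%:~R.
Proof.
move=> h; have /andP[f1 f2] := floor_itv u; exists (Num.floor u).
set m := Num.floor u in f1 f2 *.
have E : pexp 0 (u - m%:~R) = pexp 0 u.
  by rewrite -[0 in LHS]addr0 pexpD -rmorphN pexp_int mulr1.
have {}h : cos ((u - m%:~R) * tau) = 1.
  have : complex.Re (pexp 0 (u - m%:~R)) = complex.Re (pexp 0 u) by rewrite E.
  by rewrite /= expR0 !mul1r h.
move: f2; rewrite rmorphD /= => f2.
have t0 := tau_gt0; have p0 := pi_gt0 R.
have et : tau = pi + pi by rewrite mulr2n.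
(* Cosine is injective on [[0, pi]] only; an angle in the second half of the period is replaced by
   [tau] minus it. *)
have [le|gt] := lerP ((u - m%:~R) * tau) pi.
  have i1 : (u - m%:~R) * tau \in `[0, pi] by rewrite in_itv /= le mulr_ge0 ?subr_ge0 // ltW.
  have i2 : (0 : R) \in `[0, pi] by rewrite in_itv /= lexx ltW.
  have /eqP : (u - m%:~R) * tau = 0 by apply: cos_inj => //; rewrite h cos0.
  by rewrite mulf_eq0 (gt_eqF t0) orbF subr_eq0 => /eqP.
have /cos_inj : cos (tau - (u - m%:~R) * tau) = cos 0.
  by rewrite cosB cos2pi sin2pi h mul0r addr0 mul1r cos0.
have hh : 0 < tau - (u - m%:~R) * tau.
  rewrite subr_gt0 -[ltRHS]mul1r ltr_pM2r //; move: f2; rewrite (_ : 1%:~R = 1 :> R) //; lra.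
rewrite !in_itv /= lexx (ltW hh) (ltW p0) /= => /(_ _ isT).
have -> : tau - (u - m%:~R) * tau <= pi by rewrite et in gt *; lra.
by move=> /(_ isT) E0; move: hh; rewrite E0 ltxx.
Qed.

Lemma pexp_inj r r' t t' : pexp r t = pexp r' t' ->
  r = r' /\ exists m : int, t - t' = m%:~R.
Proof.
move/eqP; rewrite eq_complex /= => /andP[/eqP h1 /eqP h2].
have c1 := cos2Dsin2 (t * tau); have c2 := cos2Dsin2 (t' * tau).
have e1 := expR_gt0 r; have e2 := expR_gt0 r'.
have : expR r ^+ 2 = expR r' ^+ 2.
  transitivity ((expR r * cos (t * tau)) ^+ 2 + (expR r * sin (t * tau)) ^+ 2).
    by rewrite !exprMn -mulrDr c1 mulr1.
  by rewrite h1 h2 !exprMn -mulrDr c2 mulr1.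
move/eqP; rewrite eqf_sqr => /orP[/eqP/expR_inj E|/eqP E]; last by exfalso; lra.
split => //.
subst r'; have ne : expR r != 0 by rewrite gt_eqF.
move/(mulfI ne): h1 => h1; move/(mulfI ne): h2 => h2.
by apply: cos_eq1; rewrite mulrBl cosB h1 h2 -!expr2.
Qed.

Lemma pexp_surj (z : C) : z != 0 -> exists r t, z = pexp r t.
Proof.
case: z => a b; rewrite eq_complex /= negb_and => nz.
have n2 : 0 < a ^+ 2 + b ^+ 2.
  rewrite lt_def addr_ge0 ?sqr_ge0 // andbT paddr_eq0 ?sqr_ge0 // !sqrf_eq0.
  by rewrite negb_and.
set n := Num.sqrt (a ^+ 2 + b ^+ 2).
have n0 : 0 < n by rewrite sqrtr_gt0.
have nn : n ^+ 2 = a ^+ 2 + b ^+ 2 by rewrite sqr_sqrtr // ltW.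
have nz' : n != 0 by rewrite gt_eqF.
have c1 : (a / n) ^+ 2 = 1 - (b / n) ^+ 2.
  by rewrite !exprMn exprVn nn; field; rewrite gt_eqF.
have itv : -1 <= a / n <= 1.
  rewrite -ler_norml -(@expr_le1 _ 2) // real_normK ?num_real // c1 gerBl sqr_ge0 //.
have sa : sin (acos (a / n)) = `|b / n|.
  by rewrite sin_acos // c1 opprB addrC subrK sqrtr_sqr.
have ca : cos (acos (a / n)) = a / n by apply: acosK; rewrite in_itv.
have t0 : tau != 0 by rewrite gt_eqF // tau_gt0.
have en : expR (ln n) = n by apply: lnK; rewrite posrE.
have [b0|b0] := lerP 0 (b / n).
  exists (ln n), (acos (a / n) / tau); rewrite /pexp mulfVK // en ca sa ger0_norm //.
  by congr (_ +i* _)%C; rewrite mulrC divfK.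
exists (ln n), (- acos (a / n) / tau); rewrite /pexp mulfVK // en cosN sinN ca sa.
by rewrite ltr0_norm // opprK; congr (_ +i* _)%C; rewrite mulrC divfK.
Qed.

(** [zeta] is built on [n.-root], which is accessible through an extremal property: nonnegative
    imaginary part and, among such roots, largest real part. This pins it down as
    [exp (pi i / n)]. *)
Lemma rootN1 n : (0 < n)%N -> n.-root (-1 : C) = pexp 0 (n.*2%:R)^-1.
Proof.
have pm1 : (-1 : C) = pexp 0 (2^-1).
  have -> : pexp 0 2^-1 = ((-1) +i* 0)%C.
    rewrite /pexp expR0 !mul1r (_ : 2^-1 * tau = pi) ?cospi ?sinpi //.
    by field.
  by apply/eqP; rewrite eq_complex /= oppr0 !eqxx.
move=> n0; have [n1|n1] := leqP n 1.
  by have -> : n = 1%N by [lia]; rewrite root1C pm1.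
have nz : (n%:R : R) != 0 by rewrite pnatr_eq0 -lt0n.
have n0R : (0 : R) < n%:R by rewrite ltr0n.
set y := n.-root _; set c := pexp 0 _.
have yn : y ^+ n = -1 by rewrite rootCK.
have E2 : (n.*2%:R : R) = n%:R * 2 by rewrite -muln2 natrM.
have cn : c ^+ n = -1.
  rewrite /c pexpXn mulr0 pm1; congr pexp; rewrite E2; field; exact: nz.
have y0 : y != 0.
  apply/eqP => E; move/eqP: yn; rewrite E expr0n eqn0Ngt n0 /= eq_sym oppr_eq0.
  by rewrite oner_eq0.
have [r [t Ey]] := pexp_surj y0.
have [r0 [m Em]] : n%:R * r = 0 /\ exists m : int, n%:R * t - 2^-1 = m%:~R.
  by apply: pexp_inj; rewrite -pexpXn -Ey yn.
have {}r0 : r = 0 by move/eqP: r0; rewrite mulf_eq0 (negPf nz) => /eqP.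
subst r; pose p := Num.floor (t + 2^-1); pose t' := t - p%:~R.
have Ey' : y = pexp 0 t'.
  by rewrite Ey /t' -[0 in RHS]addr0 pexpD -rmorphN pexp_int mulr1.
have [t1 t2] : - 2^-1 <= t' /\ t' <= 2^-1.
  have /andP[] := floor_itv (t + 2^-1); rewrite -/p rmorphD /t' /= => h1 h2.
  by move: h2; rewrite (_ : 1%:~R = 1 :> R) // => h2; split; lra.
have Em' : n%:R * t' = 2^-1 + (m - n%:Z * p)%:~R.
  by rewrite rmorphB rmorphM /= -Em /t'; ring.
(* For any root, [n t'] is congruent to [1/2] modulo 1, so [|t'|] is at least [1 / (2 n)].
   Maximality of the real part gives the reverse bound, and the imaginary part the sign of [t']. *)
have nt : 2^-1 <= n%:R * `|t'|.
  have -> : n%:R * `|t'| = `|n%:R * t'| by rewrite normrM ger0_norm // ltW.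
  rewrite Em'; set q := m - _; have [q0|q0] := lerP 0 q.
    have : (0 : R) <= q%:~R by rewrite ler0z.
    by move=> h; rewrite ger0_norm; lra.
  have : (q%:~R : R) <= (-1)%:~R by rewrite ler_int; lia.
  by rewrite rmorphN1 => h; rewrite ler0_norm; lra.
have p0 := pi_gt0 R; have t0 := tau_gt0.
have et : tau = pi + pi by rewrite mulr2n.
have ia : 0 <= `|t'| * tau <= pi.
  rewrite mulr_ge0 ?(ltW t0) //=.
  have : `|t'| * tau <= 2^-1 * tau by rewrite ler_pM2r // ler_norml t1.
  by rewrite et; lra.
have En : (n.*2%:R)^-1 * tau = pi / n%:R by rewrite E2 -mulr_natl; field; exact: nz.
have pn : 0 < (pi / n%:R : R) < pi.
  apply/andP; split; first exact: divr_gt0.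
  rewrite ltr_pdivrMr // -[ltLHS]mulr1 ltr_pM2l //.
  by rewrite (_ : 1 = 1%:R) // ltr_nat.
have ic : 0 <= (n.*2%:R)^-1 * tau <= pi by rewrite En; case/andP: pn => h1 h2; rewrite !ltW.
have ReE (z : C) : 'Re z = (complex.Re z)%:C%C by rewrite complexRe.
have ImE (z : C) : 'Im z = (complex.Im z)%:C%C by rewrite complexIm.
have cosabs : cos (t' * tau) = cos (`|t'| * tau).
  by case: (ger0P t') => _ //; rewrite mulNr cosN.
have le_a : `|t'| <= (n.*2%:R)^-1.
  have : 'Re c <= 'Re y.
    apply: rootC_Re_max => //; rewrite ImE lecR /= expR0 mul1r.
    by apply: sin_ge0_pi.
  rewrite !ReE lecR Ey' /= expR0 !mul1r cosabs.
  rewrite (leNgt _ (cos (`|t'| * tau))) => h; rewrite leNgt; apply: contra h => h.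
  by rewrite ltr_cos ?in_itv //= ltr_pM2r.
have ea : `|t'| = (n.*2%:R)^-1.
  apply: le_anti; rewrite le_a /= E2 invfM -(ler_pM2l n0R) mulrA divff // mul1r.
  exact: nt.
rewrite Ey' /c -ea; congr pexp; case: (ger0P t') => // neg; exfalso.
have := @Im_rootC_ge0 C n (-1) n1; rewrite -/y ImE lecR Ey' /= expR0 mul1r.
have -> : t' = - (n.*2%:R)^-1 by rewrite -ea ltr0_norm // opprK.
by rewrite mulNr sinN En oppr_ge0 leNgt sin_gt0_pi.
Qed.

Lemma zetaE q : zeta R q = pexp 0 (ratr q).
Proof.
have d0 : (0 < absz (denq q))%N by rewrite absz_gt0 denq_neq0.
rewrite /zeta rootN1 // pexpXz mulr0; congr pexp.
have dz : ((absz (denq q))%:R : R) = (denq q)%:~R.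
  by rewrite natr_absz ger0_norm // denq_ge0.
rewrite -muln2 natrM dz rmorphM /= /ratr.
have : (denq q)%:~R != 0 :> R by rewrite intr_eq0 denq_neq0.
by move=> h; field.
Qed.
End ComplexExp.

(** * Points of the torus *)

(** Every small positive [t] works: a non-integral [f i] keeps away from the integers, and an
    integral one is moved by less than 1 but not by 0. *)
Lemma avoid_int (R : realType) (I : eqType) (s : seq I) (f g : I -> R) :
  (forall i, i \in s -> g i = 0 -> forall m : int, f i != m%:~R) ->
  exists t, forall i, i \in s -> forall m : int, f i + t * g i != m%:~R.
Proof.
move=> H; suff [d d0 hd] : exists2 d, 0 < d & forall t, 0 < t -> t < d ->
    forall i, i \in s -> forall m : int, f i + t * g i != m%:~R.
  by exists (d / 2); apply: hd; lra.
elim: s H => [|i0 s IH] H; first by exists 1.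
have [|d1 d10 h1] := IH; first by move=> i hi; apply: H; rewrite inE hi orbT.
have hab := H i0 (mem_head _ _); set a := f i0 in hab; set b := g i0 in hab.
suff [d2 d20 h2] : exists2 d, 0 < d & forall t, 0 < t -> t < d ->
    forall m : int, a + t * b != m%:~R.
  exists (Num.min d1 d2); first by rewrite lt_min d10.
  move=> t t0; rewrite lt_min => /andP[t1 t2] i; rewrite inE => /orP[/eqP->|hi] m.
    exact: h2.
  exact: h1.
have /andP[f1 f2] := floor_itv a; move: f2; rewrite rmorphD /= => f2.
have [ai|ani] := eqVneq a (Num.floor a)%:~R.
  have b0 : b != 0.
    apply/eqP => b0; have := hab b0 (Num.floor a).
    by rewrite -ai eqxx.
  have nb : 0 < `|b| by rewrite normr_gt0.
  exists (`|b|^-1); first by rewrite invr_gt0.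
  move=> t t0 tb m; apply/eqP => E.
  have E1 : t * b = (m - Num.floor a)%:~R by rewrite rmorphB /= -E -ai; ring.
  have : `|t * b| < 1 by rewrite normrM (gtr0_norm t0) -ltr_pdivlMr // div1r.
  rewrite E1 -intr_norm -[1]/(1%:~R) ltr_int => h.
  have h0 : m - Num.floor a = 0 by lia.
  by move/eqP: E1; rewrite h0 mulf_eq0 (gt_eqF t0) (negPf b0).
have f3 : (Num.floor a)%:~R < a by rewrite lt_def ani.
(* [e] is the distance from [a] to the nearest integer; dividing by [|b| + 1] rather than [|b|]
   allows [b = 0]. *)
pose e := Num.min (a - (Num.floor a)%:~R) ((Num.floor a)%:~R + 1 - a).
have e0 : 0 < e by rewrite lt_min !subr_gt0 f3.
have nb : 0 < `|b| + 1 by rewrite ltr_wpDl.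
exists (e / (`|b| + 1)); first by rewrite divr_gt0.
move=> t t0 tb m; apply/eqP => E.
have : `|t * b| < e.
  rewrite normrM (gtr0_norm t0); move: tb; rewrite ltr_pdivlMr //; apply: le_lt_trans.
  by rewrite ler_pM2l // lerDl.
rewrite lt_min !ltr_norml => /andP[/andP[g1 g2] /andP[g3 g4]].
have : (Num.floor a)%:~R < m%:~R :> R by rewrite -E; lra.
have : m%:~R < (Num.floor a + 1)%:~R :> R by rewrite -E rmorphD /=; lra.
by rewrite !ltr_int ltzD1 => h5 h6; have := le_lt_trans h5 h6; rewrite ltxx.
Qed.

Lemma morph_ext l k (F : idomainType) (chi chi' : 'rV[int]_(l + k) -> F) :
  ismorph chi -> ismorph chi' ->
  (forall i, chi (delta_mx 0 i) = chi' (delta_mx 0 i)) -> chi =1 chi'.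
Proof.
move=> h h' E x; rewrite (row_sum_delta x).
have sm c : ismorph c -> c (\sum_i x 0 i *: delta_mx 0 i) =
    \prod_i c (x 0 i *: delta_mx 0 i).
  by move=> [cD c0]; apply: (big_morph c cD c0).
by rewrite !sm //; apply: eq_bigr => i _; apply: morph_eqZ.
Qed.

Section Characters.
Variables (R : realType) (l k N : nat) (rt crt : 'I_N -> 'rV[int]_(l + k)) (sr : 'I_l -> 'I_N).
Hypothesis HRD : based_root_datum rt crt sr.
Local Notation inW := (inW rt crt).
Local Notation P := (puiseux R).
Local Notation X := 'rV[int]_(l + k).
Implicit Types (x y : X) (w : 'M[int]_(l + k)) (a : 'I_(l + k) -> puis R) (chi : X -> P).

Lemma pval_prod (I : finType) (F : I -> P) :
  pval (\prod_i F i) = \big[@pmul R/pone R]_i pval (F i).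
Proof. exact: (big_morph (@pval R) (@pvalM R) (pval1 R)). Qed.
Lemma pval_sum (I : Type) (s : seq I) (F : I -> P) q :
  pval (\sum_(i <- s) F i) q = \sum_(i <- s) pval (F i) q.
Proof. exact: (big_morph (fun f : P => pval f q) (fun f g => @pvalD R f g q) erefl). Qed.

Lemma pinvE (A : P) : A \is a GRing.unit -> pinv (pval A) = pval A^-1.
Proof.
move=> UA; have : exists g, isPuis g /\ pmul (pval A) g = pone R.
  by exists (pval A^-1); split; [exact: pvalP|rewrite -pvalM mulrV].
rewrite /pinv => ex.
have [hg Eg] := @ClassicalEpsilon.epsilon_spec _ (inhabits (pone R)) _ ex.
move: (ClassicalEpsilon.epsilon _ _) hg Eg => g hg Eg.
have : A * Puiseux hg = 1 by apply: pval_inj; rewrite pvalM Eg.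
by move/(congr1 (fun B => pval (A^-1 * B))); rewrite mulKr // mulr1.
Qed.
Lemma ppowzE (A : P) (z : int) : A \is a GRing.unit -> ppowz (pval A) z = pval (A ^ z).
Proof.
move=> UA; have it (B : P) m : iter m (pmul (pval B)) (pone R) = pval (B ^+ m).
  by elim: m => [|m IH] //=; rewrite exprS pvalM IH.
case: z => m; first by rewrite /ppowz it -exprnP.
by rewrite /ppowz pinvE // it NegzE -exprnN exprVn.
Qed.

(** Evaluation is defined on bare functions; lifting the coordinates to units of the ring makes it a
    character to which ring lemmas apply. *)
Lemma torus_chi a : torus a -> exists chi, ismorph chi /\ forall x, ev a x = pval (chi x).
Proof.
move=> ta; have : forall i, exists A : P, A \is a GRing.unit /\ pval A = a i.
  move=> i; have [ha [g [hg Eg]]] := ta i; exists (Puiseux ha); split => //.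
  by apply/unitrPr; exists (Puiseux hg); apply: pval_inj; rewrite pvalM Eg.
move/fin_all_exists => [A hA]; exists (fun x => \prod_i A i ^ x 0 i); split.
  split=> [x y|]; last by rewrite big1 // => i _; rewrite mxE expr0z.
  by rewrite -big_split; apply: eq_bigr => i _; rewrite mxE exprzDr //; case: (hA i).
move=> x; rewrite pval_prod; apply: eq_bigr => i _.
by have [UA <-] := hA i; rewrite ppowzE.
Qed.

Lemma OmegaE a chi : (forall x, ev a x = pval (chi x)) ->
  Omega rt a = pval (\prod_i (1 - chi (rt i))).
Proof. by move=> h; rewrite pval_prod; apply: eq_bigr => i _; rewrite h pvalB. Qed.

Lemma orbitW_seq i : exists s, uniq s /\ forall x, x \in s <-> orbitW rt crt i x.
Proof.
have [s [us hs]] := finite_W HRD.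
exists (undup [seq actX w (delta_mx 0 i) | w <- s]); split; first exact: undup_uniq.
move=> x; rewrite mem_undup; split=> [/mapP[w /hs hw ->]|[w [hw ->]]].
  by exists w.
by apply/mapP; exists w => //; apply/hs.
Qed.
Lemma cmapE a chi i s : (forall x, ev a x = pval (chi x)) -> uniq s ->
  (forall x, x \in s <-> orbitW rt crt i x) ->
  cmap rt crt a i = pval (\sum_(x <- s) chi x).
Proof.
move=> h us hs; apply/funext => q; rewrite pval_sum /cmap.
have -> : orbitW rt crt i = [set` s]%classic by apply/seteqP; split => x /= /hs.
by rewrite -fsbig_seq //; apply: eq_bigr => x _; rewrite h.
Qed.

Lemma orbitW_rshift i x : orbitW rt crt (rshift l i) x -> x = delta_mx 0 (rshift l i).
Proof.
move=> [w [hw ->]]; elim: hw => [|j u hu IH]; first by rewrite actX1.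
by rewrite actXM IH actX_sref pair_deltal (crt_rshift HRD) scale0r subr0.
Qed.

Lemma cmap_separation a a' chi chi' :
  ismorph chi -> ismorph chi' ->
  (forall x, ev a x = pval (chi x)) -> (forall x, ev a' x = pval (chi' x)) ->
  (forall i, cmap rt crt a i = cmap rt crt a' i) ->
  exists2 w, inW w & forall x, chi' x = chi (actX w x).
Proof.
move=> hc hc' E E' Ec; have [sW [usW hsW]] := finite_W HRD.
have [orb Horb] := fin_all_exists (fun j => orbitW_seq (lshift k j)).
have Es i s : uniq s -> (forall x, x \in s <-> orbitW rt crt i x) ->
    \sum_(x <- s) chi x = \sum_(x <- s) chi' x.
  move=> us hs; apply: pval_inj.
  by rewrite -(cmapE E us hs) -(cmapE E' us hs) Ec.
apply: (@orbit_separation _ _ _ _ _ _ HRD _ (@puiseux_char0 R) orb sW) => //.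
- by move=> j; case: (Horb j).
- by move=> j x; case: (Horb j).
- by move=> j; have [h1 h2] := Horb j; apply: Es h1 h2.
move=> i; have := Es (rshift l i) [:: delta_mx 0 (rshift l i)] isT.
rewrite !big_seq1; apply => x; rewrite inE; split=> [/eqP->|/orbitW_rshift->//].
by exists 1%:M; rewrite actX1; split => //; constructor.
Qed.

Lemma HasValP (f : puis R) (v : R) :
  HasVal f v <-> exists q c, ratr q = v /\ lead f (- q) c.
Proof.
split=> [[q [Eq [nz h]]]|[q [c [Eq [E nz h]]]]]; first by exists q, (f (- q)).
by exists q; split=> //; rewrite E.
Qed.
Lemma lead1 : lead (pval (1 : P)) 0 1.
Proof.
split; rewrite ?oner_eq0 //= /pmono ?eqxx // => r r0.
by rewrite lt_eqF.
Qed.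
Lemma lead_mono (c : R[i]) q : c != 0 -> lead (pmono c q) q c.
Proof. by move=> c0; split; rewrite /pmono ?eqxx // => r r0; rewrite lt_eqF. Qed.
Lemma lead_prod (f : 'I_N -> P) p d : (forall i, lead (pval (f i)) (p i) (d i)) ->
  lead (pval (\prod_i f i)) (\sum_i p i) (\prod_i d i).
Proof.
move=> h; elim/big_rec3: _ => [|i q c g _ IH]; first exact: lead1.
exact: lead_mul.
Qed.

(** [W] permutes the roots, so [Omega] agrees at conjugate points. *)
Lemma chi_root_act chi w : inW w ->
  \prod_i (1 - chi (actX w (rt i))) = \prod_i (1 - chi (rt i)).
Proof.
move=> hw; have [f Hf] := fin_all_exists (fun i => inW_root HRD i hw).
have finj : injective f.
  move=> i j E; apply: (rt_inj HRD); rewrite -[LHS](actXK _ (inW_unit HRD hw)).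
  by rewrite -Hf E Hf (actXK _ (inW_unit HRD hw)).
by rewrite [RHS](reindex_inj finj); apply: eq_bigr => i _; rewrite Hf.
Qed.

(** The coefficients of a root share one sign, so no cancellation can hide a simple root on which
    [nu] is positive. *)
Lemma root_max0 (J : {set 'I_l}) (nu : 'rV[R]_(l + k)) i :
  (forall j, j \in J -> pairXA (rt (sr j)) nu = 0) ->
  (forall j, j \notin J -> 0 < pairXA (rt (sr j)) nu) ->
  (inRM rt sr J (rt i) <-> pairXA (rt i) nu = 0).
Proof.
move=> h0 h1; split; first exact: pA_inRM_eq0.
have nu0 j : 0 <= pairXA (rt (sr j)) nu.
  by have [/h0->|/h1/ltW] := boolP (j \in J).
have [c [sgn Ei]] := rt_decomp HRD i; rewrite {1}Ei pA_suml => E.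
exists c; split => // j /h1 pj.
have : (c j)%:~R * pairXA (rt (sr j)) nu = 0.
  case: sgn => sgn.
    by move/psumr_eq0P: E; apply => // i' _; rewrite mulr_ge0 // ler0z.
  have /psumr_eq0P E' : \sum_i - ((c i)%:~R * pairXA (rt (sr i)) nu) = 0.
    by rewrite sumrN E oppr0.
  apply/eqP; rewrite -oppr_eq0; apply/eqP; apply: E' => // i' _.
  by rewrite oppr_ge0 mulr_le0_ge0 // lerz0.
by move/eqP; rewrite mulf_eq0 (gt_eqF pj) orbF intr_eq0 => /eqP.
Qed.
End Characters.

(** * Monodromy of a point with given slope, and non-emptiness *)

Section Main.
Variables (R : realType) (l k N : nat) (rt crt : 'I_N -> 'rV[int]_(l + k)) (sr : 'I_l -> 'I_N).
Hypothesis HRD : based_root_datum rt crt sr.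
Variables (J : {set 'I_l}) (nu : 'rV[R]_(l + k)).
Hypothesis Hnu : inNG rt crt sr J nu.
Local Notation inW := (inW rt crt).
Local Notation inRJ := (inRM rt sr J).
Local Notation P := (puiseux R).
Local Notation X := 'rV[int]_(l + k).
Implicit Types (x y : X) (w : 'M[int]_(l + k)) (a : 'I_(l + k) -> puis R) (chi : X -> P).

Lemma nu_J0 j : j \in J -> pairXA (rt (sr j)) nu = 0.
Proof. by case: Hnu => [[y ->] _]; exact: avg_simple0. Qed.
Lemma nu_dom j : 0 <= pairXA (rt (sr j)) nu.
Proof. by have [/nu_J0->|/(Hnu.2)/ltW] := boolP (j \in J). Qed.
Lemma nu_avg : nu = avg rt crt sr J nu.
Proof. by rewrite (avg_fixed HRD) // => w hw; exact: (actA_fixed HRD nu_J0 hw). Qed.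

Lemma nu_rational : exists q : 'I_(l + k) -> rat, forall i, ratr (q i) = nu 0 i.
Proof.
have [[y ->] _] := Hnu; have [s [us hs]] := finite_WM HRD J.
exists (fun i => ((size s)%:R)^-1 * (\sum_(w <- s) actY w y 0 i)%:~R) => i.
rewrite rmorphM fmorphV /= ratr_nat ratr_int (avgE _ us hs) mxE; congr (_ * _).
rewrite summxE rmorph_sum; apply: eq_bigr => w _.
by rewrite actA_intv [RHS]mxE.
Qed.

Lemma chi_leads chi : ismorph chi ->
  (forall x, HasVal (pval (chi x)) (pairXA x nu)) ->
  exists (q : X -> rat) (xi : X -> R[i]),
    [/\ forall x, ratr (q x) = pairXA x nu, forall x, lead (pval (chi x)) (- q x) (xi x)
      & ismorph xi].
Proof.
move=> hc hv; have H x : exists qc : rat * R[i],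
    ratr qc.1 = pairXA x nu /\ lead (pval (chi x)) (- qc.1) qc.2.
  by have /HasValP[q [c [h1 h2]]] := hv x; exists (q, c).
have [f hf] := choice H; exists (fun x => (f x).1), (fun x => (f x).2).
split=> [x|x|]; [by case: (hf x)|by case: (hf x)|].
split=> [x y|].
  have := lead_mul (hf x).2 (hf y).2; rewrite -pvalM -hc.1 => h.
  by case: (lead_uniq (hf (x + y)).2 h).
by have := (hf 0).2; rewrite hc.2 => h; case: (lead_uniq h (lead1 R)).
Qed.

(** Each factor [1 - chi alpha] has valuation at most [max 0 <alpha, nu>], and these bounds sum to
    [mnu]; attaining the sum forces equality everywhere. For a root of [M] the bound is 0, so the
    constant term [1 - xi alpha] survives. *)
Lemma regular_lead chi (q : X -> rat) (xi : X -> R[i]) :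
  (forall x, ratr (q x) = pairXA x nu) -> (forall x, lead (pval (chi x)) (- q x) (xi x)) ->
  HasVal (pval (\prod_i (1 - chi (rt i)))) (mnu rt nu) ->
  forall i, inRJ (rt i) -> xi (rt i) != 1.
Proof.
move=> hq hl /HasValP[p [c [Ep lp]]].
have nz i : 1 - chi (rt i) != 0.
  have : \prod_i (1 - chi (rt i)) != 0.
    apply/eqP => E; case: lp; rewrite E /= /pzero => <-.
    by rewrite eqxx.
  by move/prodf_neq0/(_ i isT).
have H i : exists qd : rat * R[i], lead (pval (1 - chi (rt i))) qd.1 qd.2.
  by have [q' [d h]] := Plead (nz i); exists (q', d).
have [f hf] := choice H.
have [Es _] := lead_uniq lp (lead_prod hf).
have le i : - ratr (f i).1 <= Num.max 0 (pairXA (rt i) nu).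
  rewrite leNgt; apply/negP; rewrite gt_max => /andP[h1 h2].
  have [E n _] := hf i; move/eqP: n; apply; rewrite -E pvalB /psub pval1.
  have -> : pone R (f i).1 = 0.
    by rewrite /pone lt_eqF // -(ltrq0 R) -oppr_gt0.
  have [_ _ h] := hl (rt i); rewrite h ?subrr //.
  by rewrite -(ltr_rat R) rmorphN /= hq; lra.
have Esum : \sum_i (Num.max 0 (pairXA (rt i) nu) - - ratr (f i).1) = 0.
  rewrite sumrB -/(mnu rt nu) -Ep sumrN -rmorph_sum -Es rmorphN /=; ring.
have E0 i : Num.max 0 (pairXA (rt i) nu) = - ratr (f i).1.
  apply/eqP; rewrite -subr_eq0; apply/eqP.
  by move/psumr_eq0P: Esum; apply => // j _; rewrite subr_ge0.
move=> i hi; have n0 := pA_inRM_eq0 nu_J0 hi.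
have q0 : q (rt i) = 0.
  have : ratr (q (rt i)) = 0 :> R by rewrite hq n0.
  by move/eqP; rewrite fmorph_eq0 => /eqP.
have f0 : (f i).1 = 0.
  have : ratr (f i).1 = 0 :> R by have := E0 i; rewrite n0 maxxx; lra.
  by move/eqP; rewrite fmorph_eq0 => /eqP.
have [E n _] := hf i; have [E' _ _] := hl (rt i).
move: E E'; rewrite f0 q0 oppr0 pvalB /psub pval1 => E E'; move: n; rewrite -E E'.
by rewrite /pone eqxx subr_eq0 eq_sym.
Qed.

Lemma pexp_morph (u v : 'rV[R]_(l + k)) :
  ismorph (fun x : X => pexp (pairXA x u) (pairXA x v)).
Proof. by split=> [x y|]; rewrite ?pADl ?pexpD // !pA0l pexp0. Qed.

Lemma xi_log (xi : X -> R[i]) : ismorph xi ->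
  exists u1 u2 : 'rV[R]_(l + k), forall x, xi x = pexp (pairXA x u2) (pairXA x u1).
Proof.
move=> hxi; have H (i : 'I_(l + k)) : exists rt' : R * R, xi (delta_mx 0 i) = pexp rt'.1 rt'.2.
  have [r [t E]] := pexp_surj (morph_neq0 (delta_mx 0 i) hxi); by exists (r, t).
have [f hf] := fin_all_exists H.
exists (\row_i (f i).2), (\row_i (f i).1).
apply: (morph_ext hxi (pexp_morph _ _)) => i.
by rewrite !pA_delta !mxE.
Qed.

Lemma monodromy_conj chi g : ismorph chi -> inW g ->
  (forall x, HasVal (pval (chi x)) (pairXA x nu)) ->
  (forall x, psigma (pval (chi x)) = pval (chi (actX (invmx g) x))) ->
  HasVal (pval (\prod_i (1 - chi (rt i)))) (mnu rt nu) ->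
  exists2 u, inW u & wnu rt crt sr J nu = u *m g *m invmx u.
Proof.
move=> hc hg hv hs hO.
have [q [xi [hq hl hxi]]] := chi_leads hc hv.
have hreg := regular_lead hq hl hO.
(* Compare leading terms in [sigma (chi x) = chi (g^-1 x)]: the exponents show that [g] fixes [nu],
   the coefficients that it twists [xi] by [exp (-2 pi i <x, nu>)]. *)
have Hg x : q (actX (invmx g) x) = q x /\
    xi (actX (invmx g) x) = zeta R (- q x) * xi x.
  have : lead (psigma (pval (chi x))) (- q x) (zeta R (- q x) * xi x).
    have [E n h] := hl x; split; first by rewrite /psigma E.
      by rewrite mulf_neq0 // zetaE pexp_neq0.
    by move=> r /h; rewrite /psigma => ->; rewrite mulr0.
  rewrite hs => h; have [E1 E2] := lead_uniq (hl (actX (invmx g) x)) h.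
  by split; [apply: oppr_inj|].
have gnu : actA g nu = nu.
  by apply: pA_eq => x; rewrite pA_actA -!hq (Hg x).1.
have hgJ : inWM rt crt sr J g.
  exact: (stabilizer HRD nu_dom Hnu.2 hg gnu).
have [u1 [u2 Exi]] := xi_log hxi.
(* Taking logarithms, moduli agree exactly and arguments modulo 1; the integers left over assemble
   into [y]. *)
have Hx x : pairXA x (actA g u2) = pairXA x u2 /\
    exists m : int, pairXA x (actA g u1 - u1 + nu) = m%:~R.
  have := (Hg x).2; rewrite !Exi zetaE -pexpD add0r rmorphN /= hq.
  move/pexp_inj => [E1 [m Em]]; rewrite pA_actA; split => //; exists m.
  by rewrite -Em pADr pABr pA_actA; ring.
have gu2 : actA g u2 = u2 by apply: pA_eq => x; case: (Hx x).
have [m hm] := fin_all_exists (fun i => (Hx (delta_mx 0 i)).2).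
pose y : X := \row_i m i.
have Ey : actA g u1 - u1 + nu = intv R y.
  by apply/rowP => i; rewrite -pA_delta hm !mxE.
pose s := [seq i <- enum 'I_N | `[< inRJ (rt i) >]].
(* [xi alpha <> 1] means that [<alpha, u1>] is not integral or [<alpha, u2>] is nonzero, which is
   the hypothesis of [avoid_int]. *)
have [|t ht] := @avoid_int R _ s (fun i => pairXA (rt i) u1) (fun i => pairXA (rt i) u2).
  move=> i; rewrite mem_filter => /andP[/asboolP hi _] E2 m'.
  apply/eqP => E1; move/eqP: (hreg i hi); apply.
  by rewrite Exi E1 E2 pexp_int.
pose u := u1 + t *: u2.
have rv : regJ rt sr J (- u).
  move=> i m' hi; rewrite pANr pADr pAZr eqr_oppLR -rmorphN /=.
  by apply: ht; rewrite mem_filter mem_enum andbT; apply/asboolP.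
have Eg : actA g (- u) + intv R y = - u + nu.
  rewrite -Ey actAN actAD actAZ gu2 /u !opprD.
  by move: (actA g u1) => z; apply/rowP => i; rewrite !mxE; ring.
have [v hv' hw] := conj_weak HRD hgJ rv nu_avg Eg.
exists v; first exact: inWM_inW hv'.
exact: (weakW_uniq HRD (wnu_weak HRD Hnu) hw).
Qed.

Lemma Xnu_nonempty : exists c : 'I_(l + k) -> puis R, inXnu rt crt nu c.
Proof.
have [v [y [hv Ev]]] := weakW_fixed HRD (wnu_weak HRD Hnu).
set w := wnu rt crt sr J nu in Ev.
have hwJ : inWM rt crt sr J w by case: (wnu_weak HRD Hnu).
have hw := inWM_inW hwJ.
have [qn hqn] := nu_rational.
pose q x : rat := \sum_i (x 0 i)%:~R * qn i.
have hq x : ratr (q x) = pairXA x nu.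
  by rewrite rmorph_sum; apply: eq_bigr => i _; rewrite rmorphM /= ratr_int hqn.
have qD x x' : q (x + x') = q x + q x'.
  by rewrite -big_split; apply: eq_bigr => i _; rewrite mxE rmorphD mulrDl.
have q00 : q 0 = 0 by rewrite /q big1 // => i _; rewrite mxE mul0r.
have qd i : q (delta_mx 0 i) = qn i.
  rewrite /q (bigD1 i) //= mxE !eqxx mul1r big1 ?addr0 // => j nj.
  by rewrite mxE (negPf nj) andbF mul0r.
(* The monomial point [exp (-2 pi i v) epsilon^(- nu)]; the exponent is [- q x] because
   [val epsilon = -1], and [w v + y = v + nu] turns [sigma] into [w]. *)
pose chi' x : P := Pmono (pexp 0 (- pairXA x v)) (- q x).
have hchi' : ismorph chi'.
  split=> [x x'|]; apply: pval_inj.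
    by rewrite pvalM /= pmonoM qD pADl !opprD -{1}(addr0 0) pexpD.
  by rewrite /= q00 pA0l !oppr0 pexp0.
pose a i := pval (chi' (delta_mx 0 i)).
have ta : torus a.
  move=> i; split; first exact: pvalP.
  exists (pval (chi' (- delta_mx 0 i))); split; first exact: pvalP.
  by rewrite /a -pvalM (morph_inv _ hchi').
have [chi [hchi Echi]] := torus_chi ta.
have Ea x : ev a x = pval (chi' x).
  rewrite Echi; congr pval; apply: (morph_ext hchi hchi') => i.
  apply: pval_inj; rewrite -Echi /ev.
  have [A HA] : exists A : 'I_(l + k) -> P, forall j, A j \is a GRing.unit /\ pval (A j) = a j.
    exists (fun j => chi' (delta_mx 0 j)) => j; split => //.
    by apply/unitrPr; exists (chi' (- delta_mx 0 j)); exact: (morph_inv _ hchi').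
  have -> : \big[@pmul R/pone R]_(j < l + k) ppowz (a j) ((delta_mx 0 i : X) 0 j) =
      pval (\prod_j A j ^ (delta_mx 0 i : X) 0 j).
    rewrite pval_prod; apply: eq_bigr => j _.
    by have [UA <-] := HA j; rewrite ppowzE.
  have Ei : (delta_mx 0 i : X) 0 i = 1 by rewrite mxE !eqxx.
  rewrite (bigD1 i) // big1 => [|j nj]; last by rewrite mxE (negPf nj) andbF expr0z.
  by apply: etrans (congr1 (@pval R) (mulr1 _)) _; rewrite Ei expr1z (HA i).2.
have hV x : HasVal (ev a x) (pairXA x nu).
  by apply/HasValP; exists (q x), (pexp 0 (- pairXA x v)); rewrite Ea; split; [|exact/lead_mono/pexp_neq0].
have hS : sigmaW a w.
  move=> x; rewrite !Ea; have wnu' : actA w nu = nu.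
    exact: (actA_fixed HRD nu_J0 hwJ).
  have Eq : q (actX (invmx w) x) = q x.
    by apply: (fmorph_inj (@ratr R)); rewrite /= !hq -pA_actA wnu'.
  apply/funext => r; rewrite /psigma /= Eq /pmono; case: eqP => [->|]; last by rewrite mulr0.
  rewrite zetaE rmorphN /= hq -pexpD add0r -pA_actA.
  have -> : actA w v = v + nu - intv R y by rewrite -Ev addrK.
  rewrite pABr pADr pA_intv opprB addrC opprD [in RHS]addrC -[0 in RHS]addr0 pexpD.
  by rewrite pexp_int mulr1.
exists (cmap rt crt a); split.
  by exists a; split => //; split => //; split; [exists w|].
exists a; split => //; split => //.
rewrite (OmegaE rt Ea); apply/HasValP.
(* The leading term of [1 - chi' alpha] is the monomial if [<alpha, nu> > 0] and the 1 if it is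
   negative. If it is zero, [alpha] is a root of [M], and the constants cannot cancel because [v]
   lies in the alcove. *)
pose p i := - Num.max 0 (q (rt i)).
have H i : exists d, lead (pval (1 - chi' (rt i))) (p i) d.
  rewrite pvalB /p; have z0 := pexp_neq0 0 (- pairXA (rt i) v).
  have [q0|q0|q0] := ltrgtP 0 (q (rt i)).
  - exists (- pexp 0 (- pairXA (rt i) v)); split; rewrite /psub /pone /= /pmono ?eqxx ?oppr_eq0 //.
      by rewrite gt_eqF // sub0r.
    move=> r hr; rewrite !lt_eqF ?subrr //; apply: lt_trans hr _; by rewrite oppr_lt0.
  - exists 1; split; rewrite /psub /pone /= /pmono ?oner_eq0 // ?oppr0 ?eqxx.
      by rewrite lt_eqF ?subr0 // oppr_gt0.
    by move=> r hr; rewrite !lt_eqF ?subrr //; apply: lt_trans hr _; rewrite oppr_gt0.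
  exists (1 - pexp 0 (- pairXA (rt i) v)); split; rewrite /psub /pone /= /pmono -?q0 ?oppr0 ?eqxx //.
    rewrite subr_eq0; apply/eqP => E.
    have hi : inRJ (rt i).
      by apply/(root_max0 HRD i nu_J0 Hnu.2); rewrite -hq -q0 rmorph0.
    move: (E); rewrite -(pexp0 R) => /pexp_inj[_ [m]]; rewrite sub0r opprK => Em.
    by have := regJ_alcove HRD hv m hi; rewrite -Em eqxx.
  by move=> r hr; rewrite !lt_eqF ?subrr.
have [d hd] := choice H.
exists (- \sum_i p i), (\prod_i d i); split; last by rewrite opprK; exact: lead_prod.
rewrite -sumrN rmorph_sum; apply: eq_bigr => i _; rewrite /p opprK.
rewrite -hq; have [h|h] := lerP 0 (q (rt i)).
  by rewrite [RHS]max_r // ler0q.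
by rewrite [RHS]max_l ?rmorph0 // lerq0 ltW.
Qed.
End Main.

Theorem theorem2p4 (R : realType) (l k N : nat)
  (rt crt : 'I_N -> 'rV[int]_(l + k)) (sr : 'I_l -> 'I_N)
  (HRD : based_root_datum rt crt sr)
  (J : {set 'I_l}) (nu : 'rV[R]_(l + k))
  (Hnu : inNG rt crt sr J nu) :
  (exists c : 'I_(l + k) -> puis R, inXnu rt crt nu c) /\
  forall a : 'I_(l + k) -> puis R, torus a ->
    inXnu rt crt nu (cmap rt crt a) ->
    forall h : 'M[int]_(l + k), inW rt crt h -> sigmaW a h ->
      conjW rt crt h (wnu rt crt sr J nu).
Proof.
split; first exact: (Xnu_nonempty HRD Hnu).
move=> a ta [[a1 [ta1 [E1 [_ v1]]]] [a2 [ta2 [E2 O2]]]] h hh hs.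
have [chi [hc Ec]] := torus_chi ta.
have [chi1 [hc1 Ec1]] := torus_chi ta1.
have [chi2 [hc2 Ec2]] := torus_chi ta2.
have [w1 hw1 Ew1] := cmap_separation HRD hc hc1 Ec Ec1 E1.
have [w2 hw2 Ew2] := cmap_separation HRD hc hc2 Ec Ec2 E2.
have U1 := inW_unit HRD hw1; have Uh := inW_unit HRD hh.
have hi1 := inW_inv HRD hw1.
(* The point [a1], which carries the slope, is the [w1]-translate of [a], so its monodromy is the
   matching conjugate of [h]; [Omega] is carried over from [a2] through [a]. *)
pose g := invmx w1 *m h *m w1.
have hg : inW rt crt g by do 2!apply: inW_mul => //.
have EO : \prod_i (1 - chi1 (rt i)) = \prod_i (1 - chi2 (rt i)).
  transitivity (\prod_i (1 - chi (rt i))).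
    by rewrite -(chi_root_act HRD chi hw1); apply: eq_bigr => i _; rewrite Ew1.
  by rewrite -(chi_root_act HRD chi hw2); apply: eq_bigr => i _; rewrite Ew2.
have [|||u hu Eu] := @monodromy_conj R l k N rt crt sr HRD J nu Hnu chi1 g hc1 hg.
- by move=> x; rewrite -Ec1.
- move=> x; rewrite !Ew1 -Ec hs Ec -!actXM; congr (pval (chi (actX _ _))).
  rewrite /g invmx_mul ?unitmx_mul ?unitmx_inv ?U1 // invmx_mul ?unitmx_inv // invmxK.
  by rewrite mulKVmx.
- by rewrite EO -(OmegaE rt Ec2).
have Uu := inW_unit HRD hu.
exists (w1 *m invmx u); split; first by apply: inW_mul => //; exact: (inW_inv HRD).
rewrite Eu /g invmx_mul ?unitmx_inv // invmxK !mulmxA.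
by rewrite !mulmxKV // mulmxK // mulmxV // mul1mx.
Qed.
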